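(* For any tame $B_1$-persistence modules $M$ and $N$, $d_B(M,N)=d_I(M,N)$.
   Context: Fix a field $k$. $B_1=k[\mathbb{R}_{\ge 0}]$ is the monoid ring of $(\mathbb{R}_{\ge 0},+)$ (''polynomials'' in $x$ with non-negative real exponents). A $B_1$-persistence module is a $B_1$-module $M$ with a $k$-vector space decomposition $M=\bigoplus_{a\in\mathbb{R}}M_a$ such that $x^{\alpha}(M_a)\subset M_{a+\alpha}$ for all $a\in\mathbb{R}$, $\alpha\ge 0$; morphisms are module homomorphisms $f$ with $f(M_a)\subset N_a$ for all $a$. For $a\le b$ the transition map $\varphi_M(a,b):M_a\to M_b$ is multiplication by $x^{b-a}$. $M$ is tame if every $M_a$ is finite dimensional. Interleaving distance: for $\epsilon\ge 0$, $M(\epsilon)$ is the module with $M(\epsilon)_a=M_{a+\epsilon}$ and transition maps $\varphi_{M(\epsilon)}(a,b)=\varphi_M(a+\epsilon,b+\epsilon)$; for a morphism $f$, $f(\epsilon)_a=f_{a+\epsilon}$; $S(M,\epsilon):M\to M(\epsilon)$ is the morphism with $S(M,\epsilon)_a=\varphi_M(a,a+\epsilon)$. $M,N$ are $\epsilon$-interleaved if there are morphisms $f:M\to N(\epsilon)$, $g:N\to M(\epsilon)$ with $g(\epsilon)\circ f=S(M,2\epsilon)$ and $f(\epsilon)\circ g=S(N,2\epsilon)$. $d_I(M,N)=\inf\{\epsilon\ge 0: M,N \text{ are }\epsilon\text{-interleaved}\}\in[0,\infty]$. Bottleneck distance: write $\bar{\mathbb{R}}=\mathbb{R}\cup\{\pm\infty\}$,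 $\bar{\mathbb{Z}}=\mathbb{Z}\cup\{\pm\infty\}$, and for $S\subset\bar{\mathbb{R}}^2$ let $S_+=\{(a,b)\in S: a<b\}$. A persistence diagram is a function $D:\bar{\mathbb{R}}^2_+\to\mathbb{Z}_{\ge 0}$, with support $\mathrm{supp}(D)$. A multibijection between diagrams $D_1,D_2$ is a function $\gamma:\mathrm{supp}(D_1)\times\mathrm{supp}(D_2)\to\mathbb{Z}_{\ge0}$ such that for each $x\in \mathrm{supp}(D_1)$ only finitely many $y$ have $\gamma(x,y)\neq 0$ and $D_1(x)=\sum_y\gamma(x,y)$, and symmetrically for each $y\in\mathrm{supp}(D_2)$ only finitely many $x$ have $\gamma(x,y)\ne 0$ and $D_2(y)=\sum_x\gamma(x,y)$. Let $\mathcal{L}(D_1,D_2)$ be the set of triples $(D_1',D_2',\gamma)$ with $D_1'\le D_1$, $D_2'\le D_2$ persistence diagrams and $\gamma$ a multibijection between $D_1'$ and $D_2'$. With $\|\cdot\|_\infty$ the $\ell^\infty$-norm on the plane extended to $\bar{\mathbb{R}}^2$ (equal infinite coordinates are at distance $0$, a finite and an infinite one at distance $\infty$), $$d_B(D_1,D_2)=\inf_{(D_1',D_2',\gamma)\in\mathcal{L}(D_1,D_2)}\max\Big(\sup_{(a,b)\in \mathrm{supp}(D_1-D_1')\cup\mathrm{supp}(D_2-D_2')}\tfrac12(b-a),\ \sup_{(x,y)\in\mathrm{supp}(\gamma)}\|y-x\|_\infty\Big).$$ A grid function is a strictly increasing $t:\mathbb{Z}\to\mathbb{R}$ whose image has no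 accumulation point; it extends to $\bar t:\bar{\mathbb{Z}}\to\bar{\mathbb{R}}$ by $\bar t(\pm\infty)=\pm\infty$. It is an $\epsilon$-cover if every real number is within $\epsilon$ of $\mathrm{im}(t)$. For $M$ tame, the $t$-discretization of $M$ is the $\mathbb{Z}$-graded $k[x]$-module with degree-$z$ part $M_{t(z)}$ and transition maps $\varphi_M(t(y),t(z))$; by the structure theorem it is a direct sum of interval modules with $D(a,b)$ copies of the interval module supported on $\{z\in\mathbb{Z}:a\le z<b\}$, for a unique $D:\bar{\mathbb{Z}}^2_+\to\mathbb{Z}_{\ge0}$. The diagram of the $t$-discretization is the persistence diagram supported on the image of $\mathrm{supp}(D)$ under $(a,b)\mapsto(\bar t(a),\bar t(b))$ and taking the value $D(a,b)$ at $(\bar t(a),\bar t(b))$. The persistence diagram $D_M$ of $M$ is the limit (in $d_B$) of the diagrams of the $t_i$-discretizations of $M$, for $\{t_i\}_{i\geq 1}$ any sequence of grid functions with $t_i$ a $1/2^i$-cover (it is known that the limit exists and is independent of the sequence). $d_B(M,N):=d_B(D_M,D_N)$. *)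

(* Defs.v *)
From HB Require Import structures.
From mathcomp Require Import all_boot all_order all_algebra.
From mathcomp Require Import all_classical all_reals all_analysis.
From mathcomp Require monalg.
(* The notations of monalg clash with those of MathComp-Analysis. *)
Import -(notations) monalg.

Set Implicit Arguments.
Unset Strict Implicit.
Unset Printing Implicit Defensive.
Import Order.TTheory GRing.Theory Num.Theory.
Import numFieldNormedType.Exports.
Local Open Scope classical_set_scope.
Local Open Scope ring_scope.

Definition expo (R : realType) : Type := {nonneg R}.

Section ExpoMonoid.
Context (R : realType).

HB.instance Definition _ := Choice.on (expo R).

Definition expo_add (a b : expo R) : expo R := (a%:num + b%:num)%:nng.
Definition expo_zero : expo R := 0%:nng.

Fact expo_addA : associative expo_add.
Proof. by move=> a b c; apply/val_inj; rewrite /= addrA. Qed.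

Fact expo_addC : commutative expo_add.
Proof. by move=> a b; apply/val_inj; rewrite /= addrC. Qed.

Fact expo_add0 : left_id expo_zero expo_add.
Proof. by move=> a; apply/val_inj; rewrite /= add0r. Qed.

Fact expo_addr0 : right_id expo_zero expo_add.
Proof. by move=> a; apply/val_inj; rewrite /= addr0. Qed.

Fact expo_add_eq0 (a b : expo R) :
  expo_add a b = expo_zero -> a = expo_zero /\ b = expo_zero.
Proof.
move=> /(congr1 val) /= /eqP; rewrite paddr_eq0 // => /andP[/eqP a0 /eqP b0].
by split; apply/val_inj.
Qed.

(* The monoid law of monalg's monomials is written multiplicatively: it is the
   addition of exponents. *)
HB.instance Definition _ := monalg.Choice_isMonomialDef.Build (expo R)
  expo_addA expo_add0 expo_addr0 expo_add_eq0.
HB.instance Definition _ := monalg.MonomialDef_isConomialDef.Build (expo R)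
  expo_addC.

End ExpoMonoid.

Definition B1 (R : realType) (k : fieldType) : Type := monalg.malg (expo R) k.
HB.instance Definition _ (R : realType) (k : fieldType) :=
  GRing.ComNzRing.on (B1 R k).
HB.instance Definition _ (R : realType) (k : fieldType) :=
  GRing.Lalgebra.on (B1 R k).

Definition xpow (R : realType) (k : fieldType) (a : expo R) : B1 R k :=
  monalg.mkmalgU a 1.

Fact xpow0 (R : realType) (k : fieldType) : xpow k (expo_zero R) = 1.
Proof. by []. Qed.

Fact xpowD (R : realType) (k : fieldType) (a b : expo R) :
  xpow k (expo_add a b) = xpow k a * xpow k b.
Proof. by rewrite /xpow [RHS]monalg.fgmulUU mulr1. Qed.

(* A B_1-module seen as a k-vector space, by restriction of scalars along
   k -> B_1. *)
Definition kspace (R : realType) (k : fieldType) (M : lmodType (B1 R k)) : Type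
  := M.

Section RestrictionOfScalars.
Context (R : realType) (k : fieldType) (M : lmodType (B1 R k)).

HB.instance Definition _ := GRing.Zmodule.on (kspace M).

Definition kscale (c : k) (m : kspace M) : kspace M :=
  (c%:A : B1 R k) *: (m : M).

Fact kscaleA c d m : kscale c (kscale d m) = kscale (c * d) m.
Proof.
have algM (A : lalgType k) : c%:A * d%:A = (c * d)%:A :> A.
  by rewrite -scalerAl mul1r scalerA.
by rewrite /kscale -algM; exact: scalerA.
Qed.

Fact kscale1 : left_id 1 kscale.
Proof. by move=> m; rewrite /kscale scale1r scale1r. Qed.

Fact kscaleDr : right_distributive kscale +%R.
Proof. by move=> c m n; rewrite /kscale scalerDr. Qed.

Fact kscaleDl m : {morph kscale^~ m : c d / c + d}.
Proof. by move=> c d; rewrite /kscale scalerDl scalerDl. Qed.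

HB.instance Definition _ := GRing.Zmodule_isLmodule.Build k (kspace M)
  kscaleA kscale1 kscaleDr kscaleDl.

End RestrictionOfScalars.

(* V is the (internal) direct sum of the subsets P i, which are meant to be
   submodules. *)
Definition direct_decomposition (V : zmodType) (I : eqType) (P : I -> set V) :=
  (forall v : V, exists (s : seq I) (u : I -> V),
     [/\ uniq s, forall i, P i (u i) & v = \sum_(i <- s) u i]) /\
  (forall (s : seq I) (u : I -> V), uniq s -> (forall i, P i (u i)) ->
     \sum_(i <- s) u i = 0 -> forall i, i \in s -> u i = 0).

Record persmod (R : realType) (k : fieldType) := PersMod {
  pcar :> lmodType (B1 R k);
  pdeg : R -> set (kspace pcar);
  pdeg0 : forall a, pdeg a 0;
  pdeg_lin : forall a (c : k) u v, pdeg a u -> pdeg a v -> pdeg a (c *: u + v);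
  pdeg_direct : direct_decomposition pdeg;
  pdeg_xpow : forall a (e : expo R) (m : pcar),
    pdeg a m -> pdeg (a + e%:num) (xpow k e *: m) }.

Record persmor (R : realType) (k : fieldType) (M N : persmod R k) := PersMor {
  pfun :> {linear M -> N};
  pfun_deg : forall a m, pdeg a m -> pdeg a (pfun m) }.

Definition hpart (R : realType) (k : fieldType) (M : persmod R k) (a : R) : Type
  := {m : kspace M | m \in @pdeg R k M a}.

Section HomogeneousPart.
Context (R : realType) (k : fieldType) (M : persmod R k).

Definition in_pdeg (a : R) : {pred kspace M} := fun m => m \in @pdeg R k M a.

Fact in_pdeg_submod a : submod_closed (in_pdeg a).
Proof.
split=> [|c u v]; rewrite /in_pdeg; first by apply: mem_set; exact: pdeg0.
by move=> /set_mem u_a /set_mem v_a; apply: mem_set; exact: pdeg_lin.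
Qed.

HB.instance Definition _ a := GRing.isSubmodClosed.Build k (kspace M) (in_pdeg a)
  (in_pdeg_submod a).
HB.instance Definition _ a := SubChoice.copy (hpart M a) {m | in_pdeg a m}.
HB.instance Definition _ a := [SubChoice_isSubLmodule of hpart M a by <:].

End HomogeneousPart.

Definition fin_dim (k : fieldType) (V : lmodType k) : Prop :=
  exists (n : nat) (b : 'I_n -> V), forall v, exists c : 'I_n -> k,
    v = \sum_(i < n) c i *: b i.

Definition tame (R : realType) (k : fieldType) (M : persmod R k) : Prop :=
  forall a, fin_dim (hpart M a).

Section TransitionMaps.
Context (R : realType) (k : fieldType) (M : persmod R k).

Fact gap_subproof (a b : R) : a <= b -> 0 <= b - a.
Proof. by rewrite subr_ge0. Qed.

Definition gap (a b : R) (ab : a <= b) : expo R := NngNum (gap_subproof ab).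

Fact phi_subproof a b (ab : a <= b) (m : hpart M a) :
  (xpow k (gap ab) *: (val m : M) : kspace M) \in @pdeg R k M b.
Proof.
have ma : pdeg a (val m) by exact: set_mem (valP m).
apply: mem_set.
by have := pdeg_xpow (gap ab) ma; rewrite /= subrKC.
Qed.

Definition phi a b (ab : a <= b) (m : hpart M a) : hpart M b :=
  Sub (xpow k (gap ab) *: (val m : M)) (phi_subproof ab m).

Fact phi_linear a b (ab : a <= b) : linear (phi ab).
Proof.
have scalerAC (A : comNzRingType) (V : lmodType A) (p q : A) (v : V) :
  p *: (q *: v) = q *: (p *: v) by rewrite !scalerA mulrC.
move=> c u v; apply/val_inj.
transitivity (xpow k (gap ab) *: (c%:A *: (val u : M) + (val v : M))) => //.
by rewrite scalerDr scalerAC.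
Qed.

HB.instance Definition _ a b (ab : a <= b) :=
  GRing.isLinear.Build k (hpart M a) (hpart M b) _ (phi ab) (phi_linear ab).

End TransitionMaps.

Section Shift.
Context (R : realType) (k : fieldType).

Section ShiftModule.
Context (M : persmod R k) (e : expo R).

Definition shift_deg (a : R) : set (kspace M) := @pdeg R k M (a + e%:num).

Fact shift_deg_direct : direct_decomposition shift_deg.
Proof.
have [gen ind] := pdeg_direct M; split=> [v|s u us uP].
  have [s [u [us uP ->]]] := gen v.
  exists [seq a - e%:num | a <- s], (fun a => u (a + e%:num)); split.
  - by rewrite map_inj_uniq//; exact: addIr.
  - by move=> a; exact: uP.
  - by rewrite big_map; apply: eq_bigr => a _; rewrite subrK.
move=> u0 a sa.
have := ind [seq b + e%:num | b <- s] (fun b => u (b - e%:num)).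
rewrite map_inj_uniq; last exact: addIr.
move=> /(_ us) H; have := H _ _ (a + e%:num); rewrite addrK; apply.
- by move=> b; have := uP (b - e%:num); rewrite /shift_deg subrK.
- by rewrite big_map -[RHS]u0; apply: eq_bigr => b _; rewrite addrK.
- exact: map_f.
Qed.

Fact shift_deg_xpow a (d : expo R) (m : M) :
  shift_deg a m -> shift_deg (a + d%:num) (xpow k d *: m).
Proof. by move=> /(pdeg_xpow d); rewrite /shift_deg addrAC. Qed.

Definition shift : persmod R k :=
  @PersMod R k (pcar M) shift_deg (fun a => pdeg0 M (a + e%:num))
    (fun a => @pdeg_lin R k M (a + e%:num)) shift_deg_direct shift_deg_xpow.

Fact smor_deg a m : pdeg a m -> @pdeg R k shift a (xpow k e *: (m : M)).
Proof. exact: pdeg_xpow. Qed.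

(* In degree a this is phi from a to a + e. *)
Definition smor : persmor M shift :=
  @PersMor R k M shift (GRing.scale (xpow k e) : {linear M -> M}) smor_deg.

End ShiftModule.

Definition shift_mor (M N : persmod R k) (e : expo R) (f : persmor M N) :
    persmor (shift M e) (shift N e) :=
  @PersMor R k (shift M e) (shift N e) (pfun f)
    (fun a => @pfun_deg R k M N f (a + e%:num)).

(* The underlying modules of M, M(e) and M(e)(e) coincide, only the degrees
   change; likewise for f and f(e). *)
Definition interleaved (M N : persmod R k) (e : expo R) : Prop :=
  exists (f : persmor M (shift N e)) (g : persmor N (shift M e)),
    (forall m : M, shift_mor e g (f m) = smor M (expo_add e e) m :> M) /\
    (forall n : N, shift_mor e f (g n) = smor N (expo_add e e) n :> N).

Definition dI (M N : persmod R k) : \bar R :=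
  ereal_inf [set (e%:num)%:E | e in [set e : expo R | interleaved M N e]].

End Shift.

Definition upper (G : numDomainType) : Type :=
  {p : \bar G * \bar G | (p.1 < p.2)%E}.
HB.instance Definition _ (G : numDomainType) := Choice.on (upper G).

Definition diagram (G : numDomainType) : Type := upper G -> nat.
HB.instance Definition _ (G : numDomainType) := Choice.on (diagram G).

Definition supp (G : numDomainType) (D : diagram G) : Type :=
  {x : upper G | D x != 0%N}.
HB.instance Definition _ (G : numDomainType) (D : diagram G) :=
  Choice.on (supp D).

Definition multibijection (G : numDomainType) (D1 D2 : diagram G)
    (g : supp D1 -> supp D2 -> nat) : Prop :=
  (forall x, finite_set [set y | g x y != 0%N] /\
     D1 (val x) = \big[addn/0%N]_(y \in [set: supp D2]) g x y) /\
  (forall y, finite_set [set x | g x y != 0%N] /\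
     D2 (val y) = \big[addn/0%N]_(x \in [set: supp D1]) g x y).

Record matching (G : numDomainType) (D1 D2 : diagram G) := Matching {
  mdom1 : diagram G;
  mdom2 : diagram G;
  mmult : supp mdom1 -> supp mdom2 -> nat;
  mdom1_le : forall x, (mdom1 x <= D1 x)%N;
  mdom2_le : forall x, (mdom2 x <= D2 x)%N;
  mmultP : multibijection mmult }.

Section Bottleneck.
Context (R : realType).
Local Open Scope ereal_scope.

Definition bar_dist (a b : \bar R) : \bar R := if a == b then 0 else `|a - b|.

Definition linf_dist (p q : \bar R * \bar R) : \bar R :=
  maxe (bar_dist p.1 q.1) (bar_dist p.2 q.2).

Definition half_persistence (p : \bar R * \bar R) : \bar R :=
  (2^-1)%R%:E * (p.2 - p.1).

(* The supremum in [0, +oo], for which sup set0 = 0. *)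
Definition sup0 (A : set (\bar R)) : \bar R := ereal_sup (0 |` A).

Definition matching_cost (D1 D2 : diagram R) (m : matching D1 D2) : \bar R :=
  maxe
    (sup0 [set half_persistence (val p) | p in
       [set p : upper R | (D1 p - mdom1 m p != 0)%N] `|`
       [set p : upper R | (D2 p - mdom2 m p != 0)%N]])
    (sup0 [set linf_dist (val (val q.1)) (val (val q.2)) | q in
       [set q : supp (mdom1 m) * supp (mdom2 m) | mmult q.1 q.2 != 0%N]]).

Definition dB (D1 D2 : diagram R) : \bar R :=
  ereal_inf (range (@matching_cost D1 D2)).

End Bottleneck.

(* A Z-graded k[x]-module is given by its homogeneous parts and by the
   multiplications by x^(z - y) from degree y to degree z. *)
Record zgraded (k : fieldType) := ZGraded {
  zpart : int -> lmodType k;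
  ztr : forall y z : int, y <= z -> {linear zpart y -> zpart z};
  ztr_id : forall z (zz : z <= z) v, ztr zz v = v;
  ztr_comp : forall y z w (yz : y <= z) (zw : z <= w) (yw : y <= w) v,
    ztr zw (ztr yz v) = ztr yw v }.

Arguments ztr {k} _ {y z}.

Record zmor (k : fieldType) (V W : zgraded k) := ZMor {
  zfun : forall z, {linear zpart V z -> zpart W z};
  zfun_tr : forall y z (yz : y <= z) v,
    zfun z (ztr V yz v) = ztr W yz (zfun y v) }.

Definition is_direct_sum (k : fieldType) (J : eqType) (W : J -> zgraded k)
    (V : zgraded k) : Prop :=
  exists i : forall j, zmor (W j) V,
    (forall j z, injective (zfun (i j) z)) /\
    (forall z, direct_decomposition (fun j => range (zfun (i j) z))).

Section IntervalModule.
Context (k : fieldType) (I : upper int).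

Definition in_interval (z : int) : bool :=
  ((val I).1 <= z%:E)%E && (z%:E < (val I).2)%E.

(* 'rV[k]_b is k if b holds, and 0 otherwise. *)
Definition interval_part (z : int) : lmodType k := 'rV[k]_(in_interval z).

(* The 1 x 1, or empty, matrix with all entries 1. *)
Definition interval_tr (y z : int) (yz : y <= z) :
    {linear interval_part y -> interval_part z} :=
  mulmxr (const_mx 1 : 'M[k]_(in_interval y, in_interval z)).

Fact interval_tr_id z (zz : z <= z) v : interval_tr zz v = v.
Proof.
have E1 (b : bool) : const_mx 1 = 1%:M :> 'M[k]_b.
  by apply/matrixP; case: b => i j; [rewrite !mxE !ord1 | case: i].
by rewrite /= E1 mulmx1.
Qed.

Fact interval_tr_comp y z w (yz : y <= z) (zw : z <= w) (yw : y <= w) v :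
  interval_tr zw (interval_tr yz v) = interval_tr yw v.
Proof.
have conv : in_interval y -> in_interval w -> in_interval z.
  move=> /andP[ay _] /andP[_ wb]; apply/andP; split.
    by rewrite (le_trans ay) // lee_fin.
  by rewrite (le_lt_trans _ wb) // lee_fin.
have EM (b c d : bool) : (b -> d -> c) ->
    (const_mx 1 : 'M[k]_(b, c)) *m const_mx 1 = const_mx 1 :> 'M[k]_(b, d).
  case: b c d => [] [] [] // bcd; apply/matrixP => i j;
    try by [case: i | case: j | have := bcd isT isT].
  by rewrite !mxE big_ord1 !mxE mulr1.
by rewrite /= -mulmxA EM.
Qed.

Definition interval_module : zgraded k :=
  ZGraded interval_tr_id interval_tr_comp.

End IntervalModule.

(* V is a direct sum of interval modules, D p of which have interval p. *)
Definition interval_decomposition (k : fieldType) (V : zgraded k)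
    (D : diagram int) : Prop :=
  is_direct_sum
    (fun j : {j : upper int * nat | (j.2 < D j.1)%N} =>
       interval_module k (val j).1) V.

Record grid (R : realType) := Grid {
  gfun :> int -> R;
  grid_lt : {homo gfun : y z / y < z};
  grid_acc : limit_point (range gfun) = set0 }.

Definition cover (R : realType) (e : R) (t : grid R) : Prop :=
  forall x : R, exists z : int, `|x - t z| <= e.

Section Discretization.
Context (R : realType) (k : fieldType).

Fact grid_le (t : grid R) y z : y <= z -> t y <= t z.
Proof.
by rewrite le_eqVlt => /predU1P[->//|yz]; apply/ltW/grid_lt.
Qed.

Fact phi_id (M : persmod R k) a (aa : a <= a) (m : hpart M a) : phi aa m = m.
Proof.
apply/val_inj; transitivity ((1 : B1 R k) *: (val m : M));
  last exact: (@scale1r _ (pcar M)).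
rewrite -(xpow0 R k) /= (_ : gap aa = expo_zero R) //.
by apply/val_inj; rewrite /= subrr.
Qed.

Fact phi_comp (M : persmod R k) a b c (ab : a <= b) (bc : b <= c) (ac : a <= c)
  (m : hpart M a) : phi bc (phi ab m) = phi ac m.
Proof.
apply/val_inj.
transitivity (xpow k (gap bc) *: (xpow k (gap ab) *: (val m : M))) => //.
rewrite scalerA -xpowD (_ : expo_add _ _ = gap ac) //.
by apply/val_inj; rewrite /= subrKA.
Qed.

Definition discretization (M : persmod R k) (t : grid R) : zgraded k :=
  @ZGraded k (fun z => hpart M (t z)) (fun y z yz => phi (grid_le t yz))
    (fun z zz => phi_id (grid_le t zz))
    (fun y z w yz zw yw => phi_comp (grid_le t yz) (grid_le t zw) (grid_le t yw)).

(* E is the image of D under (a, b) |-> (t a, t b). *)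
Definition is_grid_image (t : grid R) (D : diagram int) (E : diagram R) : Prop :=
  (forall p, E p != 0%N -> exists2 q, D q != 0%N &
     val p = (er_map t (val q).1, er_map t (val q).2)) /\
  (forall p q, val p = (er_map t (val q).1, er_map t (val q).2) -> E p = D q).

Definition is_discretization_diagram (M : persmod R k) (t : grid R)
    (E : diagram R) : Prop :=
  exists2 D, interval_decomposition (discretization M t) D & is_grid_image t D E.

(* The diagram of the discretization exists and is unique for tame M (structure
   theorem); the default value of xget is only taken otherwise. *)
Definition discretization_diagram (M : persmod R k) (t : grid R) : diagram R :=
  xget ((fun=> 0%N) : diagram R) [set E | is_discretization_diagram M t E].

(* D is a limit, for dB, of the diagrams of the discretizations along every
   admissible sequence of grids; only the indices i >= 1 are constrained. *)
Definition is_persistence_diagram (M : persmod R k) (D : diagram R) : Prop :=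
  forall t : nat -> grid R,
    (forall i, (0 < i)%N -> cover ((2^-1) ^+ i) (t i)) ->
    dB (discretization_diagram M (t i)) D @[i --> \oo] --> 0%E.

Definition persistence_diagram (M : persmod R k) : diagram R :=
  xget ((fun=> 0%N) : diagram R) [set D | is_persistence_diagram M D].

Definition dB_mod (M N : persmod R k) : \bar R :=
  dB (persistence_diagram M) (persistence_diagram N).

End Discretization.

(* Main.v *)
From HB Require Import structures.
Require Import Defs.
From mathcomp Require Import all_boot all_order all_algebra.
From mathcomp Require Import all_classical all_reals all_analysis.
From mathcomp Require Import zify lra.
From mathcomp Require monalg.

(* A pointwise finite-dimensional system over R splits off an interval summand
   through any degree s where it is nonzero: take a vector in the smallest
   nonzero image in degree s, outside the largest kernel not containing that
   image, and lift it backwards, and a dual functional forwards, by a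
   Mittag-Leffler argument. Doing so at all rationals, each visited infinitely
   often, leaves a remainder with zero transition maps, which diagrams do not
   see.

   For stability, let M and N be d-interleaved by f and g. On the bars of M
   longer than 2 d, ordered by midpoint, the matrix of g o f is unitriangular,
   and its entries on and above the diagonal only involve bars of N at distance
   at most d from the row or column bar. Comparing ranks gives Hall's condition,
   hence, by compactness, an injection of the long bars of M into the bars of N;
   the two injections are combined as in the Cantor-Bernstein theorem.

   Conversely, a matching of cost c gives a d-interleaving for every d > c by
   sending each bar to its partner. Finally, the t-discretization of M, extended
   to R by rounding down to the grid t, is 2 d-interleaved with M when t is a
   d-cover, so by stability the diagrams of the discretizations converge to the
   barcode of M. *)

Set Implicit Arguments.
Unset Strict Implicit.
Unset Printing Implicit Defensive.
Import Order.TTheory GRing.Theory Num.Theory.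
Import numFieldNormedType.Exports.
Local Open Scope classical_set_scope.
Local Open Scope ring_scope.

(** * Bars and the interval decomposition *)

(** The rank comparison behind Hall's condition survives a restriction to few bars. For finitely
    many long bars of M, keep only the bars of N near one of them: this may alter the entries of g o
    f below the diagonal, but no others, so the product is still invertible and cannot factor
    through fewer bars than it has rows. Bars of length at most 2 d may be killed by the shift by 2
    d, but they can stay unmatched at cost at most d.

    A diagram records the endpoints of a bar, not whether they belong to it. Hence a matching of
    cost c gives interleavings only for d > c, and bars reduced to a point are dropped; the infima
    do not notice.

    The diagrams in the statement are chosen values: some interval decomposition for each
    discretization, some limit for D_M. Uniqueness is replaced by closeness: every decomposition
    yields a barcode to which stability applies, and two limits of the same sequence are arbitrarily
    close for d_B. *)

Definition msystem (k : fieldType) d (T : orderType d) (n : T -> nat) :=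
  forall a b : T, 'M[k]_(n a, n b).

(* B a a is idempotent but need not be 1: B then stands for the system of the
   images of the B a a, so that passing to a direct summand does not change the
   dimensions. *)
Definition is_msystem (k : fieldType) d (T : orderType d) (n : T -> nat)
    (B : msystem k n) :=
  forall a b c, (a <= b)%O -> (b <= c)%O -> B a b *m B b c = B a c.

(** With weak inequalities this covers the rationals in R as well as an enumeration of Z, and it is
    invariant under reversing the order. *)
Definition order_dense d (T : orderType d) (q : nat -> T) :=
  forall x y, (x < y)%O -> exists n, (x <= q n <= y)%O.

Lemma ex_min_nat (T : Type) (P : T -> Prop) (f : T -> nat) :
  (exists x, P x) -> exists2 x, P x & forall y, P y -> (f x <= f y)%N.
Proof.
case=> x Px; have [n] := ubnP (f x); elim: n => // n IHn in x Px * => fxn.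
have [|/existsNP[y /not_implyP[Py /negP fyx]]] :=
  pselect (forall y, P y -> (f x <= f y)%N); first by exists x.
by apply: (IHn y) => //; rewrite -ltnNge in fyx; exact: leq_trans fyx fxn.
Qed.

Lemma row_dual (k : fieldType) n (v : 'rV[k]_n) :
  v != 0 -> exists y : 'cV_n, v *m y = 1.
Proof.
move=> v0; have [j vj] : exists j, v 0 j != 0.
  apply/existsP; apply: contra_neqT v0 => /existsPn H.
  by apply/rowP => j; rewrite [RHS]mxE; apply/eqP; rewrite -[_ == _]negbK.
exists ((v 0 j)^-1 *: delta_mx j 0); rewrite -scalemxAr -colE.
by apply/matrixP => a b; rewrite !ord1 !mxE eqxx mulVf.
Qed.

Section CoherentLift.
Context (k : fieldType) (disp : Order.disp_t) (T : orderType disp).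
Context (n : T -> nat) (B : msystem k n) (BP : is_msystem B).
Context (q : nat -> T) (qP : order_dense q).
Context (s : T) (L : set T).
Hypotheses (Ls : L s) (L_le : forall r, L r -> (r <= s)%O)
  (L_up : forall r r', L r -> (r <= r')%O -> (r' <= s)%O -> L r').

(** If [L] has no minimum, below each [r] in [L] there is some [r' < r] in [L], and the term of [q]
    between them is again in [L]. Terms of [q] outside [L] are replaced by [s]. *)
Lemma coinitial_seq :
  exists u : nat -> T, (forall i, L (u i)) /\
    forall r, L r -> exists i, (u i <= r)%O.
Proof.
have [[m Lm mP]|nomin] := pselect (exists2 m, L m & forall r, L r -> (m <= r)%O).
  by exists (fun=> m); split=> // r /mP mr; exists 0%N.
exists (fun i => if `[< L (q i) >] then q i else s); split=> [i|r Lr].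
  by case: ifPn => // /asboolP.
have [r' Lr' r'r] : exists2 r', L r' & (r' < r)%O.
  apply: contrapT => H; apply: nomin; exists r => // r' Lr'.
  by rewrite leNgt; apply/negP => r'r; apply: H; exists r'.
have [i /andP[r'q qr]] := qP r'r; exists i.
by rewrite asboolT //; apply: L_up r'q (le_trans qr (L_le Lr)).
Qed.

Let stable r (v : 'rV[k]_(n r)) :=
  forall r', L r' -> (r' <= r)%O -> (v <= B r' r)%MS.

(** The images of [B x r'] shrink as [x] decreases, so one of minimal rank, at some [x] in [L], is
    contained in all the others. Lifting [v] to degree [x] and pushing it forward to [r'] gives a
    stable vector. *)
Lemma stable_lift r (v : 'rV[k]_(n r)) r' : L r -> stable v -> L r' ->
  (r' <= r)%O -> exists2 v' : 'rV[k]_(n r'), stable v' & v' *m B r' r = v.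
Proof.
move=> Lr sv Lr' r'r.
have [|x [Lx xr'] xP] := @ex_min_nat T (fun x => L x /\ (x <= r')%O)
  (fun x => \rank (B x r')).
  by exists r'.
have /submxP[w wv] := sv _ Lx (le_trans xr' r'r).
exists (w *m B x r'); last by rewrite -mulmxA BP.
move=> y Ly yr'; have [xy|yx] := leP x y.
  by rewrite -(BP xy yr') mulmxA submxMl.
apply: submx_trans (submxMl _ _) _.
have := submxMl (B y x) (B x r'); rewrite (BP (ltW yx) xr') => yxr'.
by rewrite -(geq_leqif (mxrank_leqif_sup yxr')) xP.
Qed.

(* Mittag-Leffler: stable images have surjective transition maps, so that
   vectors can be lifted step by step along a coinitial sequence. *)
Lemma coherent_lift (e : 'rV[k]_(n s)) :
  (forall r, L r -> (e <= B r s)%MS) ->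
  exists f : forall r, 'rV[k]_(n r), [/\ forall r, ~ L r -> f r = 0,
    forall r r', L r -> L r' -> (r <= r')%O -> f r *m B r r' = f r' &
    f s = e].
Proof.
move=> eB; have [u [Lu uP]] := coinitial_seq.
pose r := fix r i := if i is j.+1 then Order.min (r j) (u j) else s.
have Lr i : L (r i) by elim: i => //= i IHi; rewrite minEle; case: ifP.
have rS i : (r i.+1 <= r i)%O by rewrite /= ge_min lexx.
have r_le i j : (i <= j)%N -> (r j <= r i)%O.
  elim: j => [|j IHj]; first by rewrite leqn0 => /eqP->.
  by rewrite leq_eqVlt => /predU1P[->//|/IHj]; apply: le_trans (rS j).
pose st i (v : 'rV[k]_(n (r i))) : 'rV_(n (r i.+1)) :=
  xget 0 [set w | stable w /\ w *m B (r i.+1) (r i) = v].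
have stP i v : stable v -> stable (st i v) /\ st i v *m B (r i.+1) (r i) = v.
  move=> sv; have [w sw wv] := stable_lift (Lr i) sv (Lr i.+1) (rS i).
  by apply: (@xgetPex _ 0 [set w | stable w /\ w *m B _ _ = v]); exists w.
pose v := fix v i : 'rV[k]_(n (r i)) := if i is j.+1 then st j (v j) else e.
have vS i : stable (v i).
  by elim: i => [|i IHi]; [move=> x Lx _; exact: eB | exact: (stP i _ IHi).1].
(* [B x x] is only idempotent: it fixes the vectors of its image, not all vectors. *)
have fixB x y : (y <= B x x)%MS -> y *m B x x = y.
  by move=> /submxP[w ->]; rewrite -mulmxA BP.
have vE i j : (i <= j)%N -> v j *m B (r j) (r i) = v i.
  elim: j => [|j IHj]; first by rewrite leqn0 => /eqP->; rewrite fixB ?eB.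
  rewrite leq_eqVlt => /predU1P[->|ij]; first by rewrite fixB ?vS.
  by rewrite -(BP (rS j) (r_le i j ij)) mulmxA (stP _ _ (vS _)).2 IHj.
have /choice[m mP] : forall x, exists i, L x -> (r i <= x)%O.
  move=> x; have [/uP[i ux]|] := pselect (L x); last by exists 0%N.
  by exists i.+1 => _; rewrite /= ge_min ux orbT.
pose f x : 'rV_(n x) := if `[< L x >] then v (m x) *m B (r (m x)) x else 0.
(* Any index [i] with [r i] below [x] computes [f x]; two degrees can therefore be compared through
   a common index. *)
have fE x i : L x -> (r i <= x)%O -> f x = v i *m B (r i) x.
  move=> Lx rx; rewrite /f asboolT //.
  have [im|/ltnW mi] := leqP i (m x).
    by rewrite -(vE _ _ im) -mulmxA BP // r_le.
  by rewrite -(vE _ _ mi) -mulmxA BP ?r_le ?mP.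
exists f; split=> [x nLx|x y Lx Ly xy|]; first by rewrite /f asboolF.
  rewrite (fE y (m x)) ?(fE x (m x)) ?mP // -?mulmxA ?BP ?mP //.
  by apply: le_trans xy; exact: mP.
by rewrite (fE s 0%N) //= fixB ?eB.
Qed.
End CoherentLift.

(** [e] is a morphism from the interval module of [I] to the system and [p] a morphism back;
    [bar_ep] makes [p] a retraction of [e], so the bar is a direct summand. *)
Record is_bar (k : fieldType) d (T : orderType d) (n : T -> nat)
    (B : msystem k n) (I : set T) (e : forall a, 'rV[k]_(n a))
    (p : forall a, 'cV[k]_(n a)) : Prop := IsBar {
  bar_convex : forall a b c, (a <= b)%O -> (b <= c)%O -> I a -> I c -> I b;
  bar_e0 : forall a, ~ I a -> e a = 0;
  bar_p0 : forall a, ~ I a -> p a = 0;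
  bar_eB : forall a b, (a <= b)%O -> I a -> e a *m B a b = e b;
  bar_Bp : forall a b, (a <= b)%O -> I b -> B a b *m p b = p a;
  bar_ep : forall a, I a -> e a *m p a = 1 }.

Section SplitOff.
Context (k : fieldType) (disp : Order.disp_t) (T : orderType disp).
Context (n : T -> nat) (B : msystem k n) (BP : is_msystem B).
Context (q : nat -> T) (qP : order_dense q).

(** This is [coherent_lift] for the reversed order and the transposed matrices. *)
Lemma coherent_colift (s : T) (U : set T) (p : 'cV[k]_(n s)) : U s ->
  (forall t, U t -> (s <= t)%O) ->
  (forall t t', U t -> (t' <= t)%O -> (s <= t')%O -> U t') ->
  (forall t, U t -> (p^T <= (B s t)^T)%MS) ->
  exists f : forall t, 'cV[k]_(n t), [/\ forall t, ~ U t -> f t = 0,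
    forall t t', U t -> U t' -> (t <= t')%O -> B t t' *m f t' = f t & f s = p].
Proof.
move=> Us U_ge U_dn pB; pose Td : orderType _ := T^d%O.
pose Bd : @msystem k _ Td n := fun a b => (B b a)^T.
have BdP : is_msystem Bd.
  by move=> a b c ab bc; rewrite /Bd -trmx_mul BP.
have qdP : @order_dense _ Td q.
  by move=> x y /qP[i /andP[]]; exists i; apply/andP.
have [f [f0 fB fs]] := @coherent_lift k _ Td n Bd BdP q qdP s U Us U_ge U_dn p^T pB.
exists (fun t => (f t)^T); split=> [t /f0->|t t' Ut Ut' tt'|].
- exact: trmx0.
- by rewrite -(fB t' t Ut' Ut tt') trmx_mul trmxK.
- by rewrite fs trmxK.
Qed.

(* Take e in the smallest nonzero image in degree s but outside the largest
   kernel K not containing that image, and a functional vanishing on K: then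
   they pair to zero with nothing but the bar itself. *)
Lemma split_off (s : T) : B s s != 0 ->
  exists I e p, is_bar B I e p /\ I s.
Proof.
move=> Bss.
have [|r0 [r0s Br0] r0P] := @ex_min_nat T (fun r => (r <= s)%O /\ B r s != 0)
  (fun r => \rank (B r s)); first by exists s.
have r0_sub r : (r <= s)%O -> B r s != 0 -> (B r0 s <= B r s)%MS.
  move=> rs Brs; have [rr0|r0r] := leP r r0.
    have sub : (B r s <= B r0 s)%MS by rewrite -(BP rr0 r0s) submxMl.
    by rewrite -(geq_leqif (mxrank_leqif_sup sub)) r0P.
  by rewrite -(BP (ltW r0r) rs) submxMl.
(* Minimal rank of [B s t] means maximal kernel, and [B r0 t != 0] says that this kernel does not
   contain the image of [B r0 s]. *)
have [|t0 [st0 Bt0] t0P] := @ex_min_nat T (fun t => (s <= t)%O /\ B r0 t != 0)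
  (fun t => \rank (B s t)); first by exists s.
have t0_sub t : (s <= t)%O -> B r0 t != 0 -> ((B s t0)^T <= (B s t)^T)%MS.
  move=> st Brt; have [tt0|t0t] := leP t t0.
    by rewrite -(BP st tt0) trmx_mul submxMl.
  have sub : ((B s t)^T <= (B s t0)^T)%MS.
    by rewrite -(BP st0 (ltW t0t)) trmx_mul submxMl.
  by rewrite -(geq_leqif (mxrank_leqif_sup sub)) !mxrank_tr t0P.
have [i ei] : exists i, row i (B r0 s) *m B s t0 != 0.
  apply/existsP; apply: contra_neqT Bt0 => /existsPn H.
  rewrite -(BP r0s st0); apply/row_matrixP => i.
  by rewrite row_mul row0; apply/eqP; rewrite -[_ == _]negbK.
set es := row i _ in ei.
have [y ey] := row_dual ei.
(* Factoring through [B s t0] makes the functional vanish on the chosen kernel, while it takes the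
   value 1 on [es]. *)
pose ps := B s t0 *m y.
have esB : (es <= B r0 s)%MS by rewrite row_sub.
have es1 r : (r <= s)%O -> B r s != 0 -> (es <= B r s)%MS.
  by move=> rs Brs; apply: submx_trans esB _; exact: r0_sub.
have ps1 t : (s <= t)%O -> B r0 t != 0 -> (ps^T <= (B s t)^T)%MS.
  move=> st Brt; rewrite /ps trmx_mul; apply: submx_trans (submxMl _ _) _.
  exact: t0_sub.
have es0 t : (s <= t)%O -> B r0 t = 0 -> es *m B s t = 0.
  by move=> st Brt; rewrite /es -row_mul BP // Brt row0.
(* Degrees below [s] in [L] have an image in degree [s] containing [es]; degrees above [s] in [U]
   have a kernel on which [ps] vanishes. Outside these, [ps] pulls back to 0 and [es] is sent to
   0. *)
pose L := [set r | (r <= s)%O /\ B r s != 0].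
pose U := [set t | (s <= t)%O /\ B r0 t != 0].
have [|||r [] //|f [f0 fB fs]] := @coherent_lift k _ T n B BP q qP s L _ _ _ es.
- by [].
- by move=> r [].
- move=> r r' [rs Brs] rr' r's; split=> //; apply: contra_neq Brs => B0.
  by rewrite -(BP rr' r's) B0 mulmx0.
- exact: es1.
have [|||t [] //|g [g0 gB gs]] := @coherent_colift s U ps.
- by [].
- by move=> t [].
- move=> t t' [st Bt] t't st'; split=> //; apply: contra_neq Bt => B0.
  by rewrite -(BP (le_trans r0s st') t't) B0 mul0mx.
- exact: ps1.
have Ls : L s by [].
have Us : U s by [].
have es_ps : es *m ps = 1 by rewrite mulmxA.
have L_up a b : L a -> (a <= b)%O -> (b <= s)%O -> L b.
  move=> [as_ Ba] ab bs; split=> //; apply: contra_neq Ba => B0.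
  by rewrite -(BP ab bs) B0 mulmx0.
have U_dn a b : U b -> (s <= a)%O -> (a <= b)%O -> U a.
  move=> [sb Bb] sa ab; split=> //; apply: contra_neq Bb => B0.
  by rewrite -(BP (le_trans r0s sa) ab) B0 mul0mx.
pose e a : 'rV_(n a) := if (a <= s)%O then f a else es *m B s a.
pose p a : 'cV_(n a) := if (s <= a)%O then g a else B a s *m ps.
have eE a : (s <= a)%O -> e a = es *m B s a.
  move=> sa; rewrite /e; case: ifPn => // as_.
  have -> : a = s by apply/eqP; rewrite eq_le as_.
  by rewrite -fs fB.
have pE a : (a <= s)%O -> p a = B a s *m ps.
  move=> as_; rewrite /p; case: ifPn => // sa.
  have -> : a = s by apply/eqP; rewrite eq_le as_.
  by rewrite -gs gB.
have eL a : (a <= s)%O -> e a = f a by rewrite /e => ->.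
have pU a : (s <= a)%O -> p a = g a by rewrite /p => ->.
exists (L `|` U), e, p; split; last by left.
split=> [a b c ab bc|a|a|a b ab|a b ab|a].
- move=> La Uc; have [bs|/ltW sb] := leP b s.
    case: La => [La|[sa _]]; first by left; exact: L_up ab bs.
    by right; rewrite (_ : b = s) //; apply: le_anti; rewrite bs (le_trans sa ab).
  case: Uc => [[cs _]|Uc]; last by right; exact: U_dn Uc sb bc.
  by left; apply: L_up Ls sb (le_trans bc cs).
- move=> nI; have [as_|/ltW sa] := leP a s.
    by rewrite eL // f0 // => La; apply: nI; left.
  rewrite eE // es0 //; apply: contrapT => /eqP Ba.
  by apply: nI; right.
- move=> nI; have [as_|/ltW sa] := leP a s.
    rewrite pE // (_ : B a s = 0) ?mul0mx //; apply: contrapT => /eqP Ba.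
    by apply: nI; left.
  by rewrite pU // g0 // => Ua; apply: nI; right.
- case=> [La|[sa Ba]]; last by rewrite !eE ?(le_trans sa ab) // -mulmxA BP.
  have as_ := La.1; rewrite eL //; have [bs|/ltW sb] := leP b s.
    by rewrite eL // fB //; exact: L_up La ab bs.
  by rewrite eE // -(BP as_ sb) mulmxA fB // fs.
- case=> [[bs Bb]|Ub]; first by rewrite !pE ?(le_trans ab bs) // mulmxA BP.
  have sb := Ub.1; rewrite (pU b) //; have [as_|/ltW sa] := leP a s.
    by rewrite pE // -(BP as_ sb) -mulmxA gB // gs.
  by rewrite pU // gB //; exact: U_dn Ub sa ab.
- case=> [La|Ua]; last first.
    by have sa := Ua.1; rewrite eE // pU // -mulmxA gB // gs.
  by have as_ := La.1; rewrite eL // pE // mulmxA fB // fs.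
Qed.
End SplitOff.

Lemma is_bar_set0 (k : fieldType) d (T : orderType d) (n : T -> nat)
  (B : msystem k n) : is_bar B set0 (fun=> 0) (fun=> 0).
Proof. by split. Qed.

Section Peel.
Context (k : fieldType) (disp : Order.disp_t) (T : orderType disp).
Context (n : T -> nat) (B : msystem k n) (BP : is_msystem B).
Context (I : set T) (e : forall a, 'rV[k]_(n a)) (p : forall a, 'cV[k]_(n a)).
Hypothesis IP : is_bar B I e p.

Definition peel : msystem k n := fun a b => B a b - p a *m e b.

(** By convexity, the rank-one term of a bar cannot jump over a degree that the bar misses. *)
Lemma bar_pe0 a b c : (a <= b)%O -> (b <= c)%O -> ~ I b -> p a *m e c = 0.
Proof.
move=> ab bc nIb; have [Ia|nIa] := pselect (I a); last first.
  by rewrite (bar_p0 IP) ?mul0mx.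
by rewrite (bar_e0 IP) ?mulmx0 // => Ic; apply: nIb; apply: (bar_convex IP ab bc).
Qed.

Lemma peel_msystem : is_msystem peel.
Proof.
move=> a b c ab bc; rewrite /peel mulmxBl !mulmxBr BP //.
have [Ib|nIb] := pselect (I b); last first.
  rewrite (bar_e0 IP nIb) (bar_p0 IP nIb) !(mulmx0, mul0mx) !subr0.
  by rewrite (bar_pe0 ab bc nIb) subr0.
rewrite -(mulmxA (p a)) (bar_eB IP) // mulmxA (bar_Bp IP) // mulmxA.
rewrite -(mulmxA (p a) (e b)) (bar_ep IP) //.
by rewrite mulmx1 subrr subr0.
Qed.

Lemma e_peel a b : (a <= b)%O -> e a *m peel a b = 0.
Proof.
move=> ab; rewrite mulmxBr; have [Ia|nIa] := pselect (I a).
  by rewrite (bar_eB IP) // mulmxA (bar_ep IP) // mul1mx subrr.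
by rewrite (bar_e0 IP nIa) !mul0mx subrr.
Qed.

Lemma peel_p a b : (a <= b)%O -> peel a b *m p b = 0.
Proof.
move=> ab; rewrite mulmxBl; have [Ib|nIb] := pselect (I b).
  by rewrite (bar_Bp IP) // -mulmxA (bar_ep IP) // mulmx1 subrr.
by rewrite (bar_p0 IP nIb) !mulmx0 subrr.
Qed.

(** For [a] in [I], the row [e a] is in the image of [B a a] but not in that of [peel a a], which
    [p a] annihilates whereas [e a *m p a = 1]. This strict drop bounds the number of bars through
    [a]. *)
Lemma rank_peel a : (\rank (peel a a) + `[< I a >] <= \rank (B a a))%N.
Proof.
have sub : (peel a a <= B a a)%MS.
  have -> : peel a a = peel a a *m B a a; last exact: submxMl.
  have [Ia|nIa] := pselect (I a); rewrite /peel mulmxBl BP // -mulmxA.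
    by rewrite (bar_eB IP).
  by rewrite (bar_e0 IP nIa) mul0mx.
have [Ia|nIa] := pselect (I a); last by rewrite asboolF // addn0 mxrankS.
rewrite asboolT // addn1; apply: rank_ltmx; rewrite /ltmx sub /=.
apply/negP => Bpeel.
have eB : (e a <= B a a)%MS by rewrite -(bar_eB IP (lexx a) Ia) submxMl.
have /submxP[w ew] := submx_trans eB Bpeel.
have := bar_ep IP Ia; rewrite ew -mulmxA peel_p // mulmx0 => /eqP.
by rewrite eq_sym oner_eq0.
Qed.
End Peel.

Section Decomposition.
Context (k : fieldType) (disp : Order.disp_t) (T : orderType disp).
Context (n : T -> nat) (A : msystem k n) (AP : is_msystem A).
Context (q : nat -> T) (qP : order_dense q).

(* Every index is visited infinitely often by [fun i => logn 2 i.+1]. *)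
Lemma logn2_frequent j N : exists2 i, (N <= i)%N & logn 2 i.+1 = j.
Proof.
exists ((2 ^ j * N.*2.+1).-1)%N.
  have := leq_pmull N.*2.+1 (expn_gt0 2 j); rewrite /= -addnn.
  by case: (2 ^ j * _)%N => // m; rewrite ltnS; apply: leq_trans (leq_addr _ _).
rewrite prednK ?muln_gt0 ?expn_gt0 // lognM ?expn_gt0 // pfactorK //.
by rewrite lognE /= dvdn2 /= odd_double addn0.
Qed.

Theorem interval_decomposition_exists :
  exists (I : nat -> set T) (e : nat -> forall a, 'rV[k]_(n a))
      (p : nat -> forall a, 'cV[k]_(n a)),
  [/\ forall i, is_bar A (I i) (e i) (p i),
      forall i j a, i <> j -> e i a *m p j a = 0,
      forall a, exists N, forall i, (N <= i)%N -> ~ I i a &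
      forall i N, (forall j, (N <= j)%N -> ~ I j (q i)) ->
        A (q i) (q i) = \sum_(j < N) p j (q i) *m e j (q i)].
Proof.
pose bar := (set T * (forall a, 'rV[k]_(n a)) * (forall a, 'cV[k]_(n a)))%type.
pose sys := {B : msystem k n | is_msystem B}.
have split_at (B : sys) (s : T) : exists x : bar,
    is_bar (sval B) x.1.1 x.1.2 x.2 /\ (sval B s s != 0 -> x.1.1 s).
  have [_|B0] := eqVneq (sval B s s) 0.
    by exists (set0, fun=> 0, fun=> 0) => /=; split; first exact: is_bar_set0.
  have [I [e [p [IP Is]]]] := split_off (svalP B) qP B0.
  by exists (I, e, p).
pose pick (B : sys) s : bar := sval (cid (split_at B s)).
have pickP B s := svalP (cid (split_at B s)).
pose next (B : sys) s : sys := exist _ _ (peel_msystem (svalP B) (pickP B s).1).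
(* [S i] is what remains after [i] steps; each step works at [q (logn 2 i.+1)], so that every term
   of [q] is treated infinitely often. *)
pose S := fix S i : sys :=
  if i is j.+1 then next (S j) (q (logn 2 j.+1)) else exist _ A AP.
pose x i := pick (S i) (q (logn 2 i.+1)).
have xP i : is_bar (sval (S i)) (x i).1.1 (x i).1.2 (x i).2 := (pickP _ _).1.
have xI i : let s := q (logn 2 i.+1) in sval (S i) s s != 0 -> (x i).1.1 s.
  exact: (pickP _ _).2.
have SE i a b : sval (S i.+1) a b = sval (S i) a b - (x i).2 a *m (x i).1.2 b.
  by [].
have AE i a b : A a b = sval (S i) a b + \sum_(j < i) (x j).2 a *m (x j).1.2 b.
  elim: i => [|i IHi]; first by rewrite big_ord0 addr0.
  by rewrite IHi SE big_ord_recr /= [X in _ = _ + X]addrC addrA subrK.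
(* Remainders annihilate the earlier bars, on the right here and on the left in [eS]; later bars
   live in these remainders, whence orthogonality. *)
have Sp i j a b : (j < i)%N -> (a <= b)%O -> sval (S i) a b *m (x j).2 b = 0.
  elim: i a b => // i IHi a b; rewrite ltnS leq_eqVlt => /predU1P[->|ji] ab.
    by rewrite (peel_p (xP i)).
  rewrite SE mulmxBl IHi // sub0r; apply/eqP; rewrite oppr_eq0 -mulmxA.
  have [Ib|nIb] := pselect ((x i).1.1 b); last first.
    by rewrite (bar_e0 (xP i)) // mul0mx mulmx0.
  by rewrite -(bar_eB (xP i) (lexx b)) // -mulmxA IHi // !mulmx0.
have eS i j a b : (j < i)%N -> (a <= b)%O -> (x j).1.2 a *m sval (S i) a b = 0.
  elim: i a b => // i IHi a b; rewrite ltnS leq_eqVlt => /predU1P[->|ji] ab.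
    by rewrite (e_peel (xP i)).
  rewrite SE mulmxBr IHi // sub0r; apply/eqP; rewrite oppr_eq0 mulmxA.
  have [Ia|nIa] := pselect ((x i).1.1 a); last first.
    by rewrite (bar_p0 (xP i)) // mulmx0 mul0mx.
  by rewrite -(bar_Bp (xP i) (lexx a)) // mulmxA IHi // !mul0mx.
have orth i j a : i <> j -> (x i).1.2 a *m (x j).2 a = 0.
  move=> /eqP; rewrite neq_ltn => /orP[ij|ji].
    have [Ia|nIa] := pselect ((x j).1.1 a); last first.
      by rewrite (bar_p0 (xP j)) // mulmx0.
    by rewrite -(bar_Bp (xP j) (lexx a)) // mulmxA eS // mul0mx.
  have [Ia|nIa] := pselect ((x i).1.1 a); last first.
    by rewrite (bar_e0 (xP i)) // mul0mx.
  by rewrite -(bar_eB (xP i) (lexx a)) // -mulmxA Sp // mulmx0.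
have rkS i a : (\rank (sval (S i.+1) a a) + `[< (x i).1.1 a >] <=
    \rank (sval (S i) a a))%N by exact: (rank_peel (svalP (S i)) (xP i)).
(* The rank of the remainder at [a] never increases and drops whenever a bar meets [a]; after it
   reaches its minimum no bar does. *)
have fin a : exists N, forall i, (N <= i)%N -> ~ (x i).1.1 a.
  have [|N _ NP] := @ex_min_nat nat (fun=> True) (fun i => \rank (sval (S i) a a)).
    by exists 0%N.
  exists N => i Ni Ia.
  have mono : (\rank (sval (S i) a a) <= \rank (sval (S N) a a))%N.
    elim: i Ni {Ia} => [|i IHi]; first by rewrite leqn0 => /eqP->.
    rewrite leq_eqVlt => /predU1P[->//|/IHi]; apply: leq_trans.
    exact: leq_trans (leq_addr _ _) (rkS i a).
  have := rkS i a; rewrite asboolT // addn1 => /leq_trans/(_ mono).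
  by rewrite ltnNge NP.
exists (fun i => (x i).1.1), (fun i => (x i).1.2), (fun i => (x i).2); split=> //.
(* [A] differs from [S i] by earlier bars, all orthogonal to bar [i], so a bar of [S i] is a bar of
   [A]. *)
- move=> i; have [c e0 p0 eB Bp ep] := xP i.
  split=> // a b ab.
    move=> Ia; rewrite (AE i) mulmxDr eB // mulmx_sumr big1 ?addr0 // => j _.
    by rewrite mulmxA orth ?mul0mx // => ij; have := ltn_ord j; rewrite -ij ltnn.
  move=> Ib; rewrite (AE i) mulmxDl Bp // mulmx_suml big1 ?addr0 // => j _.
  by rewrite -mulmxA orth ?mulmx0 // => ij; have := ltn_ord j; rewrite ij ltnn.
(* At a visit [m] of [q i] later than [N], a nonzero remainder would yield a bar through [q i];
   hence it is zero there. *)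
- move=> i N NP; have [m Nm mi] := logn2_frequent i N.
  have Sm : sval (S m) (q i) (q i) = 0.
    apply: contrapT => /eqP Sm; apply: (NP m Nm).
    by have /= := xI m; rewrite mi; apply.
  rewrite (AE m) Sm add0r -!(big_mkord xpredT
    (fun j => (x j).2 (q i) *m (x j).1.2 (q i))).
  rewrite (big_cat_nat (n := N)) //= addrC big_nat big1 ?add0r // => j /andP[Nj _].
  by rewrite (bar_e0 (xP j)) ?mulmx0 //; exact: NP.
Qed.
End Decomposition.

(** * Diagrams, matchings and bijections of copies *)

Section Closeness.
Context (R : realType).
Implicit Types (e : R) (p q : \bar R * \bar R).

(** One-sided inequalities avoid differences of infinities, and since [e] is finite they force
    infinite coordinates to agree. *)
Definition near_pts e p q : Prop :=
  [/\ p.1 <= q.1 + e%:E, q.1 <= p.1 + e%:E,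
      p.2 <= q.2 + e%:E & q.2 <= p.2 + e%:E]%E.

Definition short_pt e p : Prop := (p.2 <= p.1 + (e + e)%:E)%E.

Lemma bar_dist_le e (a b : \bar R) : 0 <= e ->
  (bar_dist a b <= e%:E)%E <-> (a <= b + e%:E)%E /\ (b <= a + e%:E)%E.
Proof.
move=> e0; rewrite /bar_dist; case: eqVneq => [<-|].
  by split=> [_|_]; rewrite ?lee_fin // leeDl // lee_fin.
case: a => [a| |]; case: b => [b| |] //=; rewrite ?eqxx // ?lee_fin.
- by move=> _; rewrite ler_norml; split=> [/andP[? ?]|[? ?]];
    [split|apply/andP; split]; lra.
- by split=> // -[].
- by split=> // -[].
- by split=> // -[].
- by split=> // -[].
- by split=> // -[].
- by split=> // -[].
Qed.

Lemma linf_dist_le e p q : 0 <= e ->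
  (linf_dist p q <= e%:E)%E <-> near_pts e p q.
Proof.
move=> e0; rewrite /linf_dist ge_max; split=> [/andP[]|[]].
  by move=> /(bar_dist_le _ _ e0)[? ?] /(bar_dist_le _ _ e0)[].
by move=> *; apply/andP; split; apply/(bar_dist_le _ _ e0).
Qed.

Lemma half_persistence_le e p : (p.1 < p.2)%E ->
  (half_persistence p <= e%:E)%E <-> short_pt e p.
Proof.
rewrite /half_persistence /short_pt; case: p => -[a| |] [b| |] //= ab.
- by rewrite -EFinM !lee_fin; split; lra.
- by rewrite mulry gtr0_sg ?invr_gt0 ?ltr0n // mul1e; split.
- by rewrite mulry gtr0_sg ?invr_gt0 ?ltr0n // mul1e; split.
- by rewrite mulry gtr0_sg ?invr_gt0 ?ltr0n // mul1e; split.
Qed.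

Lemma near_pts_sym e p q : near_pts e p q -> near_pts e q p.
Proof. by case. Qed.

Lemma leeD_trans e e' (a b c : \bar R) :
  (a <= b + e%:E -> b <= c + e'%:E -> a <= c + (e + e')%:E)%E.
Proof.
case: a => [a| |]; case: b => [b| |]; case: c => [c| |] //=;
  rewrite ?leey ?leNye // ?lee_fin; lra.
Qed.

Lemma near_pts_trans e e' p q r :
  near_pts e p q -> near_pts e' q r -> near_pts (e + e') p r.
Proof.
case=> a b c d [a' b' c' d']; split.
- exact: leeD_trans a a'.
- by rewrite [e + e']addrC; exact: leeD_trans b' b.
- exact: leeD_trans c c'.
- by rewrite [e + e']addrC; exact: leeD_trans d' d.
Qed.

Lemma short_near e e' p q : near_pts e p q -> short_pt e' q -> short_pt (e + e') p.
Proof.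
case=> _ ab bc _ h.
have := leeD_trans (leeD_trans bc h) ab.
by rewrite (_ : e + (e' + e') + e = e + e' + (e + e')) //; lra.
Qed.

Lemma near_pts_le e e' p q : e <= e' -> near_pts e p q -> near_pts e' p q.
Proof.
have H (a b : \bar R) : e <= e' -> (a <= b + e%:E -> a <= b + e'%:E)%E.
  by move=> ee' /le_trans; apply; rewrite leeD2l // lee_fin.
by move=> ee' [*]; split; exact: H.
Qed.

Lemma short_pt_le e e' p : e <= e' -> short_pt e p -> short_pt e' p.
Proof.
by move=> ee' /le_trans; apply; rewrite leeD2l // lee_fin; lra.
Qed.

(* D as a multiset: a point p of multiplicity m has the m copies (p, 0), ...,
   (p, m - 1). *)
Definition copies (G : numDomainType) (D : diagram G) : set (upper G * nat) :=
  [set x | (x.2 < D x.1)%N].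

(** A partial bijection of copies, unlike a table of multiplicities, can be composed, reversed and
    produced by Cantor-Bernstein. *)
Record matched e (D1 D2 : diagram R)
    (S : upper R * nat -> upper R * nat -> Prop) : Prop := Matched {
  matched_dom : forall x y, S x y -> copies D1 x;
  matched_cod : forall x y, S x y -> copies D2 y;
  matched_near : forall x y, S x y -> near_pts e (val x.1) (val y.1);
  matched_fun : forall x y y', S x y -> S x y' -> y = y';
  matched_inj : forall x x' y, S x y -> S x' y -> x = x';
  matched_short1 : forall x, copies D1 x -> (exists y, S x y) \/ short_pt e
    (val x.1);
  matched_short2 : forall y, copies D2 y -> (exists x, S x y) \/ short_pt e
    (val y.1) }.

Definition bclose e (D1 D2 : diagram R) := exists S, matched e D1 D2 S.

Lemma matched_sym e D1 D2 S :
  matched e D1 D2 S -> matched e D2 D1 (fun x y => S y x).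
Proof.
move=> [a b c d f g h]; split.
- by move=> x y /b.
- by move=> x y /a.
- by move=> x y /c /near_pts_sym.
- by move=> x y y' /f; apply.
- by move=> x y y' /d; apply.
- exact: h.
- exact: g.
Qed.

Lemma bclose_sym e D1 D2 : bclose e D1 D2 -> bclose e D2 D1.
Proof. by move=> [S /matched_sym]; exists (fun x y => S y x). Qed.

Lemma bclose_le e e' D1 D2 : e <= e' -> bclose e D1 D2 -> bclose e' D1 D2.
Proof.
move=> ee' [S [a b c d f g h]]; exists S; split=> // [x y /c|x /g[]|x /h[]].
- exact: near_pts_le.
- by left.
- by right; apply: short_pt_le ee' _.
- by left.
- by right; apply: short_pt_le ee' _.
Qed.

(** A copy whose partner is unmatched in the other relation is near a short bar, hence short for
    [e + e']. *)
Lemma bclose_trans e e' D1 D2 D3 : 0 <= e -> 0 <= e' ->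
  bclose e D1 D2 -> bclose e' D2 D3 -> bclose (e + e') D1 D3.
Proof.
move=> e0 e'0 [S [a b c d f g h]] [S' [a' b' c' d' f' g' h']].
have le1 : e <= e + e' by rewrite lerDl.
have le2 : e' <= e + e' by rewrite lerDr.
exists (fun x z => exists2 y, S x y & S' y z); split.
- by move=> x z [y /a].
- by move=> x z [y _ /b'].
- by move=> x z [y /c xy /c' yz]; exact: near_pts_trans yz.
- by move=> x z z' [y xy yz] [y' /(d _ _ _ xy) <-]; exact: d'.
- by move=> x x' z [y xy yz] [y' xy' /(f' _ _ _ yz) yy']; subst y'; exact: f xy xy'.
- move=> x /g[[y xy]|sx]; last by right; exact: short_pt_le sx.
  have [[z yz]|sy] := g' _ (b _ _ xy); first by left; exists z, y.
  by right; exact: short_near (c _ _ xy) sy.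
- move=> z /h'[[y yz]|sx]; last by right; exact: short_pt_le sx.
  have [[x xy]|sy] := h _ (a' _ _ yz); first by left; exists x, y.
  by right; rewrite [e + e']addrC; apply: short_near (near_pts_sym (c' _ _ yz)) sy.
Qed.
End Closeness.

(** Positions in this list will number the copies of a point among its partners. *)
Lemma enum_multiplicities (Y : choiceType) (f : Y -> nat) :
  finite_set [set y | f y != 0%N] ->
  exists s : seq (Y * nat), [/\ uniq s, forall y l, ((y, l) \in s) = (l < f y)%N &
    size s = \big[addn/0%N]_(y \in [set: Y]) f y].
Proof.
move=> /finite_seqP[r rP]; pose u := undup r.
have mu y : (y \in u) = (f y != 0%N).
  by rewrite mem_undup; apply/idP/idP => h; have := rP; move=> /seteqP[];
    [move=> _ /(_ y h)|move=> /(_ y h)].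
exists [seq (y, l) | y <- u, l <- iota 0 (f y)]; split.
- apply: allpairs_uniq_dep => [|y _|[y l] [y' l'] _ _ /= []];
    rewrite ?undup_uniq ?iota_uniq //.
  by move=> -> ->.
- move=> y l; apply/allpairsPdep/idP => [[y' [l' [_ + [-> ->]]]]|lf].
    by rewrite mem_iota.
  exists y, l; rewrite mem_iota mu; split=> //; by case: (f y) lf.
- rewrite size_allpairs_dep sumnE big_map (fsbigE u) ?undup_uniq //.
    by rewrite [RHS]big_mkcond /=; apply: eq_bigr => y _; rewrite size_iota in_setT.
  by move=> y _; rewrite mu negbK => /eqP.
Qed.

Lemma supp_inj (G : numDomainType) (D : diagram G) (p q : supp D) :
  sval p = sval q -> p = q.
Proof.
case: p q => [p pP] [q qP] /= pq; subst q.
by rewrite (bool_irrelevance pP qP).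
Qed.

Section MatchingsAsBijections.
Context (R : realType).
Implicit Types (e : R) (D : diagram R).

Lemma bottleneck_sup_le (A : set (\bar R)) (c : \bar R) : (0 <= c)%E ->
  (Defs.sup0 A <= c)%E <-> forall x, A x -> (x <= c)%E.
Proof.
move=> c0; rewrite /Defs.sup0; split=> [h x Ax|h].
  by apply: le_trans h; apply: ereal_sup_ubound; right.
by apply: ge_ereal_sup => x [->//|/h].
Qed.

Lemma bclose_of_matching e D1 D2 (m : matching D1 D2) : 0 <= e ->
  (matching_cost m <= e%:E)%E -> bclose e D1 D2.
Proof.
move=> e0; have e0E : (0 <= e%:E)%E by rewrite lee_fin.
rewrite /matching_cost ge_max.
move=> /andP[/(bottleneck_sup_le _ e0E) sh /(bottleneck_sup_le _ e0E) nr].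
case: m sh nr => M1 M2 g le1 le2 [g1 g2] /= sh nr.
have /choice[L LP] x := enum_multiplicities (g1 x).1.
have /choice[K KP] y := enum_multiplicities (g2 y).1.
have short1 p : (D1 p - M1 p != 0)%N -> short_pt e (val p).
  move=> h; apply/(half_persistence_le _ (valP p)).
  by apply: sh; exists p => //; left.
have short2 p : (D2 p - M2 p != 0)%N -> short_pt e (val p).
  move=> h; apply/(half_persistence_le _ (valP p)).
  by apply: sh; exists p => //; right.
(* The edges between [p] and [q] are the triples [(p, q, l)] with [l < g p q]; each one joins the
   copies given by its rank among the edges at [p] and its rank among those at [q]. *)
exists (fun x y => exists p q l, [/\ (l < g p q)%N,
  x = (val p, index (q, l) (L p)) & y = (val q, index (p, l) (K q))]).
have memL p q l : (l < g p q)%N -> (q, l) \in L p by have [_ ->] := LP p.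
have memK p q l : (l < g p q)%N -> (p, l) \in K q by have [_ ->] := KP q.
have szL p : size (L p) = M1 (val p) by have [_ _ ->] := LP p; rewrite (g1 p).2.
have szK q : size (K q) = M2 (val q) by have [_ _ ->] := KP q; rewrite (g2 q).2.
split.
- move=> _ y [p [q [l [lg -> _]]]]; rewrite /copies /=.
  by apply: leq_trans (le1 _); rewrite -szL index_mem memL.
- move=> x _ [p [q [l [lg _ ->]]]]; rewrite /copies /=.
  by apply: leq_trans (le2 _); rewrite -szK index_mem memK.
- move=> _ _ [p [q [l [lg -> ->]]]]; apply/(linf_dist_le _ _ e0).
  by apply: nr; exists (p, q) => //=; rewrite -lt0n (leq_trans _ lg).
- move=> _ _ _ [p [q [l [lg -> ->]]]] [p' [q' [l' [lg' [pp' +] ->]]]].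
  move/supp_inj: pp' lg' => <- lg' /(f_equal (nth (q, l) (L p))).
  by rewrite !nth_index ?memL // => -[-> ->].
- move=> _ _ _ [p [q [l [lg -> ->]]]] [p' [q' [l' [lg' -> [qq' +]]]]].
  move/supp_inj: qq' lg' => <- lg' /(f_equal (nth (p, l) (K q))).
  by rewrite !nth_index ?memK // => -[-> ->].
- case=> [p i]; rewrite /copies /= => iD; have [iM|Mi] := ltnP i (M1 p); last first.
    by right; apply: short1; rewrite subn_eq0 -ltnNge (leq_ltn_trans Mi).
  have Mp : M1 p != 0%N by rewrite -lt0n (leq_trans _ iM).
  pose x : supp M1 := exist _ p Mp.
  have iL : (i < size (L x))%N by rewrite szL.
  case E : (L x) iL => [//|[q0 l0] r0] iL; rewrite -E in iL.
  pose ql := nth (q0, l0) (L x) i.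
  have lg : (ql.2 < g x ql.1)%N.
    by have [_ <- _] := LP x; rewrite -surjective_pairing mem_nth.
  left; exists (val ql.1, index (x, ql.2) (K ql.1)), x, ql.1, ql.2; split=> //=.
  by rewrite -surjective_pairing index_uniq //; have [] := LP x.
- case=> [p i]; rewrite /copies /= => iD; have [iM|Mi] := ltnP i (M2 p); last first.
    by right; apply: short2; rewrite subn_eq0 -ltnNge (leq_ltn_trans Mi).
  have Mp : M2 p != 0%N by rewrite -lt0n (leq_trans _ iM).
  pose x : supp M2 := exist _ p Mp.
  have iL : (i < size (K x))%N by rewrite szK.
  case E : (K x) iL => [//|[q0 l0] r0] iL; rewrite -E in iL.
  pose ql := nth (q0, l0) (K x) i.
  have lg : (ql.2 < g ql.1 x)%N.
    by have [_ <- _] := KP x; rewrite -surjective_pairing mem_nth.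
  left; exists (val ql.1, index (x, ql.2) (L ql.1)), ql.1, x, ql.2; split=> //=.
  by rewrite -surjective_pairing index_uniq //; have [] := KP x.
Qed.

Lemma bclose_of_dB e D1 D2 : 0 < e -> (dB D1 D2 < e%:E)%E ->
  exists2 c, 0 <= c < e & bclose c D1 D2.
Proof.
move=> e0 /ereal_inf_lt[_ [m _ <-] me].
have c0 : (0 <= matching_cost m)%E.
  rewrite /matching_cost le_max; apply/orP; left.
  by apply: ereal_sup_ubound; left.
have cfin : matching_cost m \is a fin_num.
  by rewrite ge0_fin_numE // (lt_le_trans me) // leey.
exists (fine (matching_cost m)).
  by rewrite fine_ge0 //= -lte_fin fineK.
by apply: (@bclose_of_matching _ _ _ m); rewrite ?fine_ge0 ?fineK.
Qed.

Lemma size_sum_fibers (I : eqType) (Y : choiceType) (f : I -> Y) (s : seq I) :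
  size s = \sum_(y <- undup (map f s)) count (fun i => f i == y) s.
Proof.
have -> : size s = (\sum_(i <- s) 1)%N by rewrite sum1_size.
under [RHS]eq_bigr => y _ do rewrite -sum1_count big_mkcond /=.
rewrite exchange_big /=; rewrite big_seq [RHS]big_seq; apply: eq_bigr => i si.
rewrite -big_mkcond /= sum1_count.
have : count_mem (f i) (undup (map f s)) = 1%N.
  by rewrite count_uniq_mem ?undup_uniq // mem_undup map_f.
by move=> <-; apply: eq_count => y /=; rewrite eq_sym.
Qed.

Lemma sum_fibers_supp (G : numDomainType) (D : diagram G) (s : seq nat)
    (f : nat -> upper G) : (forall i, i \in s -> D (f i) != 0%N) ->
  finite_set [set y : supp D | count (fun i => f i == sval y) s != 0%N] /\
  size s = \big[addn/0%N]_(y \in [set: supp D]) count (fun i => f i == sval y) s.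
Proof.
move=> sD.
have [->|[i0 si0]] : s = [::] \/ exists i0, i0 \in s.
  by case: (s) => [|i r]; [left|right; exists i; rewrite mem_head].
  split; first by rewrite (_ : [set y | _] = set0) //; apply/seteqP; split.
  by rewrite fsbig1.
pose g i : supp D := if pselect (D (f i) != 0%N) is left h then exist _ (f i) h
  else exist _ (f i0) (sD i0 si0).
have gE i : i \in s -> sval (g i) = f i.
  by move=> /sD; rewrite /g; case: pselect.
have cE (y : supp D) : count (fun i => f i == sval y) s = count
  (fun i => g i == y) s.
  apply: eq_in_count => i si /=; rewrite -gE //;
    apply/eqP/eqP => [/supp_inj//|->//].
have nin (y : supp D) : y \notin undup (map g s) -> count
  (fun i => f i == sval y) s = 0%N.
  rewrite cE mem_undup => yn; apply/eqP; rewrite -leqn0 leqNgt -has_count.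
  by apply/negP => /hasP[i si /eqP gi]; rewrite -gi map_f in yn.
split.
  apply: (@sub_finite_set _ _ [set` undup (map g s)]); last first.
    by apply/finite_seqP; exists (undup (map g s)).
  by move=> y /=; apply: contraNT => /nin ->.
rewrite (fsbigE (undup (map g s))) ?undup_uniq //.
  rewrite [in LHS](size_sum_fibers g) [RHS]big_mkcond /=.
  by apply: eq_bigr => y _; rewrite in_setT cE.
by move=> y _ /nin.
Qed.

(** The subdiagrams count the matched copies of each point, and [g p q] counts the pairs of matched
    copies over [p] and [q]. *)
Lemma dB_le_of_bclose e D1 D2 : 0 <= e -> bclose e D1 D2 -> (dB D1 D2 <= e%:E)%E.
Proof.
move=> e0 [S [Sdom Scod Snear Sfun Sinj sh1 sh2]].
pose m1 x := `[< exists y, S x y >]; pose m2 y := `[< exists x, S x y >].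
have /choice[f fP] : forall x, exists y, m1 x -> S x y.
  by move=> x; have [[y xy]|nS] := pselect (exists y, S x y);
    [exists y|exists x => /asboolP].
have /choice[h hP] : forall y, exists x, m2 y -> S x y.
  by move=> y; have [[x xy]|nS] := pselect (exists x, S x y);
    [exists x|exists y => /asboolP].
pose l1 p := [seq i <- iota 0 (D1 p) | m1 (p, i)].
pose l2 p := [seq i <- iota 0 (D2 p) | m2 (p, i)].
pose M1 : diagram R := fun p => size (l1 p).
pose M2 : diagram R := fun p => size (l2 p).
pose g (p : supp M1) (q : supp M2) :=
  count (fun i => (f (sval p, i)).1 == sval q) (l1 (sval p)).
have l1P p i : i \in l1 p -> S (p, i) (f (p, i)).
  by rewrite mem_filter => /andP[/fP].
have l2P p i : i \in l2 p -> S (h (p, i)) (p, i).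
  by rewrite mem_filter => /andP[/hP].
have l1S p i y : S (p, i) y -> i \in l1 p.
  move=> xy; rewrite mem_filter mem_iota /= add0n; apply/andP; split.
    by apply/asboolP; exists y.
  exact: (Sdom _ _ xy).
have l2S p i x : S x (p, i) -> i \in l2 p.
  move=> xy; rewrite mem_filter mem_iota /= add0n; apply/andP; split.
    by apply/asboolP; exists x.
  exact: (Scod _ _ xy).
(* The same pairs counted from the side of [q]; each inequality follows from an injection given by
   [f] or by [h]. *)
have gE (p : supp M1) (q : supp M2) :
    g p q = count (fun j => (h (sval q, j)).1 == sval p) (l2 (sval q)).
  rewrite /g -!size_filter.
  set s := [seq i <- _ | _]; set t := [seq j <- _ | _].
  have sP i : i \in s -> S (sval p, i) (sval q, (f (sval p, i)).2).
    by rewrite mem_filter => /andP[/eqP <- /l1P]; rewrite -surjective_pairing.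
  have tP j : j \in t -> S (sval p, (h (sval q, j)).2) (sval q, j).
    by rewrite mem_filter => /andP[/eqP <- /l2P]; rewrite -surjective_pairing.
  have us : uniq s by rewrite !filter_uniq ?iota_uniq.
  have ut : uniq t by rewrite !filter_uniq ?iota_uniq.
  apply/eqP; rewrite eqn_leq; apply/andP; split.
    rewrite -(size_map (fun i => (f (sval p, i)).2)); apply: uniq_leq_size.
      rewrite map_inj_in_uniq // => i i' /sP Si /sP Si' ii'; rewrite ii' in Si.
      by case: (Sinj _ _ _ Si Si').
    move=> _ /mapP[i /sP Si ->]; rewrite mem_filter (l2S _ _ _ Si) andbT.
    by have /l2P Sh := l2S _ _ _ Si; rewrite (Sinj _ _ _ Sh Si).
  rewrite -(size_map (fun j => (h (sval q, j)).2)); apply: uniq_leq_size.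
    rewrite map_inj_in_uniq // => i i' /tP Si /tP Si' ii'; rewrite ii' in Si.
    by case: (Sfun _ _ _ Si Si').
  move=> _ /mapP[i /tP Si ->]; rewrite mem_filter (l1S _ _ _ Si) andbT.
  by have /l1P Sh := l1S _ _ _ Si; rewrite (Sfun _ _ _ Sh Si).
have gP : multibijection g.
  split=> [p|q].
    have [] := @sum_fibers_supp _ M2 (l1 (sval p)) (fun i => (f (sval p, i)).1).
      move=> i /l1P; case: (f _) => y j /= /l2S jl.
      by rewrite /M2 -lt0n; case: (l2 y) jl.
    by [].
  have [] := @sum_fibers_supp _ M1 (l2 (sval q)) (fun i => (h (sval q, i)).1).
    move=> i /l2P; case: (h _) => y j /= /l1S jl.
    by rewrite /M1 -lt0n; case: (l1 y) jl.
  rewrite (_ : [set y | _] = [set x | g x q != 0%N]); last first.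
    by apply/funext => y /=; rewrite gE.
  move=> fin E; split=> //; apply: etrans E _.
  by apply: eq_fsbigr => p _; rewrite gE.
have le1 p : (M1 p <= D1 p)%N.
  by rewrite /M1 size_filter -[leqRHS](size_iota 0) count_size.
have le2 p : (M2 p <= D2 p)%N.
  by rewrite /M2 size_filter -[leqRHS](size_iota 0) count_size.
apply: le_trans (ereal_inf_lbound _) _; first by exists (Matching le1 le2 gP).
have e0E : (0 <= e%:E)%E by rewrite lee_fin.
rewrite /matching_cost ge_max; apply/andP; split; apply/(bottleneck_sup_le _ e0E).
  move=> _ [p [] /= Dp <-]; apply/(half_persistence_le _ (valP p)).
    have /hasP[i ii im] : has (fun i => ~~ m1 (p, i)) (iota 0 (D1 p)).
      rewrite has_predC; apply: contra Dp => /all_filterP.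
      by rewrite -/(l1 p) subn_eq0 /M1 => ->; rewrite size_iota.
    have /sh1[/asboolP|//] : copies D1 (p, i) by move: ii; rewrite mem_iota.
    by rewrite (negPf im : `[< _ >] = _).
  have /hasP[i ii im] : has (fun i => ~~ m2 (p, i)) (iota 0 (D2 p)).
    rewrite has_predC; apply: contra Dp => /all_filterP.
    by rewrite -/(l2 p) subn_eq0 /M2 => ->; rewrite size_iota.
  have /sh2[/asboolP|//] : copies D2 (p, i) by move: ii; rewrite mem_iota.
  by rewrite (negPf im : `[< _ >] = _).
move=> _ [[p q] /= gpq <-]; apply/(linf_dist_le _ _ e0).
have /hasP[i /l1P Si /eqP <-] : has (fun i => (f (sval p, i)).1 == sval q)
  (l1 (sval p)).
  by rewrite has_count lt0n.
exact: (Snear _ _ Si).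
Qed.
End MatchingsAsBijections.

(** * Hall's theorem and Cantor-Bernstein matchings *)

Section Hall.
Context (X Y : choiceType) (y0 : Y).
Implicit Types (A B : seq X) (N : X -> seq Y).

Definition neighbours N B : seq Y := undup (flatten [seq N x | x <- B]).

Lemma mem_neighbours N B y :
  reflect (exists2 x, x \in B & y \in N x) (y \in neighbours N B).
Proof.
rewrite mem_undup; apply: (iffP flatten_mapP) => -[x xB yN]; by exists x.
Qed.

(** Induction on the size of [A]. If a nonempty smaller [B] has exactly as many neighbours as
    elements, match [B] and its complement separately; otherwise there is slack, and any edge at [x]
    can be used first. *)
Lemma hall N A : uniq A ->
  (forall B, uniq B -> {subset B <= A} -> (size B <= size (neighbours N B))%N) ->
  exists2 f : X -> Y, {in A, forall x, f x \in N x} & {in A &, injective f}.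
Proof.
have [n] := ubnP (size A); elim: n => // n IHn in A N *.
rewrite ltnS => An uA hallA.
case EA : A uA => [|x A'] uA; first by exists (fun=> y0).
have uA0 : uniq A by rewrite EA.
have [[B [uB BA B0 [BAs NB]]]|nocrit] := pselect (exists B, [/\ uniq B,
  {subset B <= A}, B != [::] & (size B < size A)%N /\
    size (neighbours N B) = size B]).
  have [f1 f1N f1i] : exists2 f : X -> Y, {in B, forall x, f x \in N x} &
    {in B &, injective f}.
    apply: IHn => //; first exact: leq_trans BAs An.
    by move=> C uC CB; apply: hallA => // z /CB/BA.
  pose A2 := [seq z <- A | z \notin B].
  (* Hall's condition for these remaining neighbours of a set [C] is the one for [B ++ C] with the
     equal sizes of [B] and its neighbourhood cancelled. *)
  pose N2 z := [seq y <- N z | y \notin neighbours N B].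
  have [f2 f2N f2i] : exists2 f : X -> Y, {in A2, forall x, f x \in N2 x} &
    {in A2 &, injective f}.
    apply: IHn; last 2 first.
    - exact: filter_uniq.
    - move=> C uC CA2.
      have uCB : uniq (B ++ C).
        rewrite cat_uniq uB uC andbT; apply/hasPn => z /CA2.
        by rewrite mem_filter => /andP[].
      have CBA : {subset B ++ C <= A}.
        move=> z; rewrite mem_cat => /orP[/BA//|/CA2].
        by rewrite mem_filter => /andP[].
      have := hallA _ uCB CBA; rewrite size_cat.
      have sub : {subset neighbours N (B ++ C) <= neighbours N B ++ neighbours
        N2 C}.
        move=> y /mem_neighbours[z]; rewrite !mem_cat.
        case: (boolP (y \in neighbours N B)) => //= yB /orP[zB yN|zC yN].
          by case/mem_neighbours: yB; exists z.
        by apply/mem_neighbours; exists z => //; rewrite mem_filter yB.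
      move=> /leq_trans/(_ (uniq_leq_size (undup_uniq _) sub)).
      by rewrite size_cat NB leq_add2l.
    apply: leq_trans An; rewrite size_filter -(count_predC (mem B) A).
    rewrite -[X in (X < _)%N]add0n ltn_add2r -has_count.
    case: (B) BA B0 => [//|b B1] BA _; apply/hasP; exists b; last exact: mem_head.
    by apply: BA; exact: mem_head.
  have A2P z : z \in A -> z \notin B -> z \in A2 by rewrite mem_filter => -> ->.
  exists (fun z => if z \in B then f1 z else f2 z) => [z zA|z z' zA z'A].
    rewrite -EA in zA; case: ifPn => [/f1N//|zB].
    by have := f2N _ (A2P _ zA zB); rewrite mem_filter => /andP[].
  rewrite -EA in zA z'A.
  have disj u v : u \in B -> v \in A -> v \notin B -> f1 u != f2 v.
    move=> uB' vA vB; have := f2N _ (A2P _ vA vB); rewrite mem_filter => /andP[+ _].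
    apply: contra => /eqP <-; apply/mem_neighbours; exists u => //; exact: f1N.
  case: ifPn => zB; case: ifPn => z'B.
  - exact: f1i.
  - by move=> /eqP; rewrite (negPf (disj _ _ zB z'A z'B)).
  - by move=> /esym/eqP; rewrite (negPf (disj _ _ z'B zA zB)).
  - by move=> E; apply: f2i E; exact: A2P.
have [y yN] : exists y, y \in N x.
  have := hallA [:: x]; rewrite EA => /(_ isT) h.
  have {}h : (0 < size (neighbours N [:: x]))%N.
    by apply: h => z; rewrite inE => /eqP->; exact: mem_head.
  case E : (neighbours N [:: x]) h => [//|y s] _; exists y.
  have /mem_neighbours[z] : y \in neighbours N [:: x] by rewrite E mem_head.
  by rewrite inE => /eqP->.
pose N2 z := [seq w <- N z | w != y].
move: (uA) => /= /andP[xA' uA'].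
have [f2 f2N f2i] : exists2 f : X -> Y, {in A', forall x, f x \in N2 x} &
  {in A' &, injective f}.
  apply: IHn => //; first by move: An; rewrite EA.
  move=> C uC CA'; have [->//|C0] := eqVneq C [::].
  have CA : {subset C <= A} by move=> z /CA' zA; rewrite EA inE zA orbT.
  have CAs : (size C < size A)%N by rewrite EA ltnS; exact: uniq_leq_size.
  have ltC : (size C < size (neighbours N C))%N.
    rewrite ltn_neqAle hallA // andbT; apply/eqP => E.
    by apply: nocrit; exists C; split.
  have sub : {subset neighbours N C <= y :: neighbours N2 C}.
    move=> w /mem_neighbours[z zC wN]; rewrite inE; case: eqVneq => //= wy.
    by apply/mem_neighbours; exists z => //; rewrite mem_filter wy.
  rewrite -ltnS; apply: leq_trans ltC _.
  by have := uniq_leq_size (undup_uniq _) sub.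
exists (fun z => if z == x then y else f2 z) => [z|z z'].
  rewrite inE; case: eqVneq => [->//|_ /= /f2N].
  by rewrite mem_filter => /andP[].
have neq z1 : z1 \in A' -> f2 z1 != y.
  by move=> /f2N; rewrite mem_filter => /andP[].
rewrite !inE; case: eqVneq => [->|zx] /=; case: eqVneq => [->|z'x] //=.
- by move=> _ /neq/eqP h /esym.
- by move=> /neq/eqP h _ /h.
- exact: f2i.
Qed.

Lemma ultra_fiber (T : Type) (U : set_system T) (UU : UltraFilter U)
    (f : T -> Y) (s : seq Y) :
  U [set t | f t \in s] -> exists2 y, y \in s & U [set t | f t = y].
Proof.
elim: s => [|y s IHs] Us.
  by case: (filter_not_empty U); apply: filterS Us => t.
have [Uy|Uny] := in_ultra_setVsetC [set t | f t = y] UU.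
  by exists y; rewrite ?mem_head.
have [|z zs Uz] := IHs; last by exists z; rewrite // inE zs orbT.
by apply: filterS (filterI Us Uny) => t /= []; rewrite inE => /orP[/eqP|].
Qed.

(* Compactness: finite partial solutions are glued along an ultrafilter on the
   finite subsets of X'. *)
Lemma hall_compactness (X' : set X) N :
  (forall A, uniq A -> (forall x, x \in A -> X' x) ->
    exists2 f : X -> Y, {in A, forall x, f x \in N x} & {in A &, injective f}) ->
  exists2 f : X -> Y, forall x, X' x -> f x \in N x &
    forall x x', X' x -> X' x' -> f x = f x' -> x = x'.
Proof.
move=> fin; pose ok A := [seq x <- undup A | `[< X' x >]].
have /choice[F FP] : forall A, exists f : X -> Y,
    {in ok A, forall x, f x \in N x} /\ {in ok A &, injective f}.
  move=> A; have [||f] := fin (ok A); last by exists f.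
  - by rewrite filter_uniq ?undup_uniq.
  - by move=> x; rewrite mem_filter => /andP[/asboolP].
(* Any finite set of points is contained in almost every list for this filter. *)
pose G : set_system (seq X) :=
  filter_from setT (fun s : seq X => [set A : seq X | {subset s <= A}]).
have GF : ProperFilter G.
  apply: filter_from_proper; last by move=> s _; exists s.
  apply: filter_fromT_filter; first by exists [::].
  move=> s t; exists (s ++ t) => A st.
  by split=> x xs; apply: st; rewrite mem_cat xs ?orbT.
have [U [UU GU]] := ultraFilterLemma GF.
have Ux x : X' x -> U [set A | x \in ok A].
  move=> Xx; apply: GU; exists [:: x] => // A xA /=.
  by rewrite mem_filter mem_undup asboolT //= xA ?mem_head.
(* [F A x] stays in the finite list [N x] for almost every [A], so the ultrafilter selects one of
   its values. *)
have /choice[f fP] : forall x, exists y, X' x -> y \in N x /\ U [set A | F A x = y].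
  move=> x; have [Xx|] := pselect (X' x); last by exists y0.
  have [|y yN Uy] := @ultra_fiber _ U UU (fun A => F A x) (N x); last by exists y.
  by apply: filterS (Ux _ Xx) => A /= xA; exact: (FP A).1.
exists f => [x /fP[]//|x x' Xx Xx' fxx'].
have [_ Uf] := fP _ Xx; have [_ Uf'] := fP _ Xx'.
have [A [[/= xA x'A] [/= Ax Ax']]] :=
  filter_ex (filterI (filterI (Ux _ Xx) (Ux _ Xx')) (filterI Uf Uf')).
by apply: (FP A).2 => //; rewrite Ax Ax'.
Qed.

End Hall.

Section CantorBernstein.
Context (X Y : Type) (X' : set X) (Y' : set Y) (f : X -> Y) (g : Y -> X).
Hypotheses (f_inj : forall x x', X' x -> X' x' -> f x = f x' -> x = x')
  (g_inj : forall y y', Y' y -> Y' y' -> g y = g y' -> y = y').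

(** The points whose backward orbit, alternating between [g] and [f], ends at a point of [X] outside
    the image of [Y']. They are matched by [f], the others by the inverse of [g]. *)
Inductive chain : X -> Prop :=
| Chain0 x : (forall y, Y' y -> g y <> x) -> chain x
| ChainS x : chain x -> X' x -> Y' (f x) -> chain (g (f x)).

(** [f] may send [X'] outside [Y'], and [g] may send [Y'] outside [X']: a long bar may have a short
    partner. *)
Lemma cantor_bernstein_matching : exists S : X -> Y -> Prop,
  [/\ forall x y, S x y -> (X' x /\ y = f x) \/ (Y' y /\ x = g y),
      forall x y y', S x y -> S x y' -> y = y',
      forall x x' y, S x y -> S x' y -> x = x',
      forall x, X' x -> exists y, S x y & forall y, Y' y -> exists x, S x y].
Proof.
pose hit y := exists x, [/\ chain x, X' x & y = f x].
have chain_g y : Y' y -> chain (g y) -> hit y.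
  move=> Yy; move E : (g y) => z zc; case: zc E => [x /(_ y Yy)//|x xc Xx Yx E].
  by exists x; split=> //; exact: g_inj.
exists (fun x y => (chain x /\ X' x /\ y = f x) \/ (Y' y /\ ~ hit y /\ x = g y)).
split.
- by move=> x y [[_ ?]|[? [_ ?]]]; [left|right].
- move=> x y y' [[xc [Xx ->]]|[Yy [ny xg]]] [[xc' [Xx' ->]]|[Yy' [ny' xg']]] //.
  + by case: ny'; apply: chain_g; rewrite // -xg'.
  + by case: ny; apply: chain_g; rewrite // -xg.
  + by apply: g_inj; rewrite // -xg.
- move=> x x' y [[xc [Xx yf]]|[Yy [ny ->]]] [[xc' [Xx' yf']]|[Yy' [ny' ->]]] //.
  + by apply: f_inj; rewrite // -yf.
  + by case: ny'; exists x.
  + by case: ny; exists x'.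
- move=> x Xx; have [xc|nc] := pselect (chain x); first by exists (f x); left.
  have [[y Yy gy]|ng] := pselect (exists2 y, Y' y & g y = x); last first.
    by case: nc; apply: Chain0 => y Yy gy; apply: ng; exists y.
  exists y; right; split=> //; split=> // -[z [zc Xz yf]]; apply: nc.
  by rewrite -gy yf; apply: ChainS => //; rewrite -yf.
- move=> y Yy; have [[x [xc Xx yf]]|ny] := pselect (hit y); first by exists x; left.
  by exists (g y); right.
Qed.
End CantorBernstein.

(** * Algebraic stability *)

Lemma eq_sum_support (V : nmodType) (X : eqType) (s t : seq X) (f : X -> V) :
  uniq s -> uniq t -> (forall x, x \in s -> x \notin t -> f x = 0) ->
  (forall x, x \in t -> x \notin s -> f x = 0) ->
  \sum_(x <- s) f x = \sum_(x <- t) f x.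
Proof.
move=> us ut st ts; pose r := undup (s ++ t).
suff H w : uniq w -> {subset w <= r} ->
  (forall x, x \in r -> x \notin w -> f x = 0) ->
    \sum_(x <- w) f x = \sum_(x <- r) f x.
  rewrite !H // => x; rewrite mem_undup mem_cat; try by move=> ->; rewrite ?orbT.
  - by case/orP=> [xs xt|->//]; exact: st.
  - by case/orP=> [->//|xs xt]; exact: ts.
move=> uw wr w0; rewrite [RHS](bigID (mem w)) /=.
rewrite [X in _ = _ + X]big_seq_cond [X in _ = _ + X]big1 ?addr0; last first.
  by move=> x /andP[]; exact: w0.
rewrite -[RHS]big_filter; apply: perm_big; apply: uniq_perm => //.
  by rewrite filter_uniq ?undup_uniq.
by move=> x; rewrite mem_filter; case: (boolP (x \in w)) => //= /wr ->.
Qed.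

Section ExtendedReals.
Context (R : realType).
Implicit Types (e : R) (p q r : \bar R * \bar R).

Lemma ereal_between (x y : \bar R) : (x < y)%E -> exists r : R, (x < r%:E < y)%E.
Proof.
case: x => [x| |]; case: y => [y| |] //=; rewrite ?lte_fin => xy.
- by exists ((x + y) / 2); rewrite !lte_fin; apply/andP; split; lra.
- by exists (x + 1); rewrite lte_fin ltry andbT; lra.
- by exists (y - 1); rewrite lte_fin ltNyr /=; lra.
- by exists 0; rewrite ltry ltNyr.
Qed.

(* The order that triangularizes: infinite types first, then the midpoint. *)
Definition infinite_type p : nat := (p.1 != -oo%E) + (p.2 == +oo%E).
(** [fine] sends infinite endpoints to 0, so rays are compared by their finite endpoint. *)
Definition midpoint2 p : R := fine p.1 + fine p.2.
(** A nonzero morphism of bars raises neither endpoint beyond the shift, so it cannot raise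
    [infinite_type]. *)
Definition midpoint_ge r p : Prop := (infinite_type p < infinite_type r)%N \/
  infinite_type p = infinite_type r /\ midpoint2 p <= midpoint2 r.

(** If an endpoint of [p] exceeds that of [q] by more than [e], the corresponding endpoint of [r] is
    below that of [p]; the order of the midpoints then raises the other endpoint of [r] enough to
    make [r] near [q]. *)
Lemma midpoint_near e p q r : 0 <= e ->
  (p.1 < p.2)%E -> (q.1 < q.2)%E -> (r.1 < r.2)%E ->
  (q.1 <= p.1 + e%:E)%E -> (q.2 <= p.2 + e%:E)%E ->
  (r.1 <= q.1 + e%:E)%E -> (r.2 <= q.2 + e%:E)%E ->
  midpoint_ge r p -> near_pts e p q \/ near_pts e r q.
Proof.
rewrite /near_pts /midpoint_ge /infinite_type /midpoint2.
case: p => p1 p2; case: q => q1 q2; case: r => r1 r2 /= e0.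
case: p1 => [p1| |]; case: q1 => [q1| |]; case: r1 => [r1| |] //;
case: p2 => [p2| |]; case: q2 => [q2| |]; case: r2 => [r2| |] //;
  rewrite /= ?lee_fin ?lte_fin ?eqxx ?leey ?leNye //=.
all: try by move=> *; left; split; rewrite ?lee_fin ?leey ?leNye.
all: move=> ? ? ? ? ? ? ? [//|[// _ ?]].
- have [?|?] := leP p1 (q1 + e); have [?|?] := leP p2 (q2 + e);
    by [left; split; lra | right; split; lra].
- by have [?|?] := leP p1 (q1 + e); [left|right]; split=> //; lra.
- by have [?|?] := leP p2 (q2 + e); [left|right]; split=> //; lra.
Qed.

(** This provides two degrees more than [2 e] apart, one in each bar, at which a composite with
    shift [2 e] can be evaluated. Otherwise both endpoints of [r] would be too small for its
    midpoint, as both bars are long. *)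
Lemma midpoint_gap e p r : 0 <= e -> (p.1 < p.2)%E -> (r.1 < r.2)%E ->
  ~ short_pt e p -> ~ short_pt e r ->
  (r.1 <= p.1 + (e + e)%:E)%E -> (r.2 <= p.2 + (e + e)%:E)%E ->
  midpoint_ge r p -> (p.1 + (e + e)%:E < r.2)%E.
Proof.
rewrite /short_pt /midpoint_ge /infinite_type /midpoint2.
case: p => p1 p2; case: r => r1 r2 /= e0.
case: p1 => [p1| |]; case: r1 => [r1| |] //;
case: p2 => [p2| |]; case: r2 => [r2| |] //;
  rewrite /= ?lee_fin ?lte_fin ?eqxx ?leey ?leNye ?ltry ?ltNyr ?ltNyy //=.
all: move=> ? ? /negP + /negP; rewrite -?ltNge => ? ? ? ? [//|[// _ ?]].
by lra.
Qed.

Lemma midpoint_max (I : finType) (P : pred I) (f : I -> \bar R * \bar R) :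
  (exists i, P i) -> exists2 l, P l & forall i, P i -> midpoint_ge (f l) (f i).
Proof.
case=> i0 Pi0; pose key i := infinite_type (f i).
case: (@arg_maxnP I i0 P key Pi0) => m Pm mP.
pose Q i := P i && (key i == key m).
have Qm : Q m by rewrite /Q Pm eqxx.
case: (@Order.TotalTheory.arg_maxP _ _ I m Q (fun i => midpoint2 (f i)) Qm) => l
  /andP[Pl /eqP kl] lP.
exists l => // i Pi; have : (key i <= key m)%N := mP i Pi;
  rewrite leq_eqVlt => /orP[/eqP ki|ki].
  right; split; first by rewrite -/(key i) -/(key l) ki kl.
  by apply: lP; rewrite /Q Pi ki eqxx.
by left; rewrite -/(key l) kl.
Qed.
End ExtendedReals.

Section Barcodes.
Context (R : realType) (k : fieldType).

(* The bars of A with distinct endpoints are indexed by the copies of the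
   points of D; bars reduced to a point do not contribute to A a b if a < b. *)
Record barcode (n : R -> nat) (A : @msystem k _ R n) (D : diagram R)
    (I : upper R * nat -> set R) (e : upper R * nat -> forall a, 'rV[k]_(n a))
    (p : upper R * nat -> forall a, 'cV[k]_(n a)) : Prop := Barcode {
  bc_system : is_msystem A;
  bc_ends : forall x a, copies D x -> I x a ->
    ((val x.1).1 <= a%:E)%E /\ (a%:E <= (val x.1).2)%E;
  bc_in : forall x a, copies D x -> ((val x.1).1 < a%:E)%E ->
    (a%:E < (val x.1).2)%E -> I x a;
  bc_bar : forall x, copies D x -> is_bar A (I x) (e x) (p x);
  bc_orth : forall x y a, copies D x -> copies D y -> x <> y ->
    e x a *m p y a = 0;
  bc_fin : forall a, exists2 s : seq (upper R * nat), uniq s &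
    forall x, x \in s <-> copies D x /\ I x a;
  bc_sum : forall a b (s : seq (upper R * nat)), a < b -> uniq s ->
    (forall x, x \in s -> copies D x) ->
    (forall x, copies D x -> I x a -> I x b -> x \in s) ->
    A a b = \sum_(x <- s) p x a *m e x b }.

(* F a b is the degree-a part of the morphism followed by the transition map from
   a + d to b; taking all b >= a + d as targets avoids casts along equalities
   such as a + d + d = a + (d + d). *)
Definition mmorphism (d : R) n1 n2 (A1 : @msystem k _ R n1) (A2 : @msystem k _ R n2)
    (F : forall a b, 'M[k]_(n1 a, n2 b)) : Prop :=
  (forall a' a b, a' <= a -> a + d <= b -> A1 a' a *m F a b = F a' b) /\
  (forall a b b', a + d <= b -> b <= b' -> F a b *m A2 b b' = F a b').

Definition minterleaved (d : R) n1 n2 (A1 : @msystem k _ R n1)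
    (A2 : @msystem k _ R n2) : Prop :=
  exists F G, [/\ mmorphism d A1 A2 F, mmorphism d A2 A1 G,
    forall a b c : R, a + d <= b -> b + d <= c -> F a b *m G b c = A1 a c &
    forall a b c : R, a + d <= b -> b + d <= c -> G a b *m F b c = A2 a c].

Section BarHom.
Context (d : R) (n1 n2 : R -> nat) (A1 : @msystem k _ R n1)
  (A2 : @msystem k _ R n2).
Context (F : forall a b, 'M[k]_(n1 a, n2 b)) (FP : mmorphism d A1 A2 F).
Context (I1 : set R) (e1 : forall a, 'rV[k]_(n1 a)) (p1 : forall a, 'cV[k]_(n1 a)).
Context (I2 : set R) (e2 : forall a, 'rV[k]_(n2 a)) (p2 : forall a, 'cV[k]_(n2 a)).
Hypotheses (bar1 : is_bar A1 I1 e1 p1) (bar2 : is_bar A2 I2 e2 p2).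

Definition bar_entry a b : 'M[k]_1 := e1 a *m F a b *m p2 b.

Lemma bar_entry_left a' a b : I1 a' -> a' <= a -> a + d <= b ->
  bar_entry a' b = bar_entry a b.
Proof.
move=> Ia aa' ab; rewrite /bar_entry -(bar_eB bar1 aa') //.
by rewrite -(mulmxA (e1 a') (A1 a' a)) FP.1.
Qed.

Lemma bar_entry_right a b b' : I2 b' -> a + d <= b -> b <= b' ->
  bar_entry a b' = bar_entry a b.
Proof.
move=> Ib ab bb'; rewrite /bar_entry -(bar_Bp bar2 bb') //.
by rewrite mulmxA -(mulmxA (e1 a) (F a b)) FP.2.
Qed.

(** The coefficient of the morphism between two bars is the same in all admissible degrees, by
    [bar_homE]; it is set to 0 if there are none. *)
Definition bar_hom : k :=
  if pselect (exists ab : R * R, [/\ I1 ab.1, I2 ab.2 & ab.1 + d <= ab.2]) is left h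
  then bar_entry (sval (cid h)).1 (sval (cid h)).2 0 0 else 0.

Lemma bar_homE a b : I1 a -> I2 b -> a + d <= b -> bar_entry a b = bar_hom%:M.
Proof.
move=> Ia Ib ab; rewrite [LHS]mx11_scalar; congr (_%:M).
rewrite /bar_hom; case: pselect => [h|[]]; last by exists (a, b).
case: (cid h) => -[a' b'] /= [Ia' Ib' a'b'].
(* Two admissible pairs are compared through the pair with the earlier source and the later
   target. *)
pose a0 := Order.min a a'; pose b0 := Order.max b b'.
have Ia0 : I1 a0 by rewrite /a0 minEle; case: ifP.
have Ib0 : I2 b0 by rewrite /b0 maxEle; case: ifP.
suff H x y : I1 x -> I2 y -> a0 <= x -> y <= b0 -> x + d <= y ->
    bar_entry x y = bar_entry a0 b0.
  by rewrite !(H a b, H a' b') // /a0 /b0 ?ge_min ?le_max ?lexx ?orbT.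
move=> Ix Iy ax yb xy; rewrite (@bar_entry_left a0 x) //; last exact: le_trans yb.
by rewrite (@bar_entry_right x y).
Qed.

(** The entry from [a] to [b'] factors through degree [b], where [p2] is zero if the bar is
    absent. *)
Lemma bar_hom_cod a b b' : bar_hom <> 0 -> I1 a -> a + d <= b ->
  I2 b' -> b <= b' -> I2 b.
Proof.
move=> h0 Ia ab Ib' bb'; apply: contrapT => nIb; apply: h0.
have := bar_homE Ia Ib' (le_trans ab bb').
rewrite (@bar_entry_right a b) // /bar_entry (bar_p0 bar2) // mulmx0.
by move=> /matrixP/(_ 0 0); rewrite !mxE eqxx mulr1n.
Qed.

Lemma bar_hom_dom a a' b : bar_hom <> 0 -> I2 b -> a + d <= b ->
  I1 a' -> a' <= a -> I1 a.
Proof.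
move=> h0 Ib ab Ia' aa'; apply: contrapT => nIa; apply: h0.
have ab' : a' + d <= b by apply: le_trans ab; rewrite lerD2r.
have := bar_homE Ia' Ib ab'.
rewrite (@bar_entry_left a' a) // /bar_entry (bar_e0 bar1) // !mul0mx.
by move=> /matrixP/(_ 0 0); rewrite !mxE eqxx mulr1n.
Qed.

Context (u v : upper R).
Hypotheses (I1_ends : forall a, I1 a -> ((val u).1 <= a%:E)%E /\
  (a%:E <= (val u).2)%E)
  (I1_in : forall a, ((val u).1 < a%:E)%E -> (a%:E < (val u).2)%E -> I1 a)
  (I2_ends : forall a, I2 a -> ((val v).1 <= a%:E)%E /\ (a%:E <= (val v).2)%E)
  (I2_in : forall a, ((val v).1 < a%:E)%E -> (a%:E < (val v).2)%E -> I2 a).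

(** Were [v] born later, a degree [a] of the first bar could be chosen with [a + d] before the birth
    of [v], but [bar_hom_cod] puts [a + d] in the second bar. *)
Lemma bar_hom_birth : bar_hom <> 0 -> ((val v).1 <= (val u).1 + d%:E)%E.
Proof.
move=> h0; rewrite leNgt; apply/negP => uv.
have [b1 /andP[vb1 b1v]] := ereal_between (valP v).
have Ib1 : I2 b1 by exact: I2_in.
have : ((val u).1 < Order.min (val u).2 ((val v).1 - d%:E))%E.
  by rewrite lt_min (valP u) lteBrDr.
move=> /ereal_between[a]; rewrite lt_min => /and3P[ua au av].
have Ia : I1 a by exact: I1_in.
have ad : ((a + d)%:E < (val v).1)%E by rewrite EFinD -lteBrDr.
have /I2_ends[+ _] : I2 (a + d).
  apply: (bar_hom_cod h0 Ia _ Ib1) => //.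
  by rewrite -lee_fin ltW // (lt_trans ad).
by rewrite leNgt ad.
Qed.

Lemma bar_hom_death : bar_hom <> 0 -> ((val v).2 <= (val u).2 + d%:E)%E.
Proof.
move=> h0; rewrite leNgt; apply/negP => uv.
have [a1 /andP[ua1 a1u]] := ereal_between (valP u).
have Ia1 : I1 a1 by exact: I1_in.
have : (Order.max (val v).1 ((val u).2 + d%:E) < (val v).2)%E.
  by rewrite gt_max (valP v) uv.
move=> /ereal_between[b]; rewrite gt_max -andbA => /and3P[vb ub bv].
have Ib : I2 b by exact: I2_in.
have ubd : ((val u).2 < (b - d)%:E)%E by rewrite EFinB lteBrDr.
have /I1_ends[_ +] : I1 (b - d).
  apply: (bar_hom_dom h0 Ib _ Ia1); first by rewrite subrK.
  by rewrite -lee_fin ltW // (lt_trans a1u).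
by rewrite leNgt ubd.
Qed.
End BarHom.
End Barcodes.

Section Stability.
Context (R : realType) (k : fieldType) (d : R) (d0 : 0 <= d).
Context (n1 n2 : R -> nat) (A1 : @msystem k _ R n1) (A2 : @msystem k _ R n2).
Context (D1 D2 : diagram R) (I1 I2 : upper R * nat -> set R).
Context (e1 : upper R * nat -> forall a, 'rV[k]_(n1 a))
  (p1 : upper R * nat -> forall a, 'cV[k]_(n1 a))
  (e2 : upper R * nat -> forall a, 'rV[k]_(n2 a))
  (p2 : upper R * nat -> forall a, 'cV[k]_(n2 a)).
Hypotheses (bc1 : barcode A1 D1 I1 e1 p1) (bc2 : barcode A2 D2 I2 e2 p2).
Context (F : forall a b, 'M[k]_(n1 a, n2 b)) (G : forall a b, 'M[k]_(n2 a, n1 b)).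
Hypotheses (FP : mmorphism d A1 A2 F) (GP : mmorphism d A2 A1 G).
Hypothesis FG : forall a b c : R, a + d <= b -> b + d <= c -> F a b *m G b c =
  A1 a c.

Let f x y := bar_hom d F (I1 x) (e1 x) (I2 y) (p2 y).
Let g y z := bar_hom d G (I2 y) (e2 y) (I1 z) (p1 z).

Definition near_copies (x y : upper R * nat) := near_pts d (val x.1) (val y.1).

Let f_ends x y : copies D1 x -> copies D2 y -> f x y <> 0 ->
  ((val y.1).1 <= (val x.1).1 + d%:E)%E /\ ((val y.1).2 <= (val x.1).2 + d%:E)%E.
Proof.
move=> xD yD h0; split.
  apply: (bar_hom_birth FP (bc_bar bc1 xD) (bc_bar bc2 yD) _ _ _ h0) => a.
  - exact: bc_in bc1 _ _ xD.
  - exact: bc_ends bc2 _ _ yD.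
  - exact: bc_in bc2 _ _ yD.
apply: (bar_hom_death FP (bc_bar bc1 xD) (bc_bar bc2 yD) _ _ _ h0) => a.
- exact: bc_ends bc1 _ _ xD.
- exact: bc_in bc1 _ _ xD.
- exact: bc_in bc2 _ _ yD.
Qed.

Let g_ends y z : copies D2 y -> copies D1 z -> g y z <> 0 ->
  ((val z.1).1 <= (val y.1).1 + d%:E)%E /\ ((val z.1).2 <= (val y.1).2 + d%:E)%E.
Proof.
move=> xD yD h0; split.
  apply: (bar_hom_birth GP (bc_bar bc2 xD) (bc_bar bc1 yD) _ _ _ h0) => a.
  - exact: bc_in bc2 _ _ xD.
  - exact: bc_ends bc1 _ _ yD.
  - exact: bc_in bc1 _ _ yD.
apply: (bar_hom_death GP (bc_bar bc2 xD) (bc_bar bc1 yD) _ _ _ h0) => a.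
- exact: bc_ends bc2 _ _ xD.
- exact: bc_in bc2 _ _ xD.
- exact: bc_in bc1 _ _ yD.
Qed.

Let fg_support x y z a b c : copies D1 x -> copies D2 y -> copies D1 z ->
  f x y * g y z <> 0 -> I1 x a -> I1 z c -> a + d <= b -> b + d <= c -> I2 y b.
Proof.
move=> xD yD zD /eqP; rewrite mulf_eq0 => /norP[/eqP fxy /eqP gyz] Ia Ic ab bc.
have [b1 /andP[vb1 b1v]] := ereal_between (valP y.1).
have Ib1 : I2 y b1 by exact: bc_in bc2 _ _ yD vb1 b1v.
have [bb1|/ltW b1b] := leP b b1.
  exact: (bar_hom_cod FP (bc_bar bc1 xD) (bc_bar bc2 yD) fxy Ia ab Ib1 bb1).
exact: (bar_hom_dom GP (bc_bar bc2 yD) (bc_bar bc1 zD) gyz Ic bc Ib1 b1b).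
Qed.

(* On long bars, the composite g o f is unitriangular for midpoint_ge, and only
   bars near x or z contribute to its entries on or above the diagonal. *)
Lemma composite_entry x z (m : seq (upper R * nat)) :
  copies D1 x -> copies D1 z ->
  ~ short_pt d (val x.1) -> ~ short_pt d (val z.1) ->
  midpoint_ge (val z.1) (val x.1) -> uniq m ->
  (forall y, y \in m -> copies D2 y) ->
  (forall y, copies D2 y -> near_copies x y \/ near_copies z y -> y \in m) ->
  \sum_(y <- m) f x y * g y z = (x == z)%:R.
Proof.
move=> xD zD xl zl zx um mD mN.
(* Without this gap, [midpoint_gap] makes every term zero; the gap exists if [x = z], as [x] is
   long. *)
have [|ngap] := pselect ((val x.1).1 + (d + d)%:E < (val z.1).2)%E; last first.
  have xz : x != z.
    apply/eqP => xz; apply: ngap; rewrite -xz; rewrite ltNge; apply/negP.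
    exact: xl.
  rewrite (negPf xz) big_seq big1 // => y /mD yD; apply: contrapT => fg.
  apply: ngap; have /eqP := fg; rewrite mulf_eq0 => /norP[/eqP fxy /eqP gyz].
  have [a b] := f_ends xD yD fxy; have [a' b'] := g_ends yD zD gyz.
  by apply: midpoint_gap (valP x.1) (valP z.1) xl zl _ _ zx => //;
    [exact: leeD_trans a' a | exact: leeD_trans b' b].
move=> /ereal_between[t /andP[xt tz]].
have : ((val x.1).1 < Order.min (val x.1).2 ((t - (d + d))%:E))%E.
  by rewrite lt_min (valP x.1) EFinB lteBrDr.
move=> /ereal_between[a]; rewrite lt_min => /and3P[xa ax at_].
have : (Order.max (val z.1).1 t%:E < (val z.1).2)%E by rewrite gt_max (valP z.1) tz.
move=> /ereal_between[c]; rewrite gt_max -andbA => /and3P[zc tc cz].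
have Ia : I1 x a by exact: bc_in bc1 _ _ xD xa ax.
have Ic : I1 z c by exact: bc_in bc1 _ _ zD zc cz.
rewrite lte_fin in at_; rewrite lte_fin in tc.
(* Two distinct middle degrees, because [bc_sum] expands a transition map into bars only between
   distinct degrees. *)
pose b := a + d; pose b' := t - d.
have ab : a + d <= b by [].
have bb' : b < b' by rewrite /b /b'; lra.
have b'c : b' + d <= c by rewrite /b'; lra.
have ab' : a + d <= b' by exact: ltW.
have bc : b + d <= c by rewrite /b; lra.
have d0' : 0 <= d := d0.
have ac : a <= c by lra.
have [s0 us0 s0P] := bc_fin bc2 b.
(* [m] is enlarged by all bars alive at [b], so that the expansion of [A2 b b'] is complete. *)
pose s := undup (m ++ s0).
have us : uniq s by exact: undup_uniq.
have sD y : y \in s -> copies D2 y.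
  by rewrite mem_undup mem_cat => /orP[/mD//|/s0P[]].
have A2E : A2 b b' = \sum_(y <- s) p2 y b *m e2 y b'.
  apply: (bc_sum bc2) => // y yD Ib _.
  by rewrite mem_undup mem_cat; apply/orP; right; apply/s0P.
have lhs : e1 x a *m A1 a c *m p1 z c = (x == z)%:R.
  rewrite (bar_eB (bc_bar bc1 xD) ac Ia).
  case: eqVneq => [xz|/eqP xz]; last by rewrite (bc_orth bc1).
  by rewrite xz (bar_ep (bc_bar bc1 zD)).
have term y : y \in s ->
    e1 x a *m F a b *m (p2 y b *m e2 y b') *m (G b' c *m p1 z c) =
    (f x y * g y z)%:M :> 'M[k]_1.
  move=> /sD yD.
  have -> : e1 x a *m F a b *m (p2 y b *m e2 y b') *m (G b' c *m p1 z c) =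
      bar_entry F (e1 x) (p2 y) a b *m bar_entry G (e2 y) (p1 z) b' c.
    by rewrite /bar_entry !mulmxA.
  (* A nonzero product forces [y] to be alive at both middle degrees, by [fg_support]; if it is
     absent from one, both sides are zero. *)
  have [Ib|nIb] := pselect (I2 y b); have [Ib'|nIb'] := pselect (I2 y b').
  - rewrite (bar_homE FP (bc_bar bc1 xD) (bc_bar bc2 yD) Ia Ib ab).
    rewrite (bar_homE GP (bc_bar bc2 yD) (bc_bar bc1 zD) Ib' Ic b'c).
    by rewrite -scalar_mxM.
  - rewrite (_ : f x y * g y z = 0).
      by rewrite /bar_entry (bar_e0 (bc_bar bc2 yD)) // !mul0mx mulmx0 raddf0.
    by apply: contrapT => fg; apply: nIb'; exact: fg_support Ia Ic ab' b'c.
  - rewrite (_ : f x y * g y z = 0).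
      by rewrite /bar_entry (bar_p0 (bc_bar bc2 yD)) // mulmx0 mul0mx raddf0.
    by apply: contrapT => fg; apply: nIb; exact: fg_support Ia Ic ab bc.
  - rewrite (_ : f x y * g y z = 0).
      by rewrite /bar_entry (bar_p0 (bc_bar bc2 yD)) // mulmx0 mul0mx raddf0.
    by apply: contrapT => fg; apply: nIb; exact: fg_support Ia Ic ab bc.
have : (\sum_(y <- s) f x y * g y z)%:M = (x == z)%:R :> 'M[k]_1.
  rewrite -lhs -(FG ab' b'c) -(FP.2 _ _ _ ab (ltW bb')) A2E.
  rewrite raddf_sum /= big_seq; under eq_bigr => y ys do rewrite -(term y ys).
  rewrite -big_seq; rewrite !mulmxA -(mulmxA _ (G b' c)) !mulmx_sumr !mulmx_suml.
  by apply: eq_bigr => y _; rewrite !mulmxA.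
move=> /matrixP/(_ 0 0); rewrite [LHS]mxE eqxx mulr1n => E.
(* A bar contributing to the sum is near [x] or [z] by [midpoint_near], hence already in [m]. *)
have -> : \sum_(y <- m) f x y * g y z = \sum_(y <- s) f x y * g y z.
  apply: eq_sum_support => // y ys; first by rewrite mem_undup mem_cat ys.
  move=> /negP ym; have yD := sD _ ys; apply: contrapT => fg; apply: ym.
  have /eqP := fg; rewrite mulf_eq0 => /norP[/eqP fxy /eqP gyz].
  have [? ?] := f_ends xD yD fxy; have [? ?] := g_ends yD zD gyz.
  apply: mN => //.
  exact: midpoint_near (valP x.1) (valP y.1) (valP z.1) _ _ _ _ zx.
by rewrite E; case: eqVneq => _; rewrite ?mxE ?eqxx.
Qed.

Let long x := copies D1 x /\ ~ short_pt d (val x.1).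

(** All bars near a long [x] contain one common degree, chosen between its endpoints moved inwards
    by [d]; only finitely many bars pass through it. *)
Let near_list : exists N : upper R * nat -> seq (upper R * nat),
  (forall x, uniq (N x)) /\
  forall x, long x -> forall y, y \in N x <-> copies D2 y /\ near_copies x y.
Proof.
suff /choice[N NP] : forall x, exists s : seq (upper R * nat), uniq s /\
    (long x -> forall y, y \in s <-> copies D2 y /\ near_copies x y).
  by exists N; split=> x; have [] := NP x.
move=> x; have [[xD xl]|] := pselect (long x); last by exists [::].
have : ((val x.1).1 + d%:E < (val x.1).2 - d%:E)%E.
  rewrite lteBrDr // -addeA -EFinD ltNge; exact/negP.
move=> /ereal_between[t /andP[xt tx]]; have [s us sP] := bc_fin bc2 t.
exists [seq y <- s | `[< near_copies x y >]]; split; first exact: filter_uniq.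
move=> _ y; rewrite mem_filter; split=> [/andP[/asboolP xy /sP[]]//|[yD xy]].
apply/andP; split; [exact/asboolP | apply/sP; split=> //].
case: (xy) => _ yx xy2 _; apply: (bc_in bc2) => //.
  exact: le_lt_trans yx xt.
by apply: lt_le_trans tx _; rewrite leeBlDr.
Qed.

Lemma stability_injection : exists2 h : upper R * nat -> upper R * nat,
  forall x, long x -> copies D2 (h x) /\ near_copies x (h x) &
  forall x x', long x -> long x' -> h x = h x' -> x = x'.
Proof.
have [N [uN NP]] := near_list.
have [[x0 x0l]|nol] := pselect (exists x, long x); last first.
  by exists id => [x xl|x x' xl]; case: nol; exists x.
have [|h hN hi] := @hall_compactness _ _ x0 long N; last first.
  by exists h => // x xl; apply/(NP x xl); exact: hN.
move=> A uA AL; apply: (@hall _ _ x0) => // B uB BA.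
pose m := neighbours N B; rewrite -/m leqNgt; apply/negP => mB.
have BL x : x \in B -> long x by move=> /BA/AL.
have um : uniq m by exact: undup_uniq.
have mD y : y \in m -> copies D2 y.
  by move=> /mem_neighbours[x xB /(NP x (BL x xB))[]].
have mN x y : x \in B -> copies D2 y -> near_copies x y -> y \in m.
  move=> xB yD xy; apply/mem_neighbours; exists x => //.
  by apply/(NP x (BL x xB)).
pose b (i : 'I_(size B)) := nth x0 B i.
pose c (j : 'I_(size m)) := nth x0 m j.
have bB i : b i \in B by exact: mem_nth.
pose M1 := \matrix_(i, j) f (b i) (c j); pose M2 := \matrix_(j, i) g (c j) (b i).
have entry i l : midpoint_ge (val (b l).1) (val (b i).1) -> (M1 *m M2) i l =
  (i == l)%:R.
  move=> li; have [iD il] := BL _ (bB i); have [lD ll] := BL _ (bB l).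
  have := composite_entry iD lD il ll li um mD.
  rewrite (_ : (b i == b l) = (i == l)); last by rewrite nth_uniq.
  move=> <-; last by move=> y yD []; exact: mN.
  rewrite mxE (big_nth x0) big_mkord; apply: eq_bigr => j _.
  by rewrite !mxE.
(* If Hall's condition fails, [M1] has more rows than columns, hence a nonzero left kernel. *)
have /rowV0Pn[w wker w0] : kermx M1 != 0.
  rewrite kermx_eq0 /row_free neq_ltn; apply/orP; left.
  exact: leq_ltn_trans (rank_leq_col _) mB.
(* In the column of the largest bar in the support of [w], only entries on or above the diagonal are
   used, so the product returns [w 0 l], which is nonzero. *)
have [|l wl lmax] := @midpoint_max R _ (fun i => w 0 i != 0) (fun i => val (b i).1).
  apply/existsP; apply: contra_neqT w0 => /existsPn H.
  by apply/rowP => i; rewrite [RHS]mxE; apply/eqP; rewrite -[_ == _]negbK.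
have : (w *m (M1 *m M2)) 0 l = 0.
  by rewrite mulmxA (sub_kermxP wker) mul0mx mxE.
rewrite mxE (bigD1 l) //= big1 ?addr0 => [|i il].
  by rewrite entry ?eqxx ?mulr1 => [/eqP|]; [rewrite (negPf wl)|right].
have [->|wi] := eqVneq (w 0 i) 0; first by rewrite mul0r.
by rewrite entry ?(negPf il) ?mulr0 //; exact: lmax.
Qed.

End Stability.

Theorem bclose_of_minterleaved (R : realType) (k : fieldType) (d : R) n1 n2
    (A1 : @msystem k _ R n1) (A2 : @msystem k _ R n2) (D1 D2 : diagram R)
    I1 e1 p1 I2 e2 p2 : 0 <= d ->
  barcode A1 D1 I1 e1 p1 -> barcode A2 D2 I2 e2 p2 ->
  minterleaved d A1 A2 -> bclose d D1 D2.
Proof.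
move=> d0 bc1 bc2 [F [G [FP GP FG GF]]].
have [h hN hi] := stability_injection d0 bc1 bc2 FP GP FG.
have [h' hN' hi'] := stability_injection d0 bc2 bc1 GP FP GF.
have [S [SP Sf Si S1 S2]] := cantor_bernstein_matching hi hi'.
exists S; split=> //.
- by move=> x y /SP[[[]]//|[/hN'[? _] ->]].
- by move=> x y /SP[[/hN[? _] ->]|[[]]].
- by move=> x y /SP[[/hN[_ ?] ->]|[/hN'[_ ?] ->]] //; exact: near_pts_sym.
- move=> x xD; have [|xl] := pselect (short_pt d (val x.1)); first by right.
  by left; exact: S1.
- move=> x xD; have [|xl] := pselect (short_pt d (val x.1)); first by right.
  by left; exact: S2.
Qed.

(** * From matchings to interleavings *)

Section MatchedMorphism.
Context (R : realType) (k : fieldType) (c d : R) (c0 : 0 <= c) (cd : c < d).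
Context (n1 n2 : R -> nat) (A1 : @msystem k _ R n1) (A2 : @msystem k _ R n2).
Context (D1 D2 : diagram R) (I1 I2 : upper R * nat -> set R).
Context (e1 : upper R * nat -> forall a, 'rV[k]_(n1 a))
  (p1 : upper R * nat -> forall a, 'cV[k]_(n1 a))
  (e2 : upper R * nat -> forall a, 'rV[k]_(n2 a))
  (p2 : upper R * nat -> forall a, 'cV[k]_(n2 a)).
Hypotheses (bc1 : barcode A1 D1 I1 e1 p1) (bc2 : barcode A2 D2 I2 e2 p2).
Context (S : upper R * nat -> upper R * nat -> Prop) (SP : matched c D1 D2 S).

Definition bars_at a : seq (upper R * nat) := s2val (cid2 (bc_fin bc1 a)).

Lemma bars_at_uniq a : uniq (bars_at a).
Proof. exact: (s2valP (cid2 (bc_fin bc1 a))). Qed.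

Lemma bars_atP a x : x \in bars_at a <-> copies D1 x /\ I1 x a.
Proof. exact: (s2valP' (cid2 (bc_fin bc1 a))). Qed.

Definition partner x := xget x [set y | S x y].

Definition match_term x a b : 'M[k]_(n1 a, n2 b) :=
  if `[< S x (partner x) >] then p1 x a *m e2 (partner x) b else 0.

Definition match_mor a b : 'M[k]_(n1 a, n2 b) :=
  \sum_(x <- bars_at a) match_term x a b.

Let near x y : S x y -> near_pts c (val x.1) (val y.1).
Proof. by move=> xy; exact: (matched_near SP xy). Qed.

(** The strict inequality [c < d] places [a] strictly before the death of [x], where membership does
    not depend on the type of the endpoint. [cod_long] is the analogue at births. *)
Let dom_long x y a a' b : S x y -> I1 x a' -> a' <= a -> a + d <= b -> I2 y b ->
  I1 x a.
Proof.
move=> xy Ia' aa' ab Ib; have xD := matched_dom SP xy; have yD := matched_cod SP xy.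
have [<-//|a'a] := eqVneq a' a; have {}a'a : a' < a by rewrite lt_neqAle a'a.
have [xa' _] := bc_ends bc1 xD Ia'; have [_ yb] := bc_ends bc2 yD Ib.
have [_ _ _ yx] := near xy; apply: (bc_in bc1) => //.
  by apply: le_lt_trans xa' _; rewrite lte_fin.
have : (b%:E <= (val x.1).2 + c%:E)%E by exact: le_trans yb yx.
rewrite -leeBlDr //; apply: lt_le_trans.
by rewrite -EFinB lte_fin; have := cd; lra.
Qed.

Let cod_long x y a b b' : S x y -> I1 x a -> a + d <= b -> b <= b' -> I2 y b' ->
  I2 y b.
Proof.
move=> xy Ia ab bb' Ib'; have xD := matched_dom SP xy; have yD := matched_cod SP xy.
have [->//|b'b] := eqVneq b b'; have {}b'b : b < b' by rewrite lt_neqAle b'b.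
have [xa _] := bc_ends bc1 xD Ia; have [_ yb] := bc_ends bc2 yD Ib'.
have [_ yx _ _] := near xy; apply: (bc_in bc2) => //.
  apply: le_lt_trans yx _; apply: (@le_lt_trans _ _ (a + c)%:E).
    by rewrite EFinD leeD2r.
  by rewrite lte_fin; have := cd; lra.
by apply: lt_le_trans yb; rewrite lte_fin.
Qed.

Lemma match_mor_morphism : mmorphism d A1 A2 match_mor.
Proof.
split=> [a' a b a'a ab|a b b' ab bb'].
  rewrite /match_mor mulmx_sumr.
  transitivity (\sum_(x <- bars_at a) match_term x a' b).
    rewrite big_seq [RHS]big_seq; apply: eq_bigr => x /bars_atP[xD Ia].
    rewrite /match_term; case: asboolP => [_|]; last by rewrite mulmx0.
    by rewrite mulmxA (bar_Bp (bc_bar bc1 xD)).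
  apply: eq_sum_support; try exact: bars_at_uniq.
    move=> x /bars_atP[xD Ix] /negP nx; rewrite /match_term; case: asboolP => // _.
    rewrite (bar_p0 (bc_bar bc1 xD)) ?mul0mx // => Ia'.
    by apply: nx; apply/bars_atP.
  move=> x /bars_atP[xD Ix] /negP nx; rewrite /match_term; case: asboolP => // xy.
  rewrite (bar_e0 (bc_bar bc2 (matched_cod SP xy))) ?mulmx0 // => Ib.
  by apply: nx; apply/bars_atP; split=> //; exact: dom_long xy Ix a'a ab Ib.
rewrite /match_mor mulmx_suml big_seq [RHS]big_seq;
  apply: eq_bigr => x /bars_atP[xD Ia].
rewrite /match_term; case: asboolP => [xy|]; last by rewrite mul0mx.
have barP := bc_bar bc2 (matched_cod SP xy).
rewrite -mulmxA; have [Ib|nIb] := pselect (I2 (partner x) b).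
  by rewrite (bar_eB barP).
rewrite (bar_e0 barP nIb) mul0mx (bar_e0 barP) // => Ib'.
by apply: nIb; exact: cod_long xy Ia ab bb' Ib'.
Qed.

Lemma partnerP x y : S x y -> partner x = y.
Proof.
move=> xy; have := @xgetPex _ x [set y | S x y] (ex_intro _ y xy).
by move=> /(matched_fun SP) /(_ xy).
Qed.

Lemma e_match_mor x y a b : S x y -> e1 x a *m match_mor a b =
  if `[< I1 x a >] then e2 y b else 0.
Proof.
move=> xy; have xD := matched_dom SP xy; have barP := bc_bar bc1 xD.
case: asboolP => [Ia|nIa]; last by rewrite (bar_e0 barP) ?mul0mx.
rewrite /match_mor mulmx_sumr (bigD1_seq x) ?bars_at_uniq //=; last exact/bars_atP.
rewrite big_seq_cond big1 ?addr0 => [|z /andP[/bars_atP[zD Iz] zx]].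
  rewrite /match_term (partnerP xy); case: asboolP => // _.
  by rewrite mulmxA (bar_ep barP) // mul1mx.
rewrite /match_term; case: asboolP => [zz|]; last by rewrite mulmx0.
rewrite mulmxA (bc_orth bc1) // ?mul0mx // => /eqP.
by rewrite eq_sym (negPf zx).
Qed.
End MatchedMorphism.

Section Converse.
Context (R : realType) (k : fieldType) (c d : R) (c0 : 0 <= c) (cd : c < d).

(** A bar alive at both [x] and [z] has length at least [2 d > 2 c], so it is matched, and its
    partner is alive at [y]. A bar absent from [z] contributes 0 to both sides. *)
Lemma match_mor_comp (n1 n2 : R -> nat) (A1 : @msystem k _ R n1)
  (A2 : @msystem k _ R n2)
    (D1 D2 : diagram R) I1 e1 p1 I2 e2 p2
    (bc1 : barcode A1 D1 I1 e1 p1) (bc2 : barcode A2 D2 I2 e2 p2) S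
    (SP : matched c D1 D2 S) x y z : x + d <= y -> y + d <= z ->
  match_mor e2 bc1 S x y *m match_mor e1 bc2 (fun x y => S y x) y z = A1 x z.
Proof.
move=> xy yz; have xz : x < z by have := c0; have := cd; lra.
rewrite (bc_sum bc1 xz (bars_at_uniq bc1 x)); first last.
- by move=> w wD Iw _; apply/bars_atP.
- by move=> w /bars_atP[].
rewrite {1}/match_mor mulmx_suml big_seq [RHS]big_seq.
apply: eq_bigr => w /bars_atP[wD Iw]; rewrite /match_term.
have [Iz|nIz] := pselect (I1 w z); last first.
  rewrite (bar_e0 (bc_bar bc1 wD) nIz) mulmx0.
  case: asboolP => [ww|]; last by rewrite mul0mx.
  rewrite -mulmxA (e_match_mor e1 bc2 (matched_sym SP) _ _ ww).
  by rewrite (bar_e0 (bc_bar bc1 wD) nIz); case: asboolP; rewrite mulmx0.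
have [wx xw] := bc_ends bc1 wD Iw; have [wz zw] := bc_ends bc1 wD Iz.
have [[v wv]|short] := matched_short1 SP wD; last first.
  have : (z%:E <= x%:E + (c + c)%:E)%E.
    apply: le_trans zw _; apply: le_trans short _.
    by rewrite leeD2r.
  by rewrite -EFinD lee_fin => zx; exfalso; have := cd; lra.
rewrite (partnerP SP wv); case: asboolP => // _.
rewrite -mulmxA (e_match_mor e1 bc2 (matched_sym SP) _ _ wv).
case: asboolP => // -[]; have [n1' n2' n3 n4] := matched_near SP wv.
apply: (bc_in bc2 (matched_cod SP wv)).
  apply: le_lt_trans n2' _; apply: (@le_lt_trans _ _ (x + c)%:E).
    by rewrite EFinD leeD2r.
  by rewrite lte_fin; have := cd; lra.
have : (z%:E <= (val v.1).2 + c%:E)%E by exact: le_trans zw n3.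
rewrite -leeBlDr //; apply: lt_le_trans.
by rewrite -EFinB lte_fin; have := cd; lra.
Qed.

Theorem minterleaved_of_bclose (n1 n2 : R -> nat) (A1 : @msystem k _ R n1)
    (A2 : @msystem k _ R n2) (D1 D2 : diagram R) I1 e1 p1 I2 e2 p2 :
  barcode A1 D1 I1 e1 p1 -> barcode A2 D2 I2 e2 p2 ->
  bclose c D1 D2 -> minterleaved d A1 A2.
Proof.
move=> bc1 bc2 [S SP]; have SP' := matched_sym SP.
exists (match_mor e2 bc1 S), (match_mor e1 bc2 (fun x y => S y x)).
split.
- exact: (match_mor_morphism cd bc1 bc2 SP).
- exact: (match_mor_morphism cd bc2 bc1 SP').
- exact: (match_mor_comp bc1 bc2 SP).
- exact: (match_mor_comp bc2 bc1 SP').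
Qed.
End Converse.

(** * Coordinates *)

Record frame (k : fieldType) (V : lmodType k) := Frame {
  frame_dim : nat;
  of_coords : {linear 'rV[k]_frame_dim -> V};
  to_coords : {linear V -> 'rV[k]_frame_dim};
  of_coordsK : cancel of_coords to_coords;
  to_coordsK : cancel to_coords of_coords }.

Section Combination.
Context (k : fieldType) (V : lmodType k) (n : nat) (b : 'I_n -> V).

Definition combination (v : 'rV[k]_n) : V := \sum_i v 0 i *: b i.

Fact combination_linear : linear combination.
Proof.
move=> c u v; rewrite /combination scaler_sumr -big_split /=.
by apply: eq_bigr => i _; rewrite !mxE scalerA -scalerDl.
Qed.

HB.instance Definition _ := GRing.isLinear.Build k 'rV[k]_n V _ combination
  combination_linear.
End Combination.

(** A spanning family of minimal size is a basis. *)
Lemma frame_exists (k : fieldType) (V : lmodType k) :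
  fin_dim V -> exists f : frame V, True.
Proof.
case=> n0 [b0 b0P].
pose spans (x : {n : nat & 'I_n -> V}) :=
  forall v, exists c : 'I_(projT1 x) -> k, v = \sum_i c i *: projT2 x i.
have [|[n b] /= bP bmin] := @ex_min_nat _ spans (fun x => projT1 x).
  by exists (existT _ n0 b0).
have inj v : combination b v = 0 -> v = 0.
  case: n => [|n] in b bP bmin v *; first by move=> _; apply/rowP => -[].
  move=> v0; apply: contrapT => /eqP nv.
  have [i vi] : exists i, v 0 i != 0.
    apply/existsP; apply: contra_neqT nv => /existsPn H.
    by apply/rowP => j; rewrite [RHS]mxE; apply/eqP; rewrite -[_ == _]negbK.
  suff : spans (existT _ n (fun j => b (lift i j))) by move=> /bmin /=;
    rewrite ltnn.
  move=> w; have [c wE] := bP w.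
  (* A relation [v] with [v 0 i != 0] eliminates [b i], contradicting minimality. *)
  exists (fun j => c (lift i j) - c i / v 0 i * v 0 (lift i j)) => /=.
  have -> : w = w - (c i / v 0 i) *: combination b v by rewrite v0 scaler0 subr0.
  rewrite wE /combination !(bigD1_ord i) //= scalerDr scalerA divfK //.
  rewrite opprD addrACA subrr add0r scaler_sumr -sumrB.
  by apply: eq_bigr => j _; rewrite scalerBl scalerA.
pose h : {linear 'rV[k]_n -> V} := combination b.
have hinj : injective h by move=> u v uv; apply/eqP; rewrite -subr_eq0;
  apply/eqP/inj; rewrite -[combination b]/(h : _ -> _) raddfB /= uv subrr.
have /choice[g gP] : forall x, exists v, h v = x.
  move=> x; have [c xE] := bP x; exists (\row_i c i).
  by rewrite xE /= /combination; apply: eq_bigr => i _; rewrite mxE.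
have glin : linear g.
  by move=> c u v; apply: hinj; rewrite linearP !gP.
pose gl := GRing.isLinear.Build k V 'rV[k]_n _ g glin.
pose G : {linear V -> 'rV[k]_n} := HB.pack g gl.
by exists (@Frame k V n h G (fun v => hinj _ _ (gP (h v))) gP).
Qed.

Section FrameMatrix.
Context (k : fieldType).

Definition frame_mx (V W : lmodType k) (fV : frame V) (fW : frame W)
    (h : {linear V -> W}) : 'M[k]_(frame_dim fV, frame_dim fW) :=
  lin1_mx (to_coords fW \o h \o of_coords fV).

Lemma frame_mxE (V W : lmodType k) (fV : frame V) (fW : frame W)
    (h : {linear V -> W}) v :
  of_coords fW (v *m frame_mx fV fW h) = h (of_coords fV v).
Proof. by rewrite mul_rV_lin1 /= to_coordsK. Qed.

Lemma frame_mx_eq (V W : lmodType k) (fV : frame V) (fW : frame W)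
    (A B : 'M[k]_(frame_dim fV, frame_dim fW)) :
  (forall v, of_coords fW (v *m A) = of_coords fW (v *m B)) -> A = B.
Proof.
move=> AB; apply/row_matrixP => i; rewrite !rowE.
by apply: (can_inj (@of_coordsK _ _ fW)); exact: AB.
Qed.

Section System.
Context (disp : Order.disp_t) (T : orderType disp) (V : T -> lmodType k).
Context (tr : forall a b : T, (a <= b)%O -> {linear V a -> V b}).
Hypotheses (tr_id : forall a (aa : (a <= a)%O) v, tr aa v = v)
  (tr_comp : forall a b c (ab : (a <= b)%O) (bc : (b <= c)%O) (ac : (a <= c)%O) v,
    tr bc (tr ab v) = tr ac v).
Context (fr : forall a, frame (V a)).

Definition tr_mx : msystem k (fun a => frame_dim (fr a)) := fun a b =>
  if pselect (a <= b)%O is left ab then frame_mx (fr a) (fr b) (tr ab) else 0.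

Lemma tr_mxE a b (ab : (a <= b)%O) v :
  of_coords (fr b) (v *m tr_mx a b) = tr ab (of_coords (fr a) v).
Proof.
rewrite /tr_mx; case: pselect => // ab'.
by rewrite frame_mxE (bool_irrelevance ab' ab).
Qed.

Lemma tr_mx_id a : tr_mx a a = 1%:M.
Proof. by apply: frame_mx_eq => v; rewrite tr_mxE tr_id mulmx1. Qed.

Lemma tr_mx_system : is_msystem tr_mx.
Proof.
move=> a b c ab bc; apply: frame_mx_eq => v.
by rewrite mulmxA !tr_mxE ?(le_trans ab bc) // => ac; rewrite (tr_comp ab bc ac).
Qed.
End System.
End FrameMatrix.

(** * Morphisms of persistence modules as matrices *)

Lemma xpow_mul (R : realType) (k : fieldType) (M : lmodType (B1 R k))
    (g h l : expo R) (m : M) : g%:num + h%:num = l%:num ->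
  xpow k g *: (xpow k h *: m) = xpow k l *: m.
Proof.
by move=> ghl; rewrite scalerA -xpowD; congr (xpow k _ *: _); exact/val_inj.
Qed.

Section PersmodMatrix.
Context (R : realType) (k : fieldType) (M : persmod R k).
Context (fr : forall a, frame (hpart M a)).

Definition persmod_mx : @msystem k _ R (fun a => frame_dim (fr a)) :=
  tr_mx (fun a b (ab : (a <= b)%O) => phi ab : {linear hpart M a -> hpart M b}) fr.

Lemma persmod_mxE a b (ab : a <= b) v :
  of_coords (fr b) (v *m persmod_mx a b) = phi ab (of_coords (fr a) v).
Proof. exact: tr_mxE. Qed.

Lemma persmod_mx_id a : persmod_mx a a = 1%:M.
Proof. by apply: tr_mx_id => b bb v; exact: phi_id. Qed.

Lemma persmod_mx_system : is_msystem persmod_mx.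
Proof. by apply: tr_mx_system => a b c ab bc ac v; exact: phi_comp. Qed.

End PersmodMatrix.

Section HomogeneousMaps.
Context (R : realType) (k : fieldType) (M N : persmod R k) (e : expo R).
Context (f : persmor M (Defs.shift N e)).

Fact degree_map_subproof a (m : hpart M a) :
  (pfun f (val m : M) : kspace N) \in @pdeg R k N (a + e%:num).
Proof.
apply: mem_set; have := pfun_deg f (set_mem (valP m) : pdeg a (val m : M)).
by [].
Qed.

Definition degree_map a (m : hpart M a) : hpart N (a + e%:num) :=
  Sub (pfun f (val m : M) : N) (degree_map_subproof m).

Fact degree_map_linear a : linear (@degree_map a).
Proof.
move=> c u v; apply/val_inj.
transitivity (pfun f (c%:A *: (val u : M) + (val v : M))); first by [].
by rewrite linearP.
Qed.

HB.instance Definition _ a := GRing.isLinear.Build k (hpart M a)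
  (hpart N (a + e%:num)) _ (@degree_map a) (@degree_map_linear a).

Context (frM : forall a, frame (hpart M a)) (frN : forall a, frame (hpart N a)).

Definition persmor_mx a b : 'M[k]_(frame_dim (frM a), frame_dim (frN b)) :=
  if pselect (a + e%:num <= b) is left ab
  then frame_mx (frM a) (frN (a + e%:num)) (degree_map (a := a)) *m
       persmod_mx frN (a + e%:num) b
  else 0.

Lemma persmor_mxE a b (ab : a + e%:num <= b) v :
  val (of_coords (frN b) (v *m persmor_mx a b)) =
  xpow k (gap ab) *: pfun f (val (of_coords (frM a) v)) :> N.
Proof.
rewrite /persmor_mx; case: pselect => // ab'.
rewrite mulmxA persmod_mxE frame_mxE /=.
by rewrite (bool_irrelevance ab' ab).
Qed.

Lemma persmor_mx_morphism :
  mmorphism e%:num (persmod_mx frM) (persmod_mx frN) persmor_mx.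
Proof.
split=> [a' a b a'a ab|a b b' ab bb']; apply: frame_mx_eq => v; apply/val_inj.
  have a'b : a' + e%:num <= b by apply: le_trans ab; rewrite lerD2r.
  rewrite mulmxA !persmor_mxE persmod_mxE /=.
  rewrite -[X in pfun f X]/(xpow k (gap a'a) *: (val (of_coords (frM a') v) : M)).
  rewrite linearZ /=; apply: xpow_mul; rewrite /=; lra.
have ab' : a + e%:num <= b' by exact: le_trans bb'.
rewrite mulmxA persmod_mxE [RHS]persmor_mxE /= persmor_mxE.
by apply: (xpow_mul (M := pcar N)); rewrite /=; lra.
Qed.
End HomogeneousMaps.

Lemma minterleaved_of_interleaved (R : realType) (k : fieldType)
    (M N : persmod R k) (frM : forall a, frame (hpart M a))
    (frN : forall a, frame (hpart N a)) (e : expo R) :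
  interleaved M N e -> minterleaved e%:num (persmod_mx frM) (persmod_mx frN).
Proof.
case=> f [g [gf fg]]; exists (persmor_mx f frM frN), (persmor_mx g frN frM).
have comp (M' N' : persmod R k) (frM' : forall a, frame (hpart M' a))
    (frN' : forall a, frame (hpart N' a)) (f' : persmor M' (Defs.shift N' e))
    (g' : persmor N' (Defs.shift M' e)) a b c :
    (forall m : M', shift_mor e g' (f' m) = smor M' (expo_add e e) m :> M') ->
    a + e%:num <= b -> b + e%:num <= c ->
    persmor_mx f' frM' frN' a b *m persmor_mx g' frN' frM' b c =
    persmod_mx frM' a c.
  move=> gf' ab bc; have ac : a <= c.
    by apply: le_trans (le_trans ab _); rewrite ?(le_trans _ bc) ?lerDl.
  apply: frame_mx_eq => v; apply/val_inj; rewrite mulmxA persmor_mxE persmod_mxE /=.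
  rewrite persmor_mxE linearZ /=.
  have := gf' (val (of_coords (frM' a) v)); rewrite /= => ->.
  rewrite (xpow_mul (M := pcar M') (l := expo_add (gap bc) (gap ab))) //.
  by apply: (xpow_mul (M := pcar M')); rewrite /=; lra.
split; [exact: persmor_mx_morphism|exact: persmor_mx_morphism| |] => a b c.
- exact: comp.
- exact: comp.
Qed.

(** * From matrices back to morphisms of modules *)

Section DirectDecomposition.
Context (V : zmodType) (I : eqType) (P : I -> set V).
Hypothesis dd : direct_decomposition P.
Hypotheses (P0 : forall i, P i 0)
  (PB : forall i u v, P i u -> P i v -> P i (u - v)).

Lemma big_extend0 (W : nmodType) (s r : seq I) (u : I -> W) :
  uniq s -> uniq r -> {subset s <= r} ->
  \sum_(i <- r) (if i \in s then u i else 0) = \sum_(i <- s) u i.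
Proof.
move=> us ur sr; rewrite -big_mkcond -big_filter; apply: perm_big.
apply: uniq_perm; rewrite ?filter_uniq // => i.
by rewrite mem_filter; case: (boolP (i \in s)) => //= /sr.
Qed.

Lemma direct_decomposition_uniq (s t : seq I) (u v : I -> V) :
  uniq s -> uniq t -> (forall i, P i (u i)) -> (forall i, P i (v i)) ->
  \sum_(i <- s) u i = \sum_(i <- t) v i ->
  forall i, (if i \in s then u i else 0) = (if i \in t then v i else 0).
Proof.
move=> us ut uP vP uv i; pose r := undup (s ++ t).
have sr : {subset s <= r} by move=> j js; rewrite mem_undup mem_cat js.
have tr : {subset t <= r} by move=> j jt; rewrite mem_undup mem_cat jt orbT.
have [ir|] := boolP (i \in r); last first.
  by rewrite mem_undup mem_cat negb_or => /andP[/negPf-> /negPf->].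
apply/eqP; rewrite -subr_eq0; apply/eqP.
apply: (dd.2 r (fun i => (if i \in s then u i else 0) -
  (if i \in t then v i else 0)) _ _ _ i ir).
- exact: undup_uniq.
- by move=> j; apply: PB; case: ifP.
- by rewrite sumrB !big_extend0 ?undup_uniq // uv subrr.
Qed.

(** [f] sums the images of the components in a chosen decomposition; uniqueness of components makes
    it independent of the choice, hence additive. *)
Lemma direct_extension (W : zmodType) (h : I -> V -> W) :
  (forall i u v, P i u -> P i v -> h i (u - v) = h i u - h i v) ->
  exists f : V -> W, (forall u v, f (u - v) = f u - f v) /\
    forall i v, P i v -> f v = h i v.
Proof.
move=> hB; have h0 i : h i 0 = 0 by rewrite -(subrr 0) hB // subrr.
have /choice[ds dsP] : forall v : V, exists x : seq I * (I -> V),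
    [/\ uniq x.1, forall i, P i (x.2 i) & v = \sum_(i <- x.1) x.2 i].
  by move=> v; have [s [u uP]] := dd.1 v; exists (s, u).
pose f v := \sum_(i <- (ds v).1) h i ((ds v).2 i).
have fE s u : uniq s -> (forall i, P i (u i)) ->
    f (\sum_(i <- s) u i) = \sum_(i <- s) h i (u i).
  move=> us uP; set v := \sum_(i <- s) u i; have [ut vP vE] := dsP v.
  have eqi := direct_decomposition_uniq us ut uP vP vE.
  pose r := undup (s ++ (ds v).1).
  have sr : {subset s <= r} by move=> j js; rewrite mem_undup mem_cat js.
  have tr : {subset (ds v).1 <= r} by move=> j jt;
    rewrite mem_undup mem_cat jt orbT.
  rewrite /f -(big_extend0 _ us (undup_uniq _) sr)
    -(big_extend0 _ ut (undup_uniq _) tr).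
  apply: eq_bigr => i _; have := congr1 (h i) (eqi i).
  by rewrite !(fun_if (h i)) h0 => ->.
exists f; split=> [u v|i v vP].
  have [us uP uE] := dsP u; have [vs vP vE] := dsP v.
  pose s := (ds u).1; pose t := (ds v).1; pose r := undup (s ++ t).
  have sr : {subset s <= r} by move=> j js; rewrite mem_undup mem_cat js.
  have tr : {subset t <= r} by move=> j jt; rewrite mem_undup mem_cat jt orbT.
  have ur : uniq r by exact: undup_uniq.
  rewrite {1}uE {1}vE -(big_extend0 _ us ur sr) -(big_extend0 _ vs ur tr) -sumrB.
  rewrite fE // => [|i]; last by apply: PB; case: ifP.
  under eq_bigr => i _.
    rewrite hB; [|by case: ifP|by case: ifP].
    over.
  rewrite sumrB /f -(big_extend0 _ us ur sr) -(big_extend0 _ vs ur tr).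
  by congr (_ - _); apply: eq_bigr => i _; rewrite (fun_if (h i)) h0.
have := @fE [:: i] (fun j => if j == i then v else 0) isT.
rewrite !big_seq1 eqxx; apply=> j; case: eqP => [->//|_]; exact: P0.
Qed.
End DirectDecomposition.

(** Linearity over [B1] thus reduces to scalars of [k] and powers of [x]. *)
Lemma B1_expand (R : realType) (k : fieldType) (p : B1 R k) :
  exists s : seq (k * expo R), p = \sum_(x <- s) x.1%:A * xpow k x.2.
Proof.
exists [seq (monalg.mcoeff a p, a) | a <- finmap.enum_fset (monalg.msupp p)].
rewrite big_map {1}[p]monalg.monalgE; apply: eq_bigr => a _ /=.
rewrite -scalerAl mul1r; apply/monalg.malgP => b.
rewrite monalg.mcoeffZ /xpow !monalg.mcoeffU.
by rewrite mulrnAr mulr1.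
Qed.

Section MatrixMorphism.
Context (R : realType) (k : fieldType) (M N : persmod R k) (e : expo R).
Context (frM : forall a, frame (hpart M a)) (frN : forall a, frame (hpart N a)).
Context (F : forall a b, 'M[k]_(frame_dim (frM a), frame_dim (frN b))).
Hypothesis FP : mmorphism e%:num (persmod_mx frM) (persmod_mx frN) F.

Definition homogeneous_part (a : R) (m : kspace M) : hpart M a :=
  if pselect (pdeg a m) is left h then Sub m (mem_set h) else 0.

Lemma homogeneous_partE a m : pdeg a m -> val (homogeneous_part a m) = m.
Proof. by rewrite /homogeneous_part; case: pselect. Qed.

Lemma pdeg_val a (v : hpart M a) : pdeg a (val v : kspace M).
Proof. exact: set_mem (valP v). Qed.

Definition mx_part a (v : hpart M a) : hpart N (a + e%:num) :=
  of_coords (frN (a + e%:num)) (to_coords (frM a) v *m F a (a + e%:num)).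

Lemma mx_part_linear a c u v :
  @mx_part a (c *: u + v) = c *: mx_part u + mx_part v.
Proof. by rewrite /mx_part linearP mulmxDl -scalemxAl linearP. Qed.

Lemma mx_part_phi a b (ab : a <= b) (abe : a + e%:num <= b + e%:num)
  (v : hpart M a) : mx_part (phi ab v) = phi abe (mx_part v).
Proof.
rewrite -persmod_mxE /mx_part -mulmxA FP.2 //.
have -> : to_coords (frM b) (phi ab v) = to_coords (frM a) v *m persmod_mx frM a b.
  by rewrite -{1}[v](@to_coordsK _ _ (frM a)) -persmod_mxE of_coordsK.
by rewrite -mulmxA FP.1.
Qed.

Lemma val_kscale (M' : persmod R k) a (c : k) (v : hpart M' a) :
  val (c *: v) = (c%:A : B1 R k) *: (val v : M') :> M'.
Proof. by []. Qed.

(** The matrices determine the map on homogeneous parts; it is glued by [direct_extension], and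
    commutes with powers of [x] because [F] commutes with the transition maps. *)
Lemma mx_morphism : exists f : persmor M (Defs.shift N e),
  forall a (v : hpart M a), pfun f (val v) = val (mx_part v) :> N.
Proof.
pose h (a : R) (m : M) : N := val (mx_part (homogeneous_part a m)).
have pdegB a (u v : kspace M) : pdeg a u -> pdeg a v -> pdeg a (u - v).
  by move=> ua va; rewrite addrC -scaleN1r; exact: pdeg_lin.
have hB a u v : pdeg a u -> pdeg a v -> h a (u - v) = h a u - h a v.
  move=> ua va; rewrite /h.
  have -> : homogeneous_part a (u - v) =
      (-1) *: homogeneous_part a v + homogeneous_part a u.
    apply/val_inj; rewrite scaleN1r raddfD raddfN /= !homogeneous_partE //.
      by rewrite addrC.
    exact: pdegB.
  by rewrite mx_part_linear scaleN1r raddfD raddfN [LHS]addrC.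
have [f [fB fh]] := direct_extension (pdeg_direct M) (@pdeg0 _ _ M) pdegB hB.
have fE a (v : hpart M a) : f (val v) = val (mx_part v).
  rewrite (fh a); last exact: pdeg_val.
  by congr (val (mx_part _)); apply/val_inj; rewrite homogeneous_partE //;
    exact: pdeg_val.
have f0 : f 0 = 0 by rewrite -(subrr 0) fB subrr.
have fD u v : f (u + v) = f u + f v.
  by rewrite -[v in LHS]opprK fB -[- v]sub0r fB f0 sub0r opprK.
have fsum (J : Type) (s : seq J) (u : J -> M) :
    f (\sum_(i <- s) u i) = \sum_(i <- s) f (u i).
  by apply: (big_morph f fD f0).
have fx a (g : expo R) (v : hpart M a) :
    f (xpow k g *: (val v : M)) = xpow k g *: f (val v).
  have ag : a <= a + g%:num by rewrite lerDl.
  have age : a + e%:num <= a + g%:num + e%:num by rewrite lerD2r.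
  have gapE (b : R) (bc : b <= b + g%:num) : gap bc = g.
    by apply/val_inj; rewrite /= addrC addKr.
  have -> : xpow k g *: (val v : M) = val (phi ag v) by rewrite /= gapE.
  rewrite !fE (mx_part_phi _ age) /=; congr (xpow k _ *: _).
  by apply/val_inj => /=; lra.
have fc a (c : k) (v : hpart M a) :
    f ((c%:A : B1 R k) *: (val v : M)) = (c%:A : B1 R k) *: f (val v).
  rewrite -val_kscale !fE -val_kscale.
  by have := mx_part_linear c v 0;
    rewrite !addr0 /mx_part !linear0 mul0mx linear0 addr0 => ->.
have flin : linear (f : M -> N).
  move=> p u v; rewrite fD; congr (_ + _).
  have [s [w [us wP ->]]] := (pdeg_direct M).1 u.
  have [r ->] := B1_expand p.
  rewrite scaler_suml !fsum scaler_suml; apply: eq_bigr => -[c g] _ /=.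
  rewrite !scaler_sumr fsum; apply: eq_bigr => a _.
  pose wa : hpart M a := Sub (w a) (mem_set (wP a)).
  have -> : w a = val wa by [].
  rewrite mulrC -!scalerA -val_kscale fx; congr (_ *: _).
  by rewrite val_kscale fc.
pose fl : {linear M -> N} := HB.pack (f : M -> N)
  (GRing.isLinear.Build (B1 R k) M N _ (f : M -> N) flin).
have fdeg a m : pdeg a m -> @pdeg R k (Defs.shift N e) a (fl m).
  move=> am; pose v : hpart M a := Sub m (mem_set am).
  have -> : fl m = val (mx_part v) by exact: (fE a v).
  exact: set_mem (valP (mx_part v)).
by exists (@PersMor R k M (Defs.shift N e) fl fdeg).
Qed.
End MatrixMorphism.

Lemma interleaved_of_minterleaved (R : realType) (k : fieldType)
    (M N : persmod R k) (frM : forall a, frame (hpart M a))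
    (frN : forall a, frame (hpart N a)) (e : expo R) :
  minterleaved e%:num (persmod_mx frM) (persmod_mx frN) -> interleaved M N e.
Proof.
case=> F [G [FP GP FG GF]].
have [f fE] := mx_morphism FP; have [g gE] := mx_morphism GP; exists f, g.
have comp (M' N' : persmod R k) (frM' : forall a, frame (hpart M' a))
    (frN' : forall a, frame (hpart N' a))
    (F' : forall a b, 'M[k]_(frame_dim (frM' a), frame_dim (frN' b)))
    (G' : forall a b, 'M[k]_(frame_dim (frN' a), frame_dim (frM' b)))
    (f' : persmor M' (Defs.shift N' e)) (g' : persmor N' (Defs.shift M' e)) :
    (forall a (v : hpart M' a), pfun f' (val v) = val (mx_part e F' v) :> N') ->
    (forall a (v : hpart N' a), pfun g' (val v) = val (mx_part e G' v) :> M') ->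
    (forall a b c : R, a + e%:num <= b -> b + e%:num <= c ->
       F' a b *m G' b c = persmod_mx frM' a c) ->
    forall m : M', shift_mor e g' (f' m) = smor M' (expo_add e e) m :> M'.
  move=> fE' gE' FG' m; rewrite /=.
  have [s [u [us uP ->]]] := (pdeg_direct M').1 m.
  rewrite !linear_sum; apply: eq_bigr => a _.
  pose v : hpart M' a := Sub (u a) (mem_set (uP a)).
  have -> : u a = val v by [].
  have ae : a <= a + e%:num + e%:num by rewrite -addrA lerDl addr_ge0.
  rewrite fE' gE' /mx_part of_coordsK -mulmxA FG' //.
  rewrite (persmod_mxE (fr := frM') ae) to_coordsK /=; congr (xpow k _ *: _).
  by apply/val_inj => /=; lra.
split; [exact: comp fE gE FG|exact: comp gE fE GF].
Qed.

(** * Barcodes of tame modules *)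

(** Turns a sequence of bars, with endpoints [c i] or [None] if the bar is to be dropped, into a
    diagram: the copies of [p] number the indices in the fiber over [p]. *)
Lemma fiber_enumeration (G : numDomainType) (c : nat -> option (upper G)) :
  (forall p, exists N, forall i, (N <= i)%N -> c i <> Some p) ->
  exists (D : diagram G) (nu : upper G * nat -> nat)
    (inv : nat -> option (upper G * nat)),
  [/\ forall x, copies D x -> c (nu x) = Some x.1,
      forall x, copies D x -> inv (nu x) = Some x,
      forall i p, c i = Some p -> exists2 x, inv i = Some x &
        [/\ copies D x, x.1 = p & nu x = i] &
      forall i x, inv i = Some x -> copies D x].
Proof.
move=> /choice[N NP]; pose l p := [seq i <- iota 0 (N p) | c i == Some p].
have lP p i : (i \in l p) = (c i == Some p).
  rewrite mem_filter mem_iota /=; case: eqP => //= cp.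
  by rewrite ltnNge; apply/negP => /NP.
have ul p : uniq (l p) by rewrite filter_uniq ?iota_uniq.
have c_nth p i : (i < size (l p))%N -> c (nth 0%N (l p) i) = Some p.
  by move=> il; apply/eqP; rewrite -lP mem_nth.
exists (fun p => size (l p)), (fun x => nth 0%N (l x.1) x.2),
  (fun i => omap (fun p => (p, index i (l p))) (c i)); split.
- by case=> p i; exact: c_nth.
- by case=> p i il /=; rewrite c_nth //= index_uniq.
- move=> i p cp; rewrite cp /=; exists (p, index i (l p)) => //; split=> //=.
    by rewrite /copies /= index_mem lP cp.
  by rewrite nth_index // lP cp.
- move=> i [p j]; case E : (c i) => [p'|//] /= [<- <-].
  by rewrite /copies /= index_mem lP E.
Qed.

Section RealBarcode.
Context (R : realType) (k : fieldType).

Definition rat_seq (i : nat) : R := ratr (odflt 0 (unpickle i : option rat)).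

Lemma rat_seq_dense : order_dense rat_seq.
Proof.
move=> x y xy; have [r] := rat_in_itvoo xy; rewrite in_itv /= => /andP[xr ry].
by exists (pickle r); rewrite /rat_seq pickleK /= !ltW.
Qed.

Lemma convex_ends (I : set R) (a b : R) : a < b -> I a -> I b ->
  (forall x y z, x <= y -> y <= z -> I x -> I z -> I y) ->
  exists p : upper R,
    (forall x, I x -> ((val p).1 <= x%:E)%E /\ (x%:E <= (val p).2)%E) /\
    (forall x, ((val p).1 < x%:E)%E -> (x%:E < (val p).2)%E -> I x).
Proof.
move=> ab Ia Ib Iconv; pose J := EFin @` I.
have JP x : I x -> (ereal_inf J <= x%:E)%E /\ (x%:E <= ereal_sup J)%E.
  by move=> Ix; split; [apply: ereal_inf_lbound|apply: ereal_sup_ubound]; exists x.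
have pP : (ereal_inf J < ereal_sup J)%E.
  apply: le_lt_trans (JP a Ia).1 _; apply: lt_le_trans (JP b Ib).2.
  by rewrite lte_fin.
exists (exist _ (ereal_inf J, ereal_sup J) pP); split=> //= x.
move=> /ereal_inf_lt[_ [y Iy <-] yx] /ereal_sup_gt[_ [z Iz <-] xz].
rewrite !lte_fin in yx xz.
exact: (Iconv y x z (ltW yx) (ltW xz)).
Qed.

Theorem barcode_exists (n : R -> nat) (A : @msystem k _ R n) :
  is_msystem A -> (forall a, A a a = 1%:M) ->
  exists D I e p, barcode A D I e p.
Proof.
move=> AP A1; have [I [e [p [bar orth fin full]]]] :=
  interval_decomposition_exists AP rat_seq_dense.
pose ends i (x : upper R) :=
    (forall a, I i a -> ((val x).1 <= a%:E)%E /\ (a%:E <= (val x).2)%E) /\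
    (forall a, ((val x).1 < a%:E)%E -> (a%:E < (val x).2)%E -> I i a).
(* Bars with at most one point have no such endpoints and are dropped. *)
pose c i := if pselect (exists x, ends i x) is left h then Some (sval (cid h))
  else None.
have cP i x : c i = Some x -> ends i x.
  by rewrite /c; case: pselect => // h [<-]; exact: svalP (cid h).
have cN i a b : a < b -> I i a -> I i b -> exists x, c i = Some x.
  move=> ab Ia Ib; rewrite /c; case: pselect => [h|[]]; first by eexists.
  exact: (convex_ends ab Ia Ib (bar_convex (bar i))).
have [|D [nu [inv [cnu invK invP invD]]]] := @fiber_enumeration R c.
  (* Bars with the same endpoints share an interior degree, so there are finitely many. *)
  move=> x; have [t /andP[xt tx]] := ereal_between (valP x).
  have [N NP] := fin t; exists N => i Ni /cP[_ Iin].
  exact: (NP i Ni (Iin t xt tx)).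
have nu_inj x y : copies D x -> copies D y -> nu x = nu y -> x = y.
  by move=> xD yD xy; have := invK x xD; rewrite xy invK // => -[].
exists D, (fun x => I (nu x)), (fun x => e (nu x)), (fun x => p (nu x)); split=> //.
- by move=> x a xD; exact: (cP _ _ (cnu x xD)).1.
- by move=> x a xD; exact: (cP _ _ (cnu x xD)).2.
- by move=> x y a xD yD xy; apply: orth => nxy; apply: xy; exact: nu_inj.
- move=> a; have [N NP] := fin a.
  exists [seq x <- undup (pmap inv (iota 0 N)) | `[< I (nu x) a >]].
    by rewrite filter_uniq ?undup_uniq.
  move=> x; rewrite mem_filter mem_undup; split=> [/andP[/asboolP Ia]|[xD Ia]].
    rewrite mem_pmap => /mapP[i _ /esym ix]; split=> //; exact: invD ix.
  apply/andP; split; first exact/asboolP.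
  rewrite mem_pmap; apply/mapP; exists (nu x); last by rewrite invK.
  rewrite mem_iota /= ltnNge; apply/negP => /NP; exact.
(* Factoring [A a b] through a rational degree [t] removes the remainder: the identity at [t] is a
   finite sum over bars. *)
- move=> a b s ab us sD sI; have [i /andP[aq qb]] := rat_seq_dense ab.
  set t := rat_seq i in aq qb; have [N NP] := fin t.
  transitivity (\sum_(j <- iota 0 N) p j a *m e j b).
    rewrite -(AP _ _ _ aq qb) -[A a t]mulmx1 -A1 (full i N NP) -/t.
    rewrite mulmx_sumr mulmx_suml
      -(big_mkord xpredT (fun j => A a t *m (p j t *m e j t) *m A t b)).
    rewrite /index_iota subn0; apply: eq_bigr => j _.
    have [Ij|nIj] := pselect (I j t).
      by rewrite mulmxA (bar_Bp (bar j)) // -mulmxA (bar_eB (bar j)).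
    by rewrite (bar_e0 (bar j) nIj) !mulmx0 mul0mx (bar_pe0 (bar j) aq qb nIj).
  transitivity (\sum_(j <- map nu s) p j a *m e j b); last by rewrite big_map.
  have umap : uniq (map nu s).
    by rewrite map_inj_in_uniq // => x y /sD xD /sD yD; exact: nu_inj.
  apply: eq_sum_support; rewrite ?iota_uniq // => j.
    move=> _ /negP jn; have [Ia|nIa] := pselect (I j a); last first.
      by rewrite (bar_p0 (bar j)) ?mul0mx.
    have [Ib|nIb] := pselect (I j b); last by rewrite (bar_e0 (bar j)) ?mulmx0.
    have [x cx] := cN j a b ab Ia Ib.
    have [y _ [yD _ yj]] := invP j x cx.
    by exfalso; apply: jn; apply/mapP; exists y; rewrite // sI ?yj.
  move=> _; rewrite mem_iota /= -leqNgt => /NP nIj.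
  exact: (bar_pe0 (bar j) aq qb nIj).
Qed.
End RealBarcode.

(** * Integer gradings *)

Lemma int_convex_lower (I : set int) (z0 : int) : I z0 ->
  (forall x y z, x <= y -> y <= z -> I x -> I z -> I y) ->
  exists2 a : \bar int, (a <= z0%:E)%E & forall z, z <= z0 -> I z <-> (a <= z%:E)%E.
Proof.
move=> I0 conv; have [all|/existsNP[m0 Im0]] :=
  pselect (forall m : nat, I (z0 - m%:Z)).
  exists -oo%E; rewrite ?leNye // => z zz0; split=> [_|_]; first by rewrite leNye.
  by have := all `|z0 - z|%N; rewrite gez0_abs ?subr_ge0 // subKr.
have [|m Im mP] := @ex_min_nat nat (fun m : nat => ~ I (z0 - m%:Z)) id.
  by exists m0.
have m1 : (0 < m)%N by case: m Im {mP} => //; rewrite subr0.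
(* [z0 - m] is the first degree below [z0] missing from [I], so [I] starts one above it. *)
exists (z0 - m%:Z + 1)%:E; first by rewrite lee_fin; lia.
move=> z zz0; rewrite lee_fin; split=> [Iz|mz].
  rewrite leNgt; apply/negP => zm; apply: Im; apply: conv Iz I0; lia.
apply: contrapT => nIz; have := mP `|z0 - z|%N; rewrite gez0_abs ?subr_ge0 // subKr.
by move=> /(_ nIz); lia.
Qed.

Lemma int_convex_upper (I : set int) (z0 : int) : I z0 ->
  (forall x y z, x <= y -> y <= z -> I x -> I z -> I y) ->
  exists2 b : \bar int, (z0%:E < b)%E & forall z, z0 <= z -> I z <-> (z%:E < b)%E.
Proof.
move=> I0 conv.
have [||a az0 aP] := @int_convex_lower (fun z => I (- z)) (- z0).
- by rewrite opprK.
- move=> x y z xy yz Ix Iz; apply: conv Iz Ix; lia.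
case: a az0 aP => [a|//|] az0 aP.
  (* Reflection makes [- a] the last degree of [I]; upper bounds are excluded, hence the 1. *)
  exists (- a + 1)%:E => [|z zz]; first by move: az0; rewrite lee_fin lte_fin; lia.
  by have := aP (- z); rewrite opprK => ->; rewrite ?lee_fin ?lte_fin; lia.
exists +oo%E => [|z zz]; first by rewrite ltry.
by have := aP (- z); rewrite opprK => ->; [rewrite ltry leNye|lia].
Qed.

Lemma int_convexP (I : set int) : (exists z, I z) ->
  (forall x y z, x <= y -> y <= z -> I x -> I z -> I y) ->
  exists p : upper int, forall z, I z <-> in_interval p z.
Proof.
move=> [z0 I0] conv; have [a az aP] := int_convex_lower I0 conv.
have [b zb bP] := int_convex_upper I0 conv.
exists (exist _ (a, b) (le_lt_trans az zb : (a, b).1 < (a, b).2)%E) => z.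
rewrite /in_interval /=; have [zz|/ltW zz] := leP z z0.
  rewrite (aP z zz); split=> [->|/andP[]//]; apply: le_lt_trans zb.
  by rewrite lee_fin.
rewrite (bP z zz); split=> [->|/andP[]//]; rewrite andbT; apply: le_trans az _.
by rewrite lee_fin.
Qed.

Lemma upper_int_inhabited (p : upper int) : exists z, in_interval p z.
Proof.
rewrite /in_interval; case: p => -[[a| |] [b| |]] //= ab.
- by exists a; rewrite lexx.
- by exists a; rewrite lexx ltry.
- by exists (b - 1); rewrite leNye lte_fin; lia.
- by exists 0; rewrite leNye ltry.
Qed.

Section IntegerBarcode.
Context (k : fieldType).

(** Over Z every degree is visited, so there is no remainder: one-point bars count, the supports are
    exact, and [zb_sum] decomposes the identity itself. *)
Record zbarcode (n : int -> nat) (A : @msystem k _ int n) (D : diagram int)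
    (e : upper int * nat -> forall z, 'rV[k]_(n z))
    (p : upper int * nat -> forall z, 'cV[k]_(n z)) : Prop := ZBarcode {
  zb_bar : forall x, copies D x -> is_bar A [set z | in_interval x.1 z] (e x) (p x);
  zb_orth : forall x y z, copies D x -> copies D y -> x <> y ->
    e x z *m p y z = 0;
  zb_fin : forall z, exists2 s : seq (upper int * nat), uniq s &
    forall x, x \in s <-> copies D x /\ in_interval x.1 z;
  zb_sum : forall z (s : seq (upper int * nat)), uniq s ->
    (forall x, x \in s -> copies D x) ->
    (forall x, copies D x -> in_interval x.1 z -> x \in s) ->
    1%:M = \sum_(x <- s) p x z *m e x z }.

Definition int_seq (i : nat) : int := odflt 0 (unpickle i : option int).

Lemma int_seqP z : exists i, int_seq i = z.
Proof. by exists (pickle z); rewrite /int_seq pickleK. Qed.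

Lemma int_seq_dense : order_dense int_seq.
Proof.
by move=> x y xy; have [i ix] := int_seqP x; exists i; rewrite ix lexx ltW.
Qed.

Theorem zbarcode_exists (n : int -> nat) (A : @msystem k _ int n) :
  is_msystem A -> (forall z, A z z = 1%:M) ->
  exists D e p, zbarcode A D e p.
Proof.
move=> AP A1; have [I [e [p [bar orth fin full]]]] :=
  interval_decomposition_exists AP int_seq_dense.
pose c i := if pselect (exists x : upper int, forall z, I i z <->
  in_interval x z) is left h
  then Some (sval (cid h)) else None.
have cP i x : c i = Some x -> I i = [set z | in_interval x z].
  rewrite /c; case: pselect => // h [<-]; apply/funext => z; apply/propext.
  exact: (svalP (cid h) z).
have cN i z : I i z -> exists x, c i = Some x.
  move=> Iz; rewrite /c; case: pselect => [h|[]]; first by eexists.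
  by apply: int_convexP; [exists z|exact: bar_convex (bar i)].
have [|D [nu [inv [cnu invK invP invD]]]] := @fiber_enumeration int c.
  move=> x; have [t xt] := upper_int_inhabited x.
  have [N NP] := fin t; exists N => i Ni /cP Ii.
  by apply: (NP i Ni); rewrite Ii.
have nu_inj x y : copies D x -> copies D y -> nu x = nu y -> x = y.
  by move=> xD yD xy; have := invK x xD; rewrite xy invK // => -[].
exists D, (fun x => e (nu x)), (fun x => p (nu x)); split=> //.
- by move=> x xD; rewrite -(cP _ _ (cnu x xD)).
- by move=> x y a xD yD xy; apply: orth => nxy; apply: xy; exact: nu_inj.
- move=> a; have [N NP] := fin a.
  exists [seq x <- undup (pmap inv (iota 0 N)) | in_interval x.1 a].
    by rewrite filter_uniq ?undup_uniq.
  move=> x; rewrite mem_filter mem_undup; split=> [/andP[Ia]|[xD Ia]].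
    rewrite mem_pmap => /mapP[i _ /esym ix]; split=> //; exact: invD ix.
  rewrite Ia mem_pmap; apply/mapP; exists (nu x); last by rewrite invK.
  rewrite mem_iota /= ltnNge; apply/negP => /NP; apply.
  by rewrite (cP _ _ (cnu x xD)).
- move=> z s us sD sI; have [i iz] := int_seqP z.
  have [N NP] := fin z; rewrite -A1 -iz (full i N) ?iz //.
  rewrite -(big_mkord xpredT (fun j => p j z *m e j z)) /index_iota subn0.
  transitivity (\sum_(j <- map nu s) p j z *m e j z); last by rewrite big_map.
  have umap : uniq (map nu s).
    by rewrite map_inj_in_uniq // => x y /sD xD /sD yD; exact: nu_inj.
  apply: eq_sum_support; rewrite ?iota_uniq // => j.
    move=> _ /negP jn; have [Iz|nIz] := pselect (I j z); last first.
      by rewrite (bar_p0 (bar j)) ?mul0mx.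
    have [x cx] := cN j z Iz; have [y _ [yD yx yj]] := invP j x cx.
    exfalso; apply: jn; apply/mapP; exists y; rewrite // sI //.
    by move: Iz; rewrite (cP _ _ cx) yx.
  move=> _; rewrite mem_iota /= -leqNgt => /NP nIj.
  by rewrite (bar_p0 (bar j)) ?mul0mx.
Qed.
End IntegerBarcode.

(** * Interval decompositions of graded modules and their bars *)

Lemma bool_mx1 (k : fieldType) (b c d : bool) : (b -> d -> c) ->
  (const_mx 1 : 'M[k]_(b, c)) *m const_mx 1 = const_mx 1 :> 'M[k]_(b, d).
Proof.
case: b c d => [] [] [] // bcd; apply/matrixP => i j;
  try by [case: i | case: j | have := bcd isT isT].
by rewrite !mxE big_ord1 !mxE mulr1.
Qed.

Lemma bool_row_eq (k : fieldType) (b : bool) (bF : ~ b) (u v : 'rV[k]_b) : u = v.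
Proof. by case: b bF u v => // _ u v; apply/rowP => -[]. Qed.

Lemma const_mx1_1 (k : fieldType) : const_mx 1 = 1 :> 'M[k]_1.
Proof. by apply/matrixP => i j; rewrite !mxE !ord1. Qed.

Section IntervalDecomposition.
Context (k : fieldType) (V : zgraded k) (fr : forall z, frame (zpart V z)).

Definition zgraded_mx : @msystem k _ int (fun z => frame_dim (fr z)) :=
  tr_mx (fun a b (ab : (a <= b)%O) => ztr V ab) fr.

Lemma zgraded_mxE a b (ab : a <= b) v :
  of_coords (fr b) (v *m zgraded_mx a b) = ztr V ab (of_coords (fr a) v).
Proof. exact: tr_mxE. Qed.

Lemma zgraded_mx_id a : zgraded_mx a a = 1%:M.
Proof. by apply: tr_mx_id => b bb v; exact: ztr_id. Qed.

Lemma zgraded_mx_system : is_msystem zgraded_mx.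
Proof. by apply: tr_mx_system => a b c ab bc ac v; exact: ztr_comp. Qed.

Section BarMorphism.
Context (q : upper int) (e : forall z, 'rV[k]_(frame_dim (fr z)))
  (p : forall z, 'cV[k]_(frame_dim (fr z))).
Hypothesis bar : is_bar zgraded_mx [set z | in_interval q z] e p.

(** The constant matrix identifies the part of the interval module, of dimension 0 or 1, with a
    subspace of [k]. *)
Definition bar_fun z : {linear zpart (interval_module k q) z -> zpart V z} :=
  (of_coords (fr z) \o mulmxr ((const_mx 1 : 'M[k]_(in_interval q z, 1)) *m e
    z))%FUN.

Lemma bar_funE z (v : 'rV[k]_(in_interval q z)) :
  bar_fun z v = of_coords (fr z)
    (v *m (const_mx 1 : 'M[k]_(in_interval q z, 1)) *m e z).
Proof. by rewrite /bar_fun /= mulmxA. Qed.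

Lemma bar_fun_tr y z (yz : y <= z) v :
  bar_fun z (ztr (interval_module k q) yz v) = ztr V yz (bar_fun y v).
Proof.
rewrite !bar_funE /= -zgraded_mxE; congr (of_coords _ _).
have [Iy|nIy] := pselect (in_interval q y); last first.
  by rewrite (bool_row_eq nIy v 0) !mul0mx.
rewrite -[RHS]mulmxA (bar_eB bar yz Iy) -(mulmxA v).
have [Iz|nIz] := pselect (in_interval q z); last first.
  by rewrite (bar_e0 bar) ?mulmx0.
by rewrite (@bool_mx1 k _ (in_interval q z) true).
Qed.

Lemma bar_fun_inj z : injective (bar_fun z).
Proof.
move=> u v; rewrite !bar_funE => /(can_inj (@of_coordsK _ _ (fr z))) uv.
have [Iz|nIz] := pselect (in_interval q z); last first.
  exact: bool_row_eq.
have : u *m const_mx 1 = v *m const_mx 1 :> 'rV[k]_1.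
  move: uv => /(congr1 (mulmx^~ (p z))); rewrite -!mulmxA.
  by rewrite (bar_ep bar Iz) !mulmx1.
move=> /(congr1 (mulmx^~ (const_mx 1 : 'M[k]_(1, in_interval q z)))).
rewrite -!mulmxA (@bool_mx1 k (in_interval q z) true (in_interval q z)) //.
suff -> : const_mx 1 = 1%:M :> 'M[k]_(in_interval q z) by rewrite !mulmx1.
move: (in_interval q z) => b; apply/matrixP; case: b => i j; last by case: i.
by rewrite !mxE !ord1.
Qed.

Lemma range_bar_fun z x : range (bar_fun z) x <->
  exists y : 'M[k]_1, x = of_coords (fr z) (y *m e z).
Proof.
split=> [[v _ <-]|[y ->]]; first by exists (v *m const_mx 1); rewrite bar_funE.
have [Iz|nIz] := pselect (in_interval q z).
  exists (y *m (const_mx 1 : 'M[k]_(1, in_interval q z))) => //.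
  by rewrite bar_funE -(mulmxA y) (@bool_mx1 k true _ true) // const_mx1_1 mulmx1.
by exists 0 => //; rewrite linear0 (bar_e0 bar) ?mulmx0 ?linear0.
Qed.

Definition bar_zmor : zmor (interval_module k q) V := ZMor bar_fun_tr.
End BarMorphism.

Lemma interval_decomposition_of_zbarcode D e p :
  zbarcode zgraded_mx D e p -> interval_decomposition V D.
Proof.
move=> zb; pose J := {j : upper int * nat | (j.2 < D j.1)%N}.
have bar (j : J) := zb_bar zb (svalP j : copies D (val j)).
exists (fun j : J => bar_zmor (bar j)); split=> [j z|z].
  exact: (bar_fun_inj (bar j)).
split=> [v|s u us uP u0 j js].
  have [s us sP] := zb_fin zb z.
  pose w := to_coords (fr z) v.
  pose sJ : seq J := pmap insub s.
  exists sJ, (fun j => of_coords (fr z) (w *m p (val j) z *m e (val j) z)); split.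
  - exact: pmap_sub_uniq.
  - by move=> j; apply/(range_bar_fun (bar j)); exists (w *m p (val j) z).
  - rewrite -linear_sum -[v](@to_coordsK _ _ (fr z)) -/w; congr (of_coords _ _).
    rewrite -[w in LHS]mulmx1 (zb_sum zb us); first last.
    + by move=> x xD xz; apply/sP.
    + by move=> x /sP[].
    rewrite mulmx_sumr; under eq_bigr do rewrite mulmxA.
    have -> : s = map val sJ.
      rewrite /sJ (pmap_filter (insubK J)); apply/esym/all_filterP/allP => x.
      by move=> /sP[xD _]; rewrite isSome_insub.
    by rewrite big_map.
have /choice[y yE] i : exists y : 'M[k]_1, u i = of_coords (fr z)
  (y *m e (val i) z).
  by apply/(range_bar_fun (bar i)); exact: uP.
have : to_coords (fr z) (\sum_(i <- s) u i) *m p (val j) z = 0.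
  by rewrite u0 linear0 mul0mx.
rewrite linear_sum mulmx_suml (bigD1_seq j) //= big1 ?addr0 => [|i ij]; last first.
  rewrite yE of_coordsK -mulmxA (zb_orth zb) ?mulmx0 //; try exact: svalP.
  by move=> /val_inj/eqP; rewrite (negPf ij).
rewrite yE of_coordsK -mulmxA.
have [Iz|nIz] := pselect (in_interval (val j).1 z).
  by rewrite (bar_ep (bar j)) // mulmx1 => ->; rewrite mul0mx linear0.
by rewrite (bar_e0 (bar j)) // mulmx0 linear0.
Qed.
End IntervalDecomposition.

(** The rows [e j] form an invertible matrix; the [p j] are the columns of its inverse. *)
Lemma dual_family (k : fieldType) (J : eqType) n (e : J -> 'rV[k]_n) (s : seq J) :
  uniq s ->
  (forall c, \sum_(j <- s) c j *: e j = 0 -> forall j, j \in s -> c j = 0) ->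
  (forall w, exists c, w = \sum_(j <- s) c j *: e j) ->
  exists p : J -> 'cV[k]_n, [/\ forall j, j \notin s -> p j = 0,
    forall i j, i \in s -> j \in s -> e i *m p j = (i == j)%:R &
    1%:M = \sum_(j <- s) p j *m e j].
Proof.
move=> us free span; case Es : s => [|j0 s'].
  exists (fun=> 0); split=> //; rewrite big_nil; apply/row_matrixP => i.
  by have [c] := span (row i 1%:M); rewrite Es big_nil => ->; rewrite row0.
rewrite -Es; pose E := \matrix_(i < size s) e (nth j0 s i).
pose pos j : option 'I_(size s) := insub (index j s).
have posK (i : 'I_(size s)) : pos (nth j0 s i) = Some i.
  by rewrite /pos index_uniq // valK.
have nth_pos j : j \in s -> exists2 i : 'I_(size s), j = nth j0 s i & pos j =
  Some i.
  by rewrite -index_mem => js; exists (Ordinal js);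
    rewrite /pos ?insubT //= nth_index -?index_mem.
have combE (c : 'rV[k]_(size s)) :
    c *m E = \sum_(j <- s) oapp (c 0) 0 (pos j) *: e j.
  rewrite (big_nth j0) big_mkord mulmx_sum_row; apply: eq_bigr => i _.
  by rewrite posK rowK.
have /row_freeP[B EB] : row_free E.
  apply: inj_row_free => c; rewrite combE => /free c0; apply/rowP => i.
  by have := c0 (nth j0 s i) (mem_nth _ (ltn_ord i)); rewrite posK mxE.
have /row_fullP[B' BE'] : row_full E.
  rewrite -sub1mx; apply/row_subP => i; have [c ->] := span (row i 1%:M).
  apply/submxP; exists (\row_l c (nth j0 s l)); rewrite combE.
  rewrite big_seq [RHS]big_seq; apply: eq_bigr => j /nth_pos[l jl ->].
  by rewrite /= mxE -jl.
have BE : B *m E = 1%:M by rewrite -[B]mul1mx -BE' -(mulmxA B') EB mulmx1.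
exists (fun j => oapp (fun i => col i B) 0 (pos j)); split.
- by move=> j js; rewrite /pos insubF // index_mem (negPf js).
- move=> i j /nth_pos[i' ii' _] /nth_pos[j' jj' ->] /=.
  have -> : e i = row i' E by rewrite rowK -ii'.
  rewrite rowE colE mulmxA -(mulmxA _ E) EB mulmx1 -rowE.
  apply/matrixP => a b; rewrite !mxE !ord1 ii' jj' nth_uniq // -val_eqE eqxx andbT.
  by case: eqP => _; rewrite !mxE.
- rewrite -BE (big_nth j0) big_mkord; apply/matrixP => a b; rewrite mxE summxE.
  by apply: eq_bigr => i _; rewrite posK /= !mxE big_ord1 !mxE.
Qed.

Lemma bool_row_scale (k : fieldType) (b : bool) (v : 'rV[k]_b) :
  exists c, v = c *: const_mx 1.
Proof.
case: b v => v; last by exists 0; exact: bool_row_eq.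
by exists (v 0 0); apply/rowP => i; rewrite !mxE !ord1 mulr1.
Qed.

Lemma const_row_neq0 (k : fieldType) (b : bool) :
  b -> const_mx 1 != 0 :> 'rV[k]_b.
Proof.
case: b => // _; apply/eqP => /rowP/(_ 0); rewrite !mxE => /eqP.
by rewrite oner_eq0.
Qed.

Section BarsOfDirectSum.
Context (k : fieldType) (V : zgraded k) (fr : forall z, frame (zpart V z)).
Context (D : diagram int).
Let J := {j : upper int * nat | (j.2 < D j.1)%N}.
Context (h : forall j : J, zmor (interval_module k (val j).1) V).
Hypotheses (h_inj : forall j z, injective (zfun (h j) z))
  (h_dd : forall z, direct_decomposition (fun j => range (zfun (h j) z))).

Let eJ (j : J) z : 'rV[k]_(frame_dim (fr z)) := to_coords (fr z)
  (zfun (h j) z (const_mx 1 : 'rV[k]_(in_interval (val j).1 z))).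

Let eJ_range j z x : range (zfun (h j) z) x <->
  exists c, to_coords (fr z) x = c *: eJ j z.
Proof.
split=> [[v _ <-]|[c xE]].
  have [c ->] := bool_row_scale (v : 'rV[k]_(in_interval (val j).1 z)).
  by exists c; rewrite /eJ -!linearZ.
exists (c *: (const_mx 1 : 'rV[k]_(in_interval (val j).1 z))) => //.
by apply: (can_inj (@to_coordsK _ _ (fr z))); rewrite xE /eJ -!linearZ.
Qed.

Let eJ_neq0 j z : in_interval (val j).1 z -> eJ j z != 0.
Proof.
move=> Iz; apply/eqP => e0.
have : zfun (h j) z (const_mx 1 : 'rV[k]_(in_interval (val j).1 z)) = zfun (h j)
  z 0.
  by apply: (can_inj (@to_coordsK _ _ (fr z))); rewrite [LHS]e0 !linear0.
by move=> /h_inj; apply/eqP; exact: const_row_neq0.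
Qed.

Let eJ0 j z : ~ in_interval (val j).1 z -> eJ j z = 0.
Proof.
move=> nI; rewrite /eJ; have -> : const_mx 1 = 0 :>
  'rV[k]_(in_interval (val j).1 z).
  exact: bool_row_eq.
by rewrite !linear0.
Qed.

Let eJ_tr j y z : y <= z -> in_interval (val j).1 y ->
  eJ j y *m zgraded_mx fr y z = eJ j z.
Proof.
move=> yz Iy; apply: (can_inj (@of_coordsK _ _ (fr z))).
rewrite (zgraded_mxE yz) !to_coordsK -zfun_tr; congr (zfun _ _ _).
exact: (@bool_mx1 k true _ _ (fun _ _ => Iy)).
Qed.

Let eJ_free z (s : seq J) (c : J -> k) : uniq s ->
  \sum_(j <- s) c j *: eJ j z = 0 ->
  forall j, j \in s -> in_interval (val j).1 z -> c j = 0.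
Proof.
move=> us c0 j js Iz.
have cj : of_coords (fr z) (c j *: eJ j z) = 0.
  apply: ((h_dd z).2 s (fun j => of_coords (fr z) (c j *: eJ j z)) us _ _ j js).
    by move=> i; apply/eJ_range; exists (c i); rewrite of_coordsK.
  by rewrite -linear_sum c0 linear0.
have : c j *: eJ j z = 0 by rewrite -[LHS](@of_coordsK _ _ (fr z)) cj linear0.
by move=> /eqP; rewrite scaler_eq0 (negPf (eJ_neq0 Iz)) orbF => /eqP.
Qed.

(** Finitely many summands already span degree [z]; any other summand alive there would depend on
    them. *)
Let eJ_list z : exists s : seq J, [/\ uniq s,
  forall j, j \in s <-> in_interval (val j).1 z &
  forall w, exists c, w = \sum_(j <- s) c j *: eJ j z].
Proof.
have /choice[S SP] : forall i : 'I_(frame_dim (fr z)), exists x : seq J * (J -> k),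
    uniq x.1 /\ delta_mx 0 i = \sum_(j <- x.1) x.2 j *: eJ j z.
  move=> i; have [s [u [us uP uE]]] := (h_dd z).1 (of_coords (fr z) (delta_mx 0 i)).
  have /choice[c cE] : forall j, exists c, to_coords (fr z) (u j) = c *: eJ j z.
    by move=> j; apply/eJ_range; exact: uP.
  exists (s, c); split=> //=; rewrite -[LHS](@of_coordsK _ _ (fr z)) uE linear_sum.
  by apply: eq_bigr => j _; rewrite cE.
pose s := [seq j <- undup (flatten
  [seq (S i).1 | i <- enum 'I_(frame_dim (fr z))]) |
  in_interval (val j).1 z].
have us : uniq s by rewrite filter_uniq ?undup_uniq.
have span w : exists c, w = \sum_(j <- s) c j *: eJ j z.
  have dE i : delta_mx 0 i =
      \sum_(j <- s) (if j \in (S i).1 then (S i).2 j else 0) *: eJ j z.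
    have [uS ->] := SP i.
    transitivity (\sum_(j <- (S i).1) (if j \in (S i).1 then (S i).2 j else 0)
      *: eJ j z).
      by rewrite big_seq [RHS]big_seq; apply: eq_bigr => j ->.
    apply: eq_sum_support => // j; last by move=> _ /negPf->; rewrite scale0r.
    move=> jS /negP js; rewrite eJ0 ?scaler0 // => Iz; apply: js.
    rewrite mem_filter Iz mem_undup; apply/flatten_mapP; exists i => //.
    by rewrite mem_enum.
  exists (fun j => \sum_i w 0 i * (if j \in (S i).1 then (S i).2 j else 0)).
  rewrite [LHS]row_sum_delta; under [RHS]eq_bigr do rewrite scaler_suml.
  rewrite exchange_big; apply: eq_bigr => i _ /=; rewrite dE scaler_sumr.
  by apply: eq_bigr => j _; rewrite scalerA.
exists s; split=> // j; split=> [|Iz]; first by rewrite mem_filter => /andP[].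
apply: contrapT => /negP js; have [c cE] := span (eJ j z).
(* Moving [eJ j z] to the other side gives a relation with coefficient -1 at [j]. *)
have := @eJ_free z (j :: s) (fun i => if i == j then -1 else c i).
rewrite /= js us => /(_ isT); rewrite big_cons eqxx.
have -> : \sum_(i <- s) (if i == j then -1 else c i) *: eJ i z = eJ j z.
  rewrite [RHS]cE big_seq [RHS]big_seq; apply: eq_bigr => i si.
  by case: eqP si => [->|//]; rewrite (negPf js).
rewrite scaleN1r addNr => /(_ erefl j (mem_head _ _) Iz); rewrite eqxx => /eqP.
by rewrite oppr_eq0 oner_eq0.
Qed.

(** The diagram chosen for a discretization comes with an unknown decomposition; reading bars off an
    arbitrary one replaces the uniqueness part of the structure theorem. *)
Lemma zbarcode_of_direct_sum : exists e p, zbarcode (zgraded_mx fr) D e p.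
Proof.
have /choice[s sP] := eJ_list.
have dual z : exists p : J -> 'cV[k]_(frame_dim (fr z)),
    [/\ forall j, j \notin s z -> p j = 0,
      forall i j, i \in s z -> j \in s z -> eJ i z *m p j = (i == j)%:R &
      1%:M = \sum_(j <- s z) p j *m eJ j z].
  have [us sI span] := sP z; apply: dual_family => // c c0 j js.
  by apply: (eJ_free us c0 js); exact/sI.
pose pJ z := sval (cid (dual z)); have pJP z := svalP (cid (dual z)).
pose e (x : upper int * nat) z : 'rV[k]_(frame_dim (fr z)) :=
  if insub x : option J is Some j then eJ j z else 0.
pose p (x : upper int * nat) z : 'cV[k]_(frame_dim (fr z)) :=
  if insub x : option J is Some j then pJ z j else 0.
have eE (j : J) z : e (val j) z = eJ j z by rewrite /e valK.
have pE (j : J) z : p (val j) z = pJ z j by rewrite /p valK.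
have lift x : copies D x -> exists j : J, val j = x by move=> xD; exists (Sub x xD).
have pJ0 j z : ~ in_interval (val j).1 z -> pJ z j = 0.
  move=> nI; have [p0 _ _] := pJP z; apply: p0; apply/negP => js; apply: nI.
  by have [_ sI _] := sP z; exact/sI.
have epJ i j z : eJ i z *m pJ z j = ((i == j) && in_interval (val j).1 z)%:R.
  have [Ij|/negP nIj] := boolP (in_interval (val j).1 z); last first.
    by rewrite pJ0 // mulmx0 andbF.
  rewrite andbT; have [Ii|nIi] := boolP (in_interval (val i).1 z); last first.
    rewrite eJ0 ?mul0mx; last exact/negP.
    by case: eqP nIi => // ->; rewrite Ij.
  have [_ pe _] := pJP z; have [_ sI _] := sP z.
  by apply: pe; exact/sI.
exists e, p; split.
- move=> _ /lift[j <-]; split=> /=.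
  + move=> a b c ab bc /andP[ja _] /andP[_ cj]; apply/andP; split.
      by apply: le_trans ja _; rewrite lee_fin.
    by apply: le_lt_trans cj; rewrite lee_fin.
  + by move=> z; rewrite eE; exact: eJ0.
  + by move=> z; rewrite pE; exact: pJ0.
  + by move=> a b ab Ia; rewrite !eE eJ_tr.
  + move=> a b ab Ib; rewrite !pE.
    (* Expand the identity at [a] in the dual bases; each [eJ] then moves forward to [b], where
       orthogonality leaves the term of [j]. *)
    have [_ _ sum1] := pJP a; rewrite -[LHS]mul1mx sum1 mulmx_suml.
    have [us sI _] := sP a.
    have term i : i \in s a -> pJ a i *m eJ i a *m (zgraded_mx fr a b *m pJ b j) =
        if i == j then pJ a j else 0.
      move=> /sI Ii; rewrite mulmxA -(mulmxA (pJ a i)) eJ_tr // -mulmxA epJ Ib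
        andbT.
      by case: eqP => [->|_]; rewrite ?mulmx1 ?mulmx0.
    rewrite big_seq; under eq_bigr do rewrite term //.
    rewrite -big_seq -big_mkcond /=.
    have [js|js] := boolP (j \in s a).
      by rewrite -big_filter filter_pred1_uniq // big_seq1.
    rewrite -big_filter (_ : [seq i <- s a | i == j] = [::]).
      by rewrite big_nil; apply/esym; have [p0 _ _] := pJP a; exact: p0.
    by apply/eqP; rewrite -(negbK (_ == _)) -has_filter has_pred1.
  + by move=> z Iz; rewrite eE pE epJ eqxx Iz.
- move=> _ _ z /lift[i <-] /lift[j <-] ij; rewrite eE pE epJ.
  by case: eqP => // ij'; case: ij; rewrite ij'.
- move=> z; have [us sI _] := sP z; exists (map val (s z)).
    by rewrite map_inj_uniq //; exact: val_inj.
  move=> x; split=> [/mapP[j /sI Iz ->]|[/lift[j <-] Iz]].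
    by split=> //; exact: (svalP j).
  by apply: map_f; exact/sI.
- move=> z r ur rD rI; have [us sI _] := sP z; have [_ _ ->] := pJP z.
  transitivity (\sum_(x <- map val (s z)) p x z *m e x z).
    by rewrite big_map; apply: eq_bigr => j _; rewrite eE pE.
  apply: eq_sum_support => //.
  + by rewrite map_inj_uniq //; exact: val_inj.
  + move=> _ /mapP[j /sI Iz ->] /negP nr; exfalso; apply: nr; apply: rI => //.
    exact: (svalP j).
  + move=> x xr; have [j <-] := lift x (rD x xr); rewrite eE => /negP nj.
    rewrite eJ0 ?mulmx0 // => Iz; apply: nj; apply: map_f; exact/sI.
Qed.
End BarsOfDirectSum.

(** * Discretizations *)

Section GridFloor.
Context (R : realType) (t : grid R) (d : R) (td : Defs.cover d t).

Lemma grid_leE y z : (t y <= t z) = (y <= z).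
Proof.
have [yz|zy] := leP y z; first exact: grid_le.
by rewrite leNgt; apply/negbF/grid_lt.
Qed.

Lemma grid_ltE y z : (t y < t z) = (y < z).
Proof. by rewrite !ltNge grid_leE. Qed.

Lemma grid_floor_exists (a : R) : exists z, t z <= a < t (z + 1).
Proof.
(* A grid point within [d] of [a - d] is at most [a]; the extra 1 puts the other strictly above
   [a]. *)
have [z0 z0a] := td (a - d); have [z1 z1a] := td (a + d + 1).
have t0 : t z0 <= a by move: z0a; rewrite ler_norml => /andP[]; lra.
have t1 : a < t z1 by move: z1a; rewrite ler_norml => /andP[]; lra.
have z01 : z0 < z1 by rewrite -grid_ltE; exact: le_lt_trans t1.
have [|m am mP] := @ex_min_nat nat (fun m : nat => a < t (z0 + m%:Z)) id.
  by exists `|z1 - z0|%N; rewrite gez0_abs ?subr_ge0 ?ltW // subrKC.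
have m0 : (0 < m)%N by case: m am {mP} => //; rewrite addr0 ltNge t0.
exists (z0 + m.-1%:Z); apply/andP; split.
  by rewrite leNgt; apply/negP => /mP; lia.
by rewrite (_ : z0 + m.-1%:Z + 1 = z0 + m%:Z) //; lia.
Qed.

Definition grid_floor (a : R) : int := sval (cid (grid_floor_exists a)).

Lemma grid_floorP a : t (grid_floor a) <= a < t (grid_floor a + 1).
Proof. exact: svalP (cid (grid_floor_exists a)). Qed.

Lemma grid_floor_ge a z : (z <= grid_floor a) = (t z <= a).
Proof.
have /andP[ta at1] := grid_floorP a.
have [za|az] := leP z (grid_floor a).
  by apply/esym; apply: le_trans ta; rewrite grid_leE.
apply/esym/negbTE; rewrite -ltNge; apply: lt_le_trans at1 _.
by rewrite grid_leE; lia.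
Qed.

Lemma grid_floor_le a b : a <= b -> grid_floor a <= grid_floor b.
Proof.
by move=> ab; rewrite grid_floor_ge (le_trans _ ab) //; have /andP[] :=
  grid_floorP a.
Qed.

(** The midpoint of two consecutive grid points is within [d] of the grid, so they are at most [2 d]
    apart. *)
Lemma grid_floor_gt a : a - (d + d) < t (grid_floor a).
Proof.
set z := grid_floor a; have /andP[ta at1] := grid_floorP a.
have [w wm] := td ((t z + t (z + 1)) / 2).
move: wm; rewrite ler_norml => /andP[w1 w2].
have [wz|zw] := leP w z.
  have tw : t w <= t z by rewrite grid_leE.
  rewrite -/z in at1; lra.
have tw : t (z + 1) <= t w by rewrite grid_leE; lia.
rewrite -/z in at1; lra.
Qed.
End GridFloor.

Section GridBarcode.
Context (R : realType) (k : fieldType) (t : grid R) (d : R) (td : Defs.cover d t).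
Context (n : int -> nat) (A : @msystem k _ int n) (AP : is_msystem A).
Context (D : diagram int) (E : diagram R) (DE : is_grid_image t D E).
Context (e : upper int * nat -> forall z, 'rV[k]_(n z))
  (p : upper int * nat -> forall z, 'cV[k]_(n z)) (zb : zbarcode A D e p).

Local Notation fl := (grid_floor td).

Definition floor_mx : @msystem k _ R (fun a => n (fl a)) :=
  fun a b => A (fl a) (fl b).

Fact grid_pt_subproof (q : upper int) :
  ((er_map t (val q).1, er_map t (val q).2).1 <
   (er_map t (val q).1, er_map t (val q).2).2)%E.
Proof.
case: q => -[[a| |] [b| |]] //= ab; rewrite ?ltry ?ltNyr //.
by rewrite lte_fin; apply: grid_lt; rewrite -lte_fin.
Qed.

Definition grid_pt (q : upper int) : upper R :=
  exist (fun p : \bar R * \bar R => is_true (p.1 < p.2)%E)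
    (er_map t (val q).1, er_map t (val q).2) (grid_pt_subproof q).

Lemma grid_pt_inj : injective grid_pt.
Proof.
have er_inj : injective (er_map t).
  have t_inj : injective t.
    by move=> a b ab; apply: le_anti; rewrite -!(grid_leE t) ab lexx.
  by move=> [a| |] [b| |] //= [/t_inj->].
by move=> [[a b] ab] [[a' b'] ab'] [/er_inj aa' /er_inj bb'];
  apply/val_inj => /=; rewrite aa' bb'.
Qed.

Lemma grid_copy_inj :
  injective (fun y : upper int * nat => (grid_pt y.1, y.2)).
Proof.
move=> [q i] [q' i'] H; have /grid_pt_inj /= -> := congr1 fst H.
by have /= -> := congr1 snd H.
Qed.

Lemma floor_in_interval q a :
  ((val (grid_pt q)).1 <= a%:E)%E /\ (a%:E < (val (grid_pt q)).2)%E <->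
  in_interval q (fl a).
Proof.
have lo (b : \bar int) : (er_map t b <= a%:E)%E = (b <= (fl a)%:E)%E.
  by case: b => [b| |] //=; rewrite ?leNye // !lee_fin grid_floor_ge.
have hi (b : \bar int) : (a%:E < er_map t b)%E = ((fl a)%:E < b)%E.
  by case: b => [b| |] /=; rewrite ?lte_fin ?ltry // !ltNge ?leNye // grid_floor_ge.
rewrite /in_interval /= lo hi; split=> [[-> ->]//|/andP[]//].
Qed.

Lemma barcode_of_grid :
  exists I e' p', barcode floor_mx E I e' p'.
Proof.
have copyE q i : copies E (grid_pt q, i) <-> copies D (q, i).
  by rewrite /copies /= (DE.2 (grid_pt q) q).
have copyP x : copies E x -> exists y, copies D y /\ (grid_pt y.1, y.2) = x.
  case: x => x i xE; have Ex : E x != 0%N by rewrite -lt0n (leq_ltn_trans _ xE).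
  have [q _ xq] := DE.1 x Ex; have xg : x = grid_pt q by exact/val_inj.
  by exists (q, i); split; [apply/copyE; rewrite -xg | rewrite /= xg].
have /choice[f fP] : forall x, exists y, copies E x -> copies D y /\
  (grid_pt y.1, y.2) = x.
  move=> x; have [/copyP[y yP]|nx] := pselect (copies E x); first by exists y.
  by exists (exist (fun p : \bar int * \bar int => is_true (p.1 < p.2)%E)
    (0%:E, +oo%E) (ltry 0), 0%N).
have fD x : copies E x -> copies D (f x) by move=> /fP[].
have f1 x : copies E x -> x.1 = grid_pt (f x).1 by move=> xE;
  rewrite -{1}(fP x xE).2.
have f_inj x y : copies E x -> copies E y -> f x = f y -> x = y.
  by move=> xE yE xy; rewrite -(fP x xE).2 -[RHS](fP y yE).2 xy.
have fK y : copies D y -> f (grid_pt y.1, y.2) = y.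
  case: y => q i yD; have /copyE/fP[_] := yD.
  by move=> H; apply: grid_copy_inj; exact: H.
exists (fun x => [set a | in_interval (f x).1 (fl a)]), (fun x a => e (f x) (fl a)),
  (fun x a => p (f x) (fl a)); split.
- by move=> a b c ab bc; apply: AP; exact: grid_floor_le.
- move=> x a xE /floor_in_interval[]; rewrite (f1 x xE) => xa ax; split=> //.
  exact: ltW.
- move=> x a xE; rewrite (f1 x xE) => xa ax; apply/floor_in_interval; split=> //.
  exact: ltW.
- move=> x xE; have [c e0 p0 eA Ap ep] := zb_bar zb (fD x xE).
  split=> [a b c' ab bc|a|a|a b ab|a b ab|a].
  + by apply: c; exact: grid_floor_le.
  + exact: e0.
  + exact: p0.
  + by apply: eA; exact: grid_floor_le.
  + by apply: Ap; exact: grid_floor_le.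
  + exact: ep.
- move=> x y a xE yE xy; apply: (zb_orth zb); try exact: fD.
  by move=> /(f_inj _ _ xE yE).
- move=> a; have [s us sP] := zb_fin zb (fl a).
  exists [seq (grid_pt y.1, y.2) | y <- s].
    by rewrite map_inj_uniq //; exact: grid_copy_inj.
  move=> x; split=> [/mapP[[q i] /sP[yD Iy] ->]|[xE Ix]].
    by split; [apply/copyE | rewrite /= (fK (q, i))].
  apply/mapP; exists (f x); last by have [_ ->] := fP x xE.
  by apply/sP; split; [exact: fD|].
- move=> a b s ab us sE sI; rewrite /floor_mx -[LHS]mul1mx.
  have fs : uniq (map f s).
    by rewrite map_inj_in_uniq // => x y /sE xE /sE yE; exact: f_inj.
  have [r ur rP] := zb_fin zb (fl a).
  rewrite (zb_sum zb ur); first last.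
  + by move=> x xD xI; apply/rP.
  + by move=> x /rP[].
  rewrite mulmx_suml; transitivity (\sum_(y <- r) p y (fl a) *m e y (fl b)).
    rewrite big_seq [RHS]big_seq; apply: eq_bigr => y /rP[yD Iy].
    by rewrite -mulmxA (bar_eB (zb_bar zb yD) (grid_floor_le td (ltW ab)) Iy).
  transitivity (\sum_(y <- map f s) p y (fl a) *m e y (fl b));
    last by rewrite big_map.
  apply: eq_sum_support => // y.
    move=> /rP[yD Iy] /negP ny; rewrite (bar_e0 (zb_bar zb yD)) ?mulmx0 // => Iyb.
    apply: ny; apply/mapP; exists (grid_pt y.1, y.2); last by rewrite fK.
    by apply: sI; [apply/copyE; case: (y) yD|rewrite /= fK|rewrite /= fK].
  move=> /mapP[x /sE xE ->] /negP nr.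
  rewrite (bar_p0 (zb_bar zb (fD x xE))) ?mul0mx // => Ix.
  by apply: nr; apply/rP; split; [exact: fD|].
Qed.
End GridBarcode.

Section DiscretizationLimit.
Context (R : realType) (k : fieldType) (M : persmod R k).
Context (fr : forall a, frame (hpart M a)).

Let zfr (t : grid R) (z : int) : frame (zpart (discretization M t) z) := fr (t z).

Lemma discretization_mxE (t : grid R) y z : y <= z ->
  zgraded_mx (zfr t) y z = persmod_mx fr (t y) (t z).
Proof.
move=> yz; apply: frame_mx_eq => v; rewrite (zgraded_mxE yz).
by rewrite (persmod_mxE (grid_le t yz)).
Qed.

(** Both morphisms are transition maps of [M]: rounding down lowers a degree by less than [2 d], so
    [a + 2 d <= b] gives [a <= t (fl b)], and [t (fl a) <= b] is immediate. *)
Lemma discretization_minterleaved (t : grid R) (d : R) (td : Defs.cover d t) :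
  minterleaved (d + d) (persmod_mx fr) (floor_mx td (zgraded_mx (zfr t))).
Proof.
have [w wd] := td 0; have d0 : 0 <= d by exact: le_trans wd.
pose fl := grid_floor td.
have fl_le a : t (fl a) <= a by have /andP[] := grid_floorP td a.
have fl_ge a b : a + (d + d) <= b -> a <= t (fl b).
  by move=> ab; have := grid_floor_gt td b; rewrite -/fl; lra.
have fl_mono a b : a <= b -> fl a <= fl b by exact: grid_floor_le.
have dd a b : a + (d + d) <= b -> a <= b by lra.
have AP := persmod_mx_system fr.
exists (fun a b => persmod_mx fr a (t (fl b))),
  (fun a b => persmod_mx fr (t (fl a)) b).
split.
- split=> [a' a b a'a ab|a b b' ab bb']; first by rewrite AP ?fl_ge.
  rewrite /floor_mx discretization_mxE ?fl_mono // AP //; first exact: fl_ge.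
  exact/grid_le/fl_mono.
- split=> [a' a b a'a ab|a b b' ab bb'].
    rewrite /floor_mx discretization_mxE ?fl_mono // AP //.
      exact/grid_le/fl_mono.
    exact: le_trans (fl_le a) (dd _ _ ab).
  by rewrite AP // (le_trans (fl_le a)) // dd.
- by move=> a b c ab bc; rewrite AP ?fl_ge // (le_trans (fl_le b)) // dd.
- move=> a b c ab bc; rewrite AP //; last exact: fl_ge.
    by rewrite /floor_mx discretization_mxE // fl_mono //
      (le_trans (dd _ _ ab)) // dd.
  by rewrite (le_trans (fl_le a)) // dd.
Qed.

Lemma discretization_diagramP (t : grid R) (d : R) : Defs.cover d t ->
  is_discretization_diagram M t (discretization_diagram M t).
Proof.
move=> td; have [D [e [p zb]]] := zbarcode_exists (zgraded_mx_system (zfr t))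
  (zgraded_mx_id (zfr t)).
pose E : diagram R := fun x =>
  if pselect (exists q, x = grid_pt t q) is left h then D (sval (cid h)) else 0%N.
have EE q : E (grid_pt t q) = D q.
  rewrite /E; case: pselect => [h|[]]; last by exists q.
  by congr (D _); apply: (@grid_pt_inj _ t); exact/esym/(svalP (cid h)).
apply: (@xgetPex _ _ [set E' | is_discretization_diagram M t E']); exists E.
exists D; first exact: interval_decomposition_of_zbarcode zb.
split=> [x|x q xq].
  rewrite /E; case: pselect => // h Dq; exists (sval (cid h)) => //.
  by rewrite {1}(svalP (cid h)).
by have -> : x = grid_pt t q by exact/val_inj.
Qed.

Context (D : diagram R) (I : upper R * nat -> set R)
  (e : upper R * nat -> forall a, 'rV[k]_(frame_dim (fr a)))
  (p : upper R * nat -> forall a, 'cV[k]_(frame_dim (fr a)))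
  (bc : barcode (persmod_mx fr) D I e p).

Lemma discretization_bclose (t : grid R) (d : R) : Defs.cover d t ->
  bclose (d + d) (discretization_diagram M t) D.
Proof.
move=> td; have [w wd] := td 0; have d0 : 0 <= d by exact: le_trans wd.
have [DZ [h [h_inj h_dd]] DE] := discretization_diagramP td.
have [e' [p' zb]] := zbarcode_of_direct_sum (zfr t) h_inj h_dd.
have [I'' [e'' [p'' bc']]] := barcode_of_grid td (zgraded_mx_system (zfr t)) DE zb.
apply/bclose_sym; apply: bclose_of_minterleaved bc bc' _; first by rewrite addr_ge0.
exact: discretization_minterleaved.
Qed.

Lemma dB_ge0 (D1 D2 : diagram R) : (0 <= dB D1 D2)%E.
Proof.
apply: le_ereal_inf_tmp => _ [m _ <-]; rewrite /matching_cost le_max; apply/orP;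
  left.
by apply: ereal_sup_ubound; left.
Qed.

Lemma barcode_is_persistence_diagram : is_persistence_diagram M D.
Proof.
move=> t tcov.
apply: (@squeeze_cvge _ _ _ _ (cst 0%E) _
  (fun i => ((2^-1) ^+ i + (2^-1) ^+ i : R)%:E)).
- near=> i; apply/andP; split; first exact: dB_ge0.
  apply: dB_le_of_bclose; first by rewrite addr_ge0 // exprn_ge0.
  by apply: discretization_bclose; apply: tcov; near: i; exact: nbhs_infty_gt.
- exact: cvg_cst.
- apply: cvg_EFin; first by near=> i.
  have h : (fun i => (2^-1) ^+ i : R) @ \oo --> (0 : R).
    by apply: cvg_expr; rewrite ger0_norm // invf_lt1 // ltr1n.
  by rewrite -[X in _ --> X]addr0; exact: (cvgD h h).
Unshelve. all: by end_near. Qed.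

End DiscretizationLimit.

(** * Dyadic grids *)

Section DyadicGrids.
Context (R : realType).

Definition dyadic_fun (i : nat) (z : int) : R := z%:~R * (2^-1) ^+ i.

Let step_gt0 i : 0 < (2^-1 : R) ^+ i.
Proof. by rewrite exprn_gt0 // invr_gt0 ltr0n. Qed.

Fact dyadic_lt i : {homo dyadic_fun i : y z / y < z}.
Proof. by move=> y z yz; rewrite /dyadic_fun ltr_pM2r // ltr_int. Qed.

(** Near a limit point there would be two distinct grid points less than one step apart. *)
Fact dyadic_acc i : limit_point (range (dyadic_fun i)) = set0.
Proof.
set d : R := (2^-1) ^+ i; have d0 : 0 < d by exact: step_gt0.
have gap y z : `|dyadic_fun i y - dyadic_fun i z| < d -> y = z.
  rewrite /dyadic_fun -/d -mulrBl normrM (gtr0_norm d0) -rmorphB /= -intr_norm.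
  by rewrite -[ltRHS]mul1r ltr_pM2r // ltrz1 => yz; lia.
apply/seteqP; split=> // x lim.
have [|y [yx [y' _ yE] xy]] := lim (ball x (d / 2)).
  by apply: nbhsx_ballx; rewrite divr_gt0.
have yx0 : 0 < `|x - y| by rewrite normr_gt0 subr_eq0 eq_sym.
have [|z [zx [z' _ zE] xz]] := lim (ball x `|x - y|).
  exact: nbhsx_ballx.
have xyd : `|x - y| < d / 2 by exact: xy.
have xzy : `|x - z| < `|x - y| by exact: xz.
have yz : y' = z'.
  apply: gap; rewrite yE zE; apply: le_lt_trans (ler_distD x y z) _.
  by rewrite (distrC y x); lra.
by move: xzy; rewrite -yE -zE yz ltxx.
Qed.

(** [is_persistence_diagram] quantifies over admissible sequences of grids; this one makes it
    possible to extract information from it. *)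
Definition dyadic_grid i : grid R := Grid (@dyadic_lt i) (@dyadic_acc i).

Lemma dyadic_cover i : Defs.cover ((2^-1) ^+ i) (dyadic_grid i).
Proof.
move=> x; set d : R := (2^-1) ^+ i; have d0 : 0 < d by exact: step_gt0.
exists (Num.floor (x / d)); rewrite /= /dyadic_fun -/d.
have := floor_itv (x / d); rewrite intrD => /andP[].
rewrite -(ler_pM2r d0) -(ltr_pM2r d0) mulfVK ?gt_eqF // mulrDl mul1r => lo hi.
by rewrite ger0_norm ?subr_ge0 // lerBlDl ltW.
Qed.
End DyadicGrids.

(** * The isometry *)

Section Isometry.
Context (R : realType) (k : fieldType).

(** The chosen diagram and the barcode are limits of the same sequence of discretizations, and the
    triangle inequality at a late index compares them. *)
Lemma persistence_diagram_bclose (M : persmod R k) : tame M ->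
  exists (fr : forall a, frame (hpart M a)) (D : diagram R) I e p,
    barcode (persmod_mx fr) D I e p /\
    forall d, 0 < d -> bclose d (persistence_diagram M) D.
Proof.
move=> tameM; pose fr a := sval (cid (frame_exists (tameM a))).
have [D [I [e [p bc]]]] := barcode_exists (persmod_mx_system fr) (persmod_mx_id fr).
exists fr, D, I, e, p; split=> // d d0; set P := persistence_diagram M.
have lim (D' : diagram R) : is_persistence_diagram M D' ->
    \forall i \near \oo, (dB (discretization_diagram M (dyadic_grid R i)) D' <
      (d / 2)%:E)%E.
  move=> /(_ (@dyadic_grid R)) /(_ (fun i _ => dyadic_cover i)) cv.
  apply: (cv [set y : \bar R | (y < (d / 2)%:E)%E]); apply: open_nbhs_nbhs;
    split; first exact: open_ereal_lt_ereal.
  by rewrite /= lte_fin divr_gt0.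
have DP := barcode_is_persistence_diagram bc.
have PP : is_persistence_diagram M P.
  by apply: (@xgetPex _ _ [set D' | is_persistence_diagram M D']); exists D.
have [i [iP iD]] := filter_ex (filterI (lim _ PP) (lim _ DP)).
have d20 : 0 < d / 2 by rewrite divr_gt0.
have [c /andP[c0 cd] cP] := bclose_of_dB d20 iP.
have [c' /andP[c'0 c'd] c'D] := bclose_of_dB d20 iD.
apply: (@bclose_le _ (c + c')); first lra.
exact: bclose_trans (bclose_sym cP) c'D.
Qed.

Lemma ereal_le_real (x y : \bar R) :
  (forall r : R, (x < r%:E)%E -> (y <= r%:E)%E) ->
  (y <= x)%E.
Proof.
move=> H; rewrite leNgt; apply/negP => /ereal_between[r /andP[xr ry]].
by have := H r xr; rewrite leNgt ry.
Qed.

End Isometry.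

Theorem theorem2p4p2 (R : realType) (k : fieldType) (M N : persmod R k)
    (tame_M : tame M) (tame_N : tame N) :
  dB_mod M N = dI M N.
Proof.
have [frM [DM [IM [eM [pM [bcM PM]]]]]] := persistence_diagram_bclose tame_M.
have [frN [DN [IN [eN [pN [bcN PN]]]]]] := persistence_diagram_bclose tame_N.
apply: le_anti; apply/andP; split; apply: ereal_le_real => r.
  move=> /ereal_inf_lt[_ [e eI <-]]; rewrite lte_fin => er.
  have /(bclose_of_minterleaved (ge0 e) bcM bcN) DMN :=
    minterleaved_of_interleaved frM frN eI.
  (* The slack [r - e] is shared between the passages from the two chosen diagrams to the
     barcodes. *)
  pose d := (r - e%:num) / 2; have d0 : 0 < d by rewrite divr_gt0 // subr_gt0.
  have e0 : 0 <= e%:num by []; have d0' : 0 <= d by exact: ltW.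
  rewrite /dB_mod; apply: dB_le_of_bclose; first by apply: le_trans (ltW er).
  have -> : r = d + (e%:num + d) by rewrite /d; lra.
  apply: (bclose_trans _ _ (PM d d0)); rewrite ?addr_ge0 //.
  by apply: (bclose_trans _ _ DMN (bclose_sym (PN d d0))).
move=> dBr; have r0 : 0 < r by rewrite -lte_fin;
  exact: le_lt_trans (dB_ge0 _ _) dBr.
have [c /andP[c0 cr] cP] := bclose_of_dB r0 dBr.
(* With a third of the slack for each passage to a barcode, the total cost stays strictly below [r],
   as [minterleaved_of_bclose] requires. *)
pose d := (r - c) / 3; have d0 : 0 < d by rewrite divr_gt0 // subr_gt0.
have d0' : 0 <= d by exact: ltW.
have DMN : bclose (d + (c + d)) DM DN.
  apply: (bclose_trans _ _ (bclose_sym (PM d d0))); rewrite ?addr_ge0 //.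
  by apply: (bclose_trans _ _ cP (PN d d0)).
have dr : d + (c + d) < r by rewrite /d; lra.
have dc0 : 0 <= d + (c + d) by rewrite !addr_ge0.
have := minterleaved_of_bclose dc0 dr bcM bcN DMN.
move=> /(@interleaved_of_minterleaved _ _ _ _ _ _ (NngNum (ltW r0))) MN.
by apply: ereal_inf_lbound; exists (NngNum (ltW r0)).
Qed.
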